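(* Assume the integrability condition $\int_{\mathrm{supp}(f)} |f(s)|^{\beta+\frac{c-1}{2}}\,ds<\infty$ holds. Then: (a) For every $v\in L^2(\mathbb{R}^\times,|x|^c dx)$ for which equation (E) has a solution $w\in L^2(\mathbb{R}^\times,|x|^c dx)$, this solution is unique, if and only if $m_{f,+}\neq 0$ and $m_{f,-}\neq 0$ Lebesgue-almost everywhere on $\mathbb{R}$. (b) Equation (E) has a solution $w\in L^2(\mathbb{R}^\times,|x|^c dx)$ for every $v\in L^2(\mathbb{R}^\times,|x|^c dx)$ if and only if $\inf_{x\in\mathbb{R}}|m_{f,+}(x)|>0$ and $\inf_{x\in\mathbb{R}}|m_{f,-}(x)|>0$. (c) Let $\alpha\ge 0$ and $\gamma>0$ be such that $|m_{f,\pm}(x)|\ge \frac{\gamma}{1+|x|^\alpha}$ for all $x\in\mathbb{R}$. If $v\in L^2(\mathbb{R}^\times,|x|^c dx)$ and both functions $x\mapsto (\mathcal{M}v)(e^x)=e^{(c+1)x/2}v(e^x)$ and $x\mapsto(\mathcal{M}v)(-e^x)=e^{(c+1)x/2}v(-e^x)$ belong to $H^\alpha(\mathbb{R})$, then (E) has a unique solution $w\in L^2(\mathbb{R}^\times,|x|^c dx)$.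
   Context: Let $\mathbb{R}^\times=\mathbb{R}\setminus\{0\}$. Let $d\ge 1$, let $f:\mathbb{R}^d\to\mathbb{R}$ be Borel measurable and $\mathrm{supp}(f):=\{s\in\mathbb{R}^d: f(s)\neq 0\}$. Fix $c\ge 0$ and $\beta\in\mathbb{R}$, and let $u:\mathbb{R}^\times\to\mathbb{R}$ be either $u(x)=|x|^\beta$ for all $x$, or $u(x)=\mathrm{sgn}(x)|x|^\beta$ for all $x$. Function spaces are of complex-valued functions (the results are the same for real-valued ones). For given $v\in L^2(\mathbb{R}^\times,|x|^c dx)$, equation (E) for the unknown $w$ is $v(x)=\int_{\mathrm{supp}(f)} \frac{u(f(s))}{|f(s)|}\, w\!\left(\frac{x}{f(s)}\right) ds$ for a.e. $x\in\mathbb{R}^\times$ (this is the relation $uv_1 = $ RHS with $w=uv_0$ between the Lévy density $v_0$ of an infinitely divisible random measure and the Lévy density $v_1$ of the moving average $\int f(t-x)\Lambda(dx)$). Define $m_{f,+}(x)=\int_{\mathrm{supp}(f)} u(f(s))|f(s)|^{(c-1)/2}e^{-ix\log|f(s)|}ds$, $m_{f,-}(x)=\int_{\mathrm{supp}(f)} u(f(s))|f(s)|^{(c-1)/2}e^{-ix\log|f(s)|}\,\mathrm{sgn} f(s)\,ds$ for $x\in\mathbb{R}$. $\mathcal{M}:L^2(\mathbb{R}^\times,|x|^cdx)\to L^2(\mathbb{R}^\times,\frac{dx}{|x|})$ is $(\mathcal{M}u)(x)=|x|^{(c+1)/2}u(x)$. For $\alpha\ge0$, $H^\alpha(\mathbb{R})=\{\varphi\in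 L^2(\mathbb{R}):\int_{\mathbb{R}}|(\mathcal{F}_+\varphi)(\xi)|^2(1+\xi^2)^\alpha d\xi<\infty\}$, where $\mathcal{F}_+$ is the usual Fourier transform on $\mathbb{R}$. *)

(* Defs.v *)
From HB Require Import structures.
From mathcomp Require Import all_boot all_order all_algebra.
From mathcomp Require Import all_classical all_reals all_analysis.
From mathcomp Require Import complex.
Import Order.TTheory GRing.Theory Num.Theory.
Local Open Scope classical_set_scope.
Local Open Scope ring_scope.
Section prodm.
Local Open Scope ereal_scope.
Context {R : realType} {d1 d2 : measure_display} {T1 : measurableType d1} {T2 : measurableType d2}.
Variables (m1 : {sigma_finite_measure set T1 -> \bar R}) (m2 : {sigma_finite_measure set T2 -> \bar R}).
Definition prodm : set (T1 * T2) -> \bar R := (m1 \x m2)%E.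
HB.instance Definition _ := Measure.on prodm.
Lemma prodm_sigma_finite : sigma_finite setT prodm.
Proof.
have /sigma_finiteP[F [TF ndF Foo]] := sigma_finiteT m1.
have /sigma_finiteP[G [TG ndG Goo]] := sigma_finiteT m2.
exists (fun n => F n `*` G n).
 rewrite -setXTT TF TG predeqE => -[x y]; split.
    move=> [/= [n _ Fnx] [k _ Gky]]; exists (maxn n k) => //; split.
    - by move: x Fnx; exact/subsetPset/ndF/leq_maxl.
    - by move: y Gky; exact/subsetPset/ndG/leq_maxr.
  by move=> [n _ []/= ? ?]; split; exists n.
move=> k; have [? ?] := Foo k; have [? ?] := Goo k.
split; first exact: measurableX.
by rewrite /prodm product_measure1E// lte_mul_pinfty// ge0_fin_numE.
Qed.
HB.instance Definition _ := Measure_isSigmaFinite.Build _ _ _ prodm prodm_sigma_finite.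
End prodm.

(* ---------- Lebesgue measure on R^d, d >= 1 ----------
   R^(n+1) is represented as R * (R * ( ... * R)) with the (iterated)
   product measure of Lebesgue measures on the product (= Borel) sigma-algebra. *)
Record sfspace (R : realType) := SFSpace {
  sf_disp : measure_display;
  sf_car : measurableType sf_disp;
  sf_mu : {sigma_finite_measure set sf_car -> \bar R} }.
Arguments SFSpace {R sf_disp sf_car}.
Arguments sf_car {R}.
Arguments sf_mu {R}.
Arguments sf_disp {R}.

Fixpoint Rsp (R : realType) (n : nat) : sfspace R := match n with
 | 0 => SFSpace (@lebesgue_measure R)
 | n.+1 => let S := Rsp R n in
     @SFSpace R _ (measurableTypeR R * sf_car S)%type
       (prodm (@lebesgue_measure R) (sf_mu S)) end.

Definition Rd (R : realType) (d : nat) : measurableType _ := sf_car (Rsp R d.-1).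
Definition lebd (R : realType) (d : nat) : {sigma_finite_measure set Rd R d -> \bar R} :=
  sf_mu (Rsp R d.-1).

Local Open Scope complex_scope.
Local Open Scope ring_scope.

Section defs.
Context {R : realType}.
Notation leb := (@lebesgue_measure R).

Definition cabs (z : R[i]) : R := Num.sqrt (complex.Re z ^+ 2 + complex.Im z ^+ 2).

Definition expi (t : R) : R[i] := cos t +i* sin t.

Definition Rx : set R := [set x | x != 0].

Definition cmeasurable {d} {T : measurableType d} (D : set T) (g : T -> R[i]) :=
  measurable_fun D (fun x => complex.Re (g x)) /\ measurable_fun D (fun x => complex.Im (g x)).

Definition cintegrable {d} {T : measurableType d} (mu : {measure set T -> \bar R})
  (D : set T) (g : T -> R[i]) :=
  mu.-integrable D (fun x => (complex.Re (g x))%:E) /\ mu.-integrable D (fun x => (complex.Im (g x))%:E).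

Definition Cint {d} {T : measurableType d} (mu : {measure set T -> \bar R})
  (D : set T) (g : T -> R[i]) : R[i] :=
  (Rintegral mu D (fun x => complex.Re (g x))) +i* (Rintegral mu D (fun x => complex.Im (g x))).

Definition L2w (c : R) (w : R -> R[i]) : Prop :=
  cmeasurable Rx w /\
  (\int[leb]_(x in Rx) ((cabs (w x)) ^+ 2 * `|x| `^ c)%:E < +oo)%E.

Definition L2R (phi : R -> R[i]) : Prop :=
  cmeasurable setT phi /\ (\int[leb]_x ((cabs (phi x)) ^+ 2)%:E < +oo)%E.

Definition Ftrunc (phi : R -> R[i]) (n : nat) (xi : R) : R[i] :=
  Cint leb `[- n%:R, n%:R]%classic (fun x => phi x * expi (- (x * xi))).

(* Sobolev space H^alpha(R): phi in L^2(R) and its (Plancherel) Fourier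
   transform Phi (the L^2-limit of the truncated Fourier integrals)
   satisfies \int |Phi(xi)|^2 (1+xi^2)^alpha dxi < oo.  The normalisation
   constant of the Fourier transform is irrelevant for this condition. *)
Definition Hsob (alpha : R) (phi : R -> R[i]) : Prop :=
  L2R phi /\
  exists Phi : R -> R[i], L2R Phi /\
    ((fun n => (\int[leb]_xi ((cabs (Phi xi - Ftrunc phi n xi)) ^+ 2)%:E)%E) @ \oo --> 0%E) /\
    (\int[leb]_xi ((cabs (Phi xi)) ^+ 2 * (1 + xi ^+ 2) `^ alpha)%:E < +oo)%E.

Definition uf (sgn_u : bool) (beta : R) (x : R) : R :=
  (if sgn_u then Num.sg x else 1) * `|x| `^ beta.

Context {dd : measure_display} {T : measurableType dd}.

Definition supp (f : T -> R) : set T := [set s | f s != 0].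

Definition Ekernel (f : T -> R) (sgn_u : bool) (beta : R) (w : R -> R[i]) (x : R) (s : T) : R[i] :=
  (uf sgn_u beta (f s) / `|f s|)%:C * w (x / f s).

Definition solvesE (mu : {measure set T -> \bar R}) (f : T -> R) (sgn_u : bool) (beta : R)
  (v w : R -> R[i]) : Prop :=
  {ae leb, forall x, x != 0 ->
     cintegrable mu (supp f) (Ekernel f sgn_u beta w x) /\
     v x = Cint mu (supp f) (Ekernel f sgn_u beta w x)}.

Definition mfp (mu : {measure set T -> \bar R}) (f : T -> R) (sgn_u : bool) (beta c : R) (x : R) : R[i] :=
  Cint mu (supp f) (fun s =>
    (uf sgn_u beta (f s) * `|f s| `^ ((c - 1) / 2))%:C * expi (- (x * ln `|f s|))).

Definition mfm (mu : {measure set T -> \bar R}) (f : T -> R) (sgn_u : bool) (beta c : R) (x : R) : R[i] :=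
  Cint mu (supp f) (fun s =>
    (uf sgn_u beta (f s) * `|f s| `^ ((c - 1) / 2))%:C * expi (- (x * ln `|f s|))
    * (Num.sg (f s))%:C).

End defs.

(* Main.v *)
Require Import Defs.
From HB Require Import structures.
From mathcomp Require Import all_boot all_order all_algebra.
From mathcomp Require Import all_classical all_reals all_analysis.
From mathcomp Require Import measurable_realfun.
From mathcomp Require Import complex ring lra.
Import Order.TTheory GRing.Theory Num.Theory.
Import numFieldNormedType.Exports.
Local Open Scope classical_set_scope.
Local Open Scope complex_scope.
Local Open Scope ring_scope.
Set Implicit Arguments.
Unset Strict Implicit.
Unset Printing Implicit Defensive.

(** In the coordinates x = e^y and x = - e^y, with even and odd parts taken,
    (E) splits into two convolution equations on L2(R), one for each sign.  The
    convolving measure is the image under log|f| of u(f) |f|^((c-1)/2) ds,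
    weighted by sgn f for the odd part, and its Fourier transform is m_{f,+} or
    m_{f,-}.  The L2 Fourier transform turns the equations into multiplication
    by these continuous bounded functions m: this operator is injective iff
    m <> 0 a.e. and onto iff |m| is bounded below (otherwise a function
    concentrated where |m| is small has no preimage), and dividing by m costs
    at most the weight 1 + |x|^alpha, which membership in H^alpha absorbs.

    The L2 transform is characterised by the multiplication formula tested
    against Gaussian wave packets, a family stable under the transform, so that
    uniqueness, limits and the convolution theorem all reduce to Fubini. *)

(** * Complex-valued functions and their integrals *)

(** Division by f(s) exchanges the two half-lines whenever f(s) < 0, so in logarithmic coordinates
    (E) is a 2 by 2 system. Even and odd parts belong to the two characters of the sign group and
    diagonalise it; the odd character produces the factor sgn f(s) of m_{f,-}. The weight
    e^{(c+1)y/2} turns |x|^c dx into dy and moves the exponent of |f(s)| from beta - 1 to beta +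
    (c-1)/2.

    The convolution of an L2 function with the image measure is first known only to exist almost
    everywhere and to be integrable against wave packets. Hence [is_FT] is a relation on the class
    [gint] of such functions, where it is one-to-one almost everywhere in both directions, and (E)
    can be verified on the side of the transforms.

    For necessity in (b), continuity of m and inf |m| = 0 give intervals where |m| <= 4^-n. One
    explicit right-hand side, whose squared transform has mass at least 2^-n on the n-th interval,
    excludes every candidate solution: the squared transform of a solution would have mass at least
    8^n for all n. *)

Section complex_numbers.
Context {R : realType}.
Implicit Types (z w : R[i]) (t r : R).

Lemma cReD z w : complex.Re (z + w) = complex.Re z + complex.Re w.
Proof. by case: z w => [? ?] [? ?]. Qed.
Lemma cImD z w : complex.Im (z + w) = complex.Im z + complex.Im w.
Proof. by case: z w => [? ?] [? ?]. Qed.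
Lemma cReN z : complex.Re (- z) = - complex.Re z.
Proof. by case: z. Qed.
Lemma cImN z : complex.Im (- z) = - complex.Im z.
Proof. by case: z. Qed.
Lemma cReM z w : complex.Re (z * w) =
  complex.Re z * complex.Re w - complex.Im z * complex.Im w.
Proof. by case: z w => [? ?] [? ?]. Qed.
Lemma cImM z w : complex.Im (z * w) =
  complex.Re z * complex.Im w + complex.Im z * complex.Re w.
Proof. by case: z w => [? ?] [? ?]. Qed.
Lemma cReJ z : complex.Re (conjc z) = complex.Re z. Proof. by case: z. Qed.
Lemma cImJ z : complex.Im (conjc z) = - complex.Im z. Proof. by case: z. Qed.
Lemma complex_ext z w : complex.Re z = complex.Re w ->
  complex.Im z = complex.Im w -> z = w.
Proof. by case: z w => [? ?] [? ?] /= -> ->. Qed.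

Lemma cabsE z : cabs z = ComplexField.Normc.normc z.
Proof. by case: z. Qed.
Lemma cabs_ge0 z : 0 <= cabs z. Proof. exact: sqrtr_ge0. Qed.
Lemma cabsM z w : cabs (z * w) = cabs z * cabs w.
Proof. by rewrite !cabsE ComplexField.Normc.normcM. Qed.
Lemma cabsV z : cabs z^-1 = (cabs z)^-1.
Proof. by rewrite !cabsE ComplexField.Normc.normcV. Qed.
Lemma cabs_leD z w : cabs (z + w) <= cabs z + cabs w.
Proof. by rewrite !cabsE le_normcD. Qed.
Lemma cabsN z : cabs (- z) = cabs z.
Proof. by rewrite !cabsE normcN. Qed.
Lemma cabs_leB z w : cabs (z - w) <= cabs z + cabs w.
Proof. by rewrite (le_trans (cabs_leD _ _))// cabsN. Qed.
Lemma cabsJ z : cabs (conjc z) = cabs z.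
Proof. by rewrite /cabs cReJ cImJ sqrrN. Qed.
Lemma cabs_sq z : cabs z ^+ 2 = complex.Re z ^+ 2 + complex.Im z ^+ 2.
Proof. by rewrite sqr_sqrtr// addr_ge0// sqr_ge0. Qed.
Lemma cabs0 : cabs (0 : R[i]) = 0.
Proof. by rewrite /cabs/= expr0n/= addr0 sqrtr0. Qed.
Lemma cabs_eq0 z : (cabs z == 0) = (z == 0).
Proof.
apply/eqP/eqP => [|->]; last exact: cabs0.
by rewrite cabsE => /ComplexField.Normc.eq0_normc.
Qed.
Lemma cabs_gt0 z : (0 < cabs z) = (z != 0).
Proof. by rewrite lt_def cabs_ge0 andbT cabs_eq0. Qed.
Lemma cabsR r : cabs r%:C = `|r|.
Proof. by rewrite /cabs/= expr0n/= addr0 sqrtr_sqr. Qed.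
Lemma Re_le_cabs z : `|complex.Re z| <= cabs z.
Proof. by rewrite -sqrtr_sqr ler_wsqrtr// lerDl sqr_ge0. Qed.
Lemma Im_le_cabs z : `|complex.Im z| <= cabs z.
Proof. by rewrite -sqrtr_sqr ler_wsqrtr// lerDr sqr_ge0. Qed.
Lemma cabs_le_ReIm z : cabs z <= `|complex.Re z| + `|complex.Im z|.
Proof.
rewrite -[leRHS]ger0_norm ?addr_ge0// -sqrtr_sqr ler_wsqrtr//.
by rewrite sqrrD !real_normK ?num_real// lerD2r lerDl mulrn_wge0// mulr_ge0.
Qed.

Lemma expiD t r : expi (t + r) = expi t * expi r.
Proof.
by apply: complex_ext; rewrite /expi/= ?cosD ?sinD// addrC [X in X + _]mulrC
  [X in _ + X]mulrC [X in X + _]mulrC [X in _ + X]mulrC.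
Qed.
Lemma cabs_expi t : cabs (expi t) = 1.
Proof. by rewrite /cabs/= cos2Dsin2 sqrtr1. Qed.
Lemma expi0 : expi (0 : R) = 1.
Proof. by apply: complex_ext; rewrite /expi/= ?cos0 ?sin0. Qed.
Lemma conj_expi t : conjc (expi t) = expi (- t).
Proof. by rewrite /expi cosN sinN. Qed.
Lemma conjcM z w : conjc (z * w) = conjc z * conjc w.
Proof. exact: rmorphM. Qed.
Lemma mulcJ z : z * conjc z = (cabs z ^+ 2)%:C.
Proof. by rewrite cabs_sq; apply: complex_ext; rewrite ?cReM ?cImM ?cReJ ?cImJ/=; ring. Qed.

End complex_numbers.

Section complex_measurability.
Context {R : realType} {d} {T : measurableType d}.
Implicit Types (f g : T -> R[i]) (D : set T).

Lemma cmeasurableM D f g : cmeasurable D f -> cmeasurable D g ->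
  cmeasurable D (fun x => f x * g x).
Proof.
move=> [f1 f2] [g1 g2]; split; (under eq_fun do rewrite ?cReM ?cImM).
  by apply: measurable_funB; apply: measurable_funM.
by apply: measurable_funD; apply: measurable_funM.
Qed.
Lemma cmeasurableD D f g : cmeasurable D f -> cmeasurable D g ->
  cmeasurable D (fun x => f x + g x).
Proof.
move=> [f1 f2] [g1 g2]; split; (under eq_fun do rewrite ?cReD ?cImD); by apply: measurable_funD.
Qed.
Lemma cmeasurableN D f : cmeasurable D f -> cmeasurable D (fun x => - f x).
Proof.
move=> [f1 f2]; split; (under eq_fun do rewrite ?cReN ?cImN);
by apply: measurableT_comp.
Qed.
Lemma cmeasurableB D f g : cmeasurable D f -> cmeasurable D g ->
  cmeasurable D (fun x => f x - g x).
Proof. by move=> mf mg; apply: cmeasurableD => //; exact: cmeasurableN. Qed.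
Lemma cmeasurableJ D f : cmeasurable D f -> cmeasurable D (fun x => conjc (f x)).
Proof.
move=> [f1 f2]; split; (under eq_fun do rewrite ?cReJ ?cImJ) => //.
exact: measurableT_comp.
Qed.
Lemma cmeasurableR D (h : T -> R) : measurable_fun D h -> cmeasurable D (fun x => (h x)%:C).
Proof. by move=> mh; split => //=; exact: measurable_cst. Qed.
Lemma cmeasurable_cst D (z : R[i]) : cmeasurable D (fun=> z).
Proof. by split; exact: measurable_cst. Qed.
Lemma cmeasurable_expi D (h : T -> R) : measurable_fun D h ->
  cmeasurable D (fun x => expi (h x)).
Proof.
move=> mh; split => /=; apply: measurableT_comp => //.
  by apply: continuous_measurable_fun; exact: continuous_cos.
by apply: continuous_measurable_fun; exact: continuous_sin.
Qed.
Lemma cmeasurable_cabs D f : cmeasurable D f -> measurable_fun D (fun x => cabs (f x)).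
Proof.
move=> [f1 f2]; apply: measurableT_comp.
  by apply: continuous_measurable_fun; exact: sqrt_continuous.
by apply: measurable_funD; apply: measurable_funX.
Qed.
Lemma cmeasurable_cabs2 D f : cmeasurable D f ->
  measurable_fun D (fun x => (cabs (f x) ^+ 2)%:E).
Proof. by move=> mf; apply/measurable_EFinP/measurable_funX/cmeasurable_cabs. Qed.
Lemma cmeasurableV D f : cmeasurable D f -> cmeasurable D (fun x => (f x)^-1).
Proof.
move=> mf.
(* [z^-1 = |z|^-2 conj z] reduces the claim to a real inverse, which is treated as the power of
   exponent -1. The identity survives at 0 since [0^-1 = 0]. *)
rewrite (_ : (fun x => _) = fun x => ((cabs (f x) ^+ 2)^-1)%:C * conjc (f x)).
  apply: cmeasurableM; last exact: cmeasurableJ.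
  apply: cmeasurableR.
  under eq_fun do rewrite -powR_inv1 ?sqr_ge0//.
  apply: (measurableT_comp (measurable_powR _)).
  exact/measurable_funX/cmeasurable_cabs.
apply/funext => x; have [->|fx0] := eqVneq (f x) 0; first by rewrite invr0 conjc0 mulr0.
apply: (mulfI fx0); rewrite divff// mulrCA mulcJ -rmorphM mulVf//.
by rewrite sqrf_eq0 cabs_eq0.
Qed.
Lemma cmeasurable_comp {d'} {T' : measurableType d'} (phi : T' -> T) f :
  cmeasurable setT f -> measurable_fun setT phi ->
  cmeasurable setT (fun x => f (phi x)).
Proof. by move=> [f1 f2] mphi; split; [apply: (measurableT_comp f1)|apply: (measurableT_comp f2)]. Qed.

End complex_measurability.

Section complex_integral.
Context {R : realType} {d} {T : measurableType d}.
Variable mu : {measure set T -> \bar R}.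
Implicit Types (f g : T -> R[i]) (D : set T).

Lemma cintegrableP D f : measurable D -> cintegrable mu D f <->
  cmeasurable D f /\ (\int[mu]_(x in D) (cabs (f x))%:E < +oo)%E.
Proof.
move=> mD; split.
  move=> [/integrableP[/measurable_EFinP m1 i1] /integrableP[/measurable_EFinP m2 i2]].
  split => //; apply: (@le_lt_trans _ _ (\int[mu]_(x in D)
      ((`|complex.Re (f x)|)%:E + (`|complex.Im (f x)|)%:E))%E).
    apply: ge0_le_integral => //.
    - by move=> x _; rewrite lee_fin cabs_ge0.
    - exact/measurable_EFinP/cmeasurable_cabs.
    - by apply: emeasurable_funD; apply/measurable_EFinP; exact: measurableT_comp.
    - by move=> x _; rewrite -EFinD lee_fin cabs_le_ReIm.
  rewrite ge0_integralD//.
  - by rewrite lte_add_pinfty.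
  - by apply/measurable_EFinP; exact: measurableT_comp.
  - by apply/measurable_EFinP; exact: measurableT_comp.
move=> [mf fi]; have [m1 m2] := mf; split; apply/integrableP; split;
  try exact/measurable_EFinP.
- apply: le_lt_trans fi; apply: ge0_le_integral => //.
  + by apply/measurable_EFinP; exact: measurableT_comp.
  + exact/measurable_EFinP/cmeasurable_cabs.
  + by move=> x _; rewrite lee_fin Re_le_cabs.
- apply: le_lt_trans fi; apply: ge0_le_integral => //.
  + by apply/measurable_EFinP; exact: measurableT_comp.
  + exact/measurable_EFinP/cmeasurable_cabs.
  + by move=> x _; rewrite lee_fin Im_le_cabs.
Qed.

Lemma cintegrable_measurable D f : cintegrable mu D f -> cmeasurable D f.
Proof.
by move=> [/integrableP[/measurable_EFinP m1 _] /integrableP[/measurable_EFinP m2 _]].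
Qed.

Lemma cintegrable_cabs D f : measurable D -> cintegrable mu D f ->
  mu.-integrable D (fun x => (cabs (f x))%:E).
Proof.
move=> mD /(cintegrableP _ mD)[mf fi]; apply/integrableP; split.
  exact/measurable_EFinP/cmeasurable_cabs.
by under eq_integral do rewrite gee0_abs ?lee_fin ?cabs_ge0//.
Qed.

Lemma le_cintegrable D f (G : T -> R) : measurable D -> cmeasurable D f ->
  mu.-integrable D (fun x => (G x)%:E) -> (forall x, D x -> cabs (f x) <= G x) ->
  cintegrable mu D f.
Proof.
move=> mD mf /integrableP[mG iG] fG; apply/(cintegrableP _ mD); split => //.
apply: le_lt_trans iG; apply: ge0_le_integral => //.
- by move=> x _; rewrite lee_fin cabs_ge0.
- exact/measurable_EFinP/cmeasurable_cabs.
- exact: measurableT_comp.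
- by move=> x Dx; rewrite lee_fin (le_trans (fG x Dx))// ler_norm.
Qed.

Lemma cintegrableD D f g : measurable D -> cintegrable mu D f -> cintegrable mu D g ->
  cintegrable mu D (fun x => f x + g x).
Proof.
move=> mD [f1 f2] [g1 g2]; split.
  under eq_fun do rewrite cReD EFinD; exact: integrableD.
under eq_fun do rewrite cImD EFinD; exact: integrableD.
Qed.

Lemma cintegrableM_bounded D f g (M : R) : measurable D -> cintegrable mu D f ->
  cmeasurable D g -> (forall x, D x -> cabs (g x) <= M) ->
  cintegrable mu D (fun x => f x * g x).
Proof.
move=> mD fi mg gM; apply: (@le_cintegrable _ _ (fun x => M * cabs (f x))) => //.
- by apply: cmeasurableM => //; exact: cintegrable_measurable fi.
- under eq_fun do rewrite EFinM; apply: integrableZl => //.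
  exact: cintegrable_cabs.
- by move=> x Dx; rewrite cabsM mulrC ler_wpM2r ?cabs_ge0// gM.
Qed.

Lemma cintegrableZ D (z : R[i]) f : measurable D -> cintegrable mu D f ->
  cintegrable mu D (fun x => z * f x).
Proof.
move=> mD fi; under eq_fun do rewrite mulrC.
apply: (@cintegrableM_bounded _ _ _ (cabs z)) => //; exact: cmeasurable_cst.
Qed.

Lemma cintegrableN D f : measurable D -> cintegrable mu D f ->
  cintegrable mu D (fun x => - f x).
Proof.
move=> mD fi; under eq_fun do rewrite -mulN1r; exact: cintegrableZ.
Qed.

Lemma cintegrableB D f g : measurable D -> cintegrable mu D f -> cintegrable mu D g ->
  cintegrable mu D (fun x => f x - g x).
Proof. by move=> mD fi gi; apply: cintegrableD => //; exact: cintegrableN. Qed.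

Lemma Cint_eq D f g : {in D, f =1 g} -> Cint mu D f = Cint mu D g.
Proof.
by move=> fg; apply: complex_ext; apply: eq_Rintegral => x xD /=; rewrite fg.
Qed.

Lemma CintD D f g : measurable D -> cintegrable mu D f -> cintegrable mu D g ->
  Cint mu D (fun x => f x + g x) = Cint mu D f + Cint mu D g.
Proof.
move=> mD [f1 f2] [g1 g2]; apply: complex_ext; rewrite ?cReD ?cImD/=.
  by under eq_Rintegral do rewrite cReD; rewrite RintegralD.
by under eq_Rintegral do rewrite cImD; rewrite RintegralD.
Qed.

Lemma CintZ D (z : R[i]) f : measurable D -> cintegrable mu D f ->
  Cint mu D (fun x => z * f x) = z * Cint mu D f.
Proof.
move=> mD [f1 f2].
have f1' r : mu.-integrable D (EFin \o (fun x => r * complex.Re (f x))).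
  by rewrite /comp; under eq_fun do rewrite EFinM; exact: integrableZl.
have f2' r : mu.-integrable D (EFin \o (fun x => r * complex.Im (f x))).
  by rewrite /comp; under eq_fun do rewrite EFinM; exact: integrableZl.
apply: complex_ext; rewrite ?cReM ?cImM/=.
  by under eq_Rintegral do rewrite cReM; rewrite RintegralB// !RintegralZl.
by under eq_Rintegral do rewrite cImM; rewrite RintegralD// !RintegralZl.
Qed.

Lemma CintZr D (z : R[i]) f : measurable D -> cintegrable mu D f ->
  Cint mu D (fun x => f x * z) = Cint mu D f * z.
Proof.
by move=> mD fi; rewrite mulrC -CintZ//; apply: Cint_eq => x _; rewrite mulrC.
Qed.

Lemma CintN D f : measurable D -> cintegrable mu D f ->
  Cint mu D (fun x => - f x) = - Cint mu D f.
Proof.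
move=> mD fi; rewrite -mulN1r -CintZ//.
by apply: Cint_eq => x _; rewrite mulN1r.
Qed.

Lemma CintB D f g : measurable D -> cintegrable mu D f -> cintegrable mu D g ->
  Cint mu D (fun x => f x - g x) = Cint mu D f - Cint mu D g.
Proof.
by move=> mD fi gi; rewrite CintD ?CintN//; exact: cintegrableN.
Qed.

Lemma CintJ D f : measurable D -> cintegrable mu D f ->
  Cint mu D (fun x => conjc (f x)) = conjc (Cint mu D f).
Proof.
move=> mD [f1 f2]; apply: complex_ext; rewrite ?cReJ ?cImJ/=.
  by apply: eq_Rintegral => x _; rewrite cReJ.
rewrite -mulN1r -RintegralZl//.
by apply: eq_Rintegral => x _; rewrite cImJ mulN1r.
Qed.

Lemma Cint0 D : Cint mu D (fun=> 0) = 0.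
Proof. by apply: complex_ext; rewrite /= /Rintegral integral0. Qed.

Lemma CintR D (r : T -> R) : Cint mu D (fun x => (r x)%:C) = (Rintegral mu D r)%:C.
Proof. by apply: complex_ext; rewrite /= /Rintegral ?integral0. Qed.

Lemma Cint_mkcond D f : Cint mu D f = Cint mu setT (fun x => (\1_D x)%:C * f x).
Proof.
apply: complex_ext => /=; rewrite Rintegral_mkcond; apply: eq_Rintegral => x _;
  rewrite ?cReM ?cImM/= ?mul0r ?subr0 ?addr0 patchE indicE; case: ifP;
  by rewrite ?mul1r ?mul0r.
Qed.

Lemma cintegrable_mkcond D f : measurable D -> cintegrable mu D f <->
  cintegrable mu setT (fun x => (\1_D x)%:C * f x).
Proof.
move=> mD.
have aux (r : T -> R) : mu.-integrable D (fun x => (r x)%:E) <->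
    mu.-integrable setT (fun x => (\1_D x * r x)%:E).
  rewrite (_ : (fun x => (\1_D x * r x)%:E) = (fun x => (r x)%:E) \_ D).
    exact: integrable_mkcond.
  by apply/funext => x; rewrite patchE indicE; case: ifP; rewrite ?mul1r ?mul0r.
rewrite /cintegrable; under [X in _ <-> integrable _ _ X /\ _]eq_fun
  do rewrite cReM/= mul0r subr0.
under [X in _ <-> _ /\ integrable _ _ X]eq_fun do rewrite cImM/= mul0r addr0.
by rewrite !aux.
Qed.

(* The factor 2 absorbs the splitting into real and imaginary parts. *)
Lemma cabs_Cint_le D f : measurable D -> cmeasurable D f ->
  ((cabs (Cint mu D f))%:E <= 2%:E * \int[mu]_(x in D) (cabs (f x))%:E)%E.
Proof.
move=> mD mf.
have I0 : (0 <= \int[mu]_(x in D) (cabs (f x))%:E)%E.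
  by apply: integral_ge0 => x _; rewrite lee_fin cabs_ge0.
have [fi|] := ltP (\int[mu]_(x in D) (cabs (f x))%:E)%E +oo%E; last first.
  by rewrite leye_eq => /eqP ->; rewrite gt0_muley ?leey// lte_fin.
have /(cintegrableP _ mD) ci : cmeasurable D f /\ (\int[mu]_(x in D) (cabs (f x))%:E < +oo)%E by [].
have [f1 f2] := ci.
have aux (r : T -> R) : mu.-integrable D (fun x => (r x)%:E) ->
    (forall x, `|r x| <= cabs (f x)) ->
    ((`|Rintegral mu D r|)%:E <= \int[mu]_(x in D) (cabs (f x))%:E)%E.
  move=> ri rf; rewrite EFin_normr_Rintegral//.
  have /integrableP[mr _] := ri.
  apply: (le_trans (le_abse_integral _ mD mr)); apply: ge0_le_integral => //.
  - exact: measurableT_comp.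
  - exact/measurable_EFinP/cmeasurable_cabs.
  - by move=> x _; rewrite lee_fin rf.
have H : ((cabs (Cint mu D f))%:E <= (`|complex.Re (Cint mu D f)|)%:E +
   (`|complex.Im (Cint mu D f)|)%:E)%E by rewrite -EFinD lee_fin cabs_le_ReIm.
apply: (le_trans H).
rewrite mule_natl mule2n; apply: leeD; apply: aux => // x.
- exact: Re_le_cabs.
- exact: Im_le_cabs.
Qed.

Lemma ae_eq_Cint D f g : measurable D -> cmeasurable D f -> cmeasurable D g ->
  {ae mu, forall x, D x -> f x = g x} -> Cint mu D f = Cint mu D g.
Proof.
move=> mD [f1 f2] [g1 g2] fg.
apply: complex_ext => /=; congr fine; apply: ae_eq_integral => //;
  try exact/measurable_EFinP;
  by apply: filterS fg => x h Dx; rewrite h.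
Qed.

End complex_integral.

Lemma measurable_fineT {R : realType} : measurable_fun setT (@fine R).
Proof. exact: fine_measurable. Qed.

(** * Fubini for complex integrands *)

Section complex_fubini.
Context {R : realType} {d1 d2} {T1 : measurableType d1} {T2 : measurableType d2}.
Variables (m1 : {sigma_finite_measure set T1 -> \bar R})
  (m2 : {sigma_finite_measure set T2 -> \bar R}).
Implicit Types F : T1 * T2 -> R[i].

(** Tonelli makes the integrals of the positive and negative parts measurable, and so is their
    difference, including where it reads [oo - oo]. Partial integrals are thus measurable on the
    whole space and not merely almost everywhere. *)
Lemma measurable_integral2 (f : T1 * T2 -> \bar R) : measurable_fun setT f ->
  measurable_fun setT (fun x => \int[m2]_y f (x, y))%E.
Proof.
move=> mf.
rewrite (_ : (fun x => _) = (fun x => \int[m2]_y f^\+ (x, y))%E \-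
                            (fun x => \int[m2]_y f^\- (x, y))%E)%E; last first.
  apply/funext => x; rewrite integralE.
  by congr (_ - _)%E; apply: eq_integral => y _; rewrite (funepos_comp f (pair x), funeneg_comp f (pair x)).
apply: emeasurable_funB; apply: measurable_fun_fubini_tonelli_F => //.
- exact: measurable_funepos.
- exact: measurable_funeneg.
Qed.

Lemma cmeasurable_Cint2 F : cmeasurable setT F ->
  cmeasurable setT (fun x => Cint m2 setT (fun y => F (x, y))).
Proof.
move=> [F1 F2]; split => /=; apply: (measurableT_comp measurable_fineT).
  by apply: (@measurable_integral2 (EFin \o (fun z => complex.Re (F z)))); exact/measurable_EFinP.
by apply: (@measurable_integral2 (EFin \o (fun z => complex.Im (F z)))); exact/measurable_EFinP.
Qed.

Lemma ae_cintegrable2 F : cintegrable (m1 \x m2)%E setT F ->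
  {ae m1, forall x, cintegrable m2 setT (fun y => F (x, y))}.
Proof.
move=> [F1 F2].
by apply: filterS2 (ae_integrable1 F1) (ae_integrable1 F2) => x ? ?; split.
Qed.

Lemma Cint_fubini F : cintegrable (m1 \x m2)%E setT F ->
  Cint m1 setT (fun x => Cint m2 setT (fun y => F (x, y))) =
  Cint m2 setT (fun y => Cint m1 setT (fun x => F (x, y))).
Proof.
have aux (r : T1 * T2 -> R) : (m1 \x m2)%E.-integrable setT (EFin \o r) ->
   (\int[m1]_x \int[m2]_y r (x, y))%R = (\int[m2]_y \int[m1]_x r (x, y))%R.
  move=> ri; rewrite /Rintegral; congr fine.
  have mr := measurable_int _ ri.
  (* [Rintegral] applies [fine] to each inner integral. These are finite almost everywhere, so
     [fine] alters the outer integrand on a null set only. *)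
  have r1 : (\int[m1]_x (fine (\int[m2]_y (r (x, y))%:E))%:E =
             \int[m1]_x (\int[m2]_y (r (x, y))%:E))%E.
    apply: ae_eq_integral => //.
    - apply/measurable_EFinP; apply: (measurableT_comp measurable_fineT).
      exact: (@measurable_integral2 (EFin \o r)).
    - exact: (@measurable_integral2 (EFin \o r)).
    - apply: filterS (ae_integrable1 ri) => x xi _; rewrite fineK//.
      exact: integrable_fin_num.
  have r2 : (\int[m2]_y (fine (\int[m1]_x (r (x, y))%:E))%:E =
             \int[m2]_y (\int[m1]_x (r (x, y))%:E))%E.
    have mG : measurable_fun setT (fun y => (\int[m1]_x (r (x, y))%:E))%E.
      exact: (measurable_fubini_G ri).
    apply: ae_eq_integral => //.
    - apply/measurable_EFinP; exact: (measurableT_comp measurable_fineT).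
    - apply: filterS (ae_integrable2 ri) => x xi _; rewrite fineK//.
      exact: integrable_fin_num.
  by rewrite r1 r2; exact: (Fubini ri).
move=> [F1 F2]; apply: complex_ext => /=.
  exact: (aux (fun z => complex.Re (F z))).
exact: (aux (fun z => complex.Im (F z))).
Qed.

Lemma cintegrable_prodP F : cmeasurable setT F ->
  (\int[m1]_x \int[m2]_y (cabs (F (x, y)))%:E < +oo)%E ->
  cintegrable (m1 \x m2)%E setT F.
Proof.
move=> mF Foo; apply/cintegrableP => //; split => //.
rewrite (fubini_tonelli1 (fun z => (cabs (F z))%:E))//.
  exact/measurable_EFinP/cmeasurable_cabs.
by move=> z; rewrite lee_fin cabs_ge0.
Qed.

Lemma cintegrable_prodP2 F : cmeasurable setT F ->
  (\int[m2]_y \int[m1]_x (cabs (F (x, y)))%:E < +oo)%E ->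
  cintegrable (m1 \x m2)%E setT F.
Proof.
move=> mF Foo; apply/cintegrableP => //; split => //.
rewrite (fubini_tonelli2 (fun z => (cabs (F z))%:E))//.
  exact/measurable_EFinP/cmeasurable_cabs.
by move=> z; rewrite lee_fin cabs_ge0.
Qed.

Lemma cintegrable_Cint2 F : cintegrable (m1 \x m2)%E setT F ->
  cintegrable m1 setT (fun x => Cint m2 setT (fun y => F (x, y))).
Proof.
move=> Fi; have mF := cintegrable_measurable Fi.
apply/cintegrableP => //; split; first exact: cmeasurable_Cint2.
have mC : measurable_fun setT (fun z => (cabs (F z))%:E).
  exact/measurable_EFinP/cmeasurable_cabs.
move: Fi => /cintegrableP [//|_].
rewrite (fubini_tonelli1 (fun z => (cabs (F z))%:E))//; last first.
  by move=> z; rewrite lee_fin cabs_ge0.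
move=> Foo.
apply: (@le_lt_trans _ _ (\int[m1]_x (2%:E * \int[m2]_y (cabs (F (x, y)))%:E))%E).
  have mI : measurable_fun setT (fun x => \int[m2]_y (cabs (F (x, y)))%:E)%E.
    exact: (@measurable_integral2 (fun z => (cabs (F z))%:E)).
  apply: ge0_le_integral => //.
  - by move=> x _; rewrite lee_fin cabs_ge0.
  - exact/measurable_EFinP/cmeasurable_cabs/cmeasurable_Cint2.
  - exact: measurable_funeM.
  - move=> x _; apply: cabs_Cint_le => //.
    exact: (cmeasurable_comp mF (pair1_measurable x)).
rewrite ge0_integralZl// ?lte_mul_pinfty//.
  exact: (@measurable_integral2 (fun z => (cabs (F z))%:E)).
by move=> x _; apply: integral_ge0 => y _; rewrite lee_fin cabs_ge0.
Qed.

End complex_fubini.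

(** * Changes of variable on the line *)

Section change_of_variable.
Context {R : realType}.
Notation leb := (@lebesgue_measure R).

Let aff (s t : R) : measurableTypeR R -> measurableTypeR R := fun x => s * x + t.
Let maff s t : measurable_fun setT (aff s t).
Proof. by apply: measurable_funD => //; exact: measurable_funM. Qed.
Let paff s t : {measure set (measurableTypeR R) -> \bar R} :=
  measure_function_pushforward__canonical__measure_function_Measure leb (maff s t).

(** Lebesgue measure is determined by its values on half-open intervals, and the preimage of []a,
    b]] under the affine map has length [(b - a) / s]. *)
Let lebesgue_affine (s : {nonneg R}) t (A : set R) : 0 < s%:num -> measurable A ->
  leb A = mscale s (paff s%:num t) A.
Proof.
move=> s0 mA; apply: lebesgue_measure_unique => // _ [[a b]] _ <-.
transitivity (s%:num%:E * leb (aff s%:num t @^-1` `]a, b]))%E; last by [].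
rewrite (_ : _ @^-1` _ =
    `](a - t) / s%:num, (b - t) / s%:num]%classic); last first.
  apply/seteqP; split => x /=; rewrite !in_itv/= /aff;
  by rewrite ltr_pdivrMr// ler_pdivlMr// ltrBlDr lerBrDr ![x * _]mulrC.
rewrite !lebesgue_measure_itv/= !lte_fin ltr_pM2r ?invr_gt0// ltrD2r.
case: ifPn => _; last by rewrite mule0.
by rewrite -!EFinB -EFinM; congr EFin; field; rewrite gt_eqF.
Qed.

Lemma ge0_integral_affine (s t : R) (f : R -> \bar R) : 0 < s ->
  measurable_fun setT f -> (forall x, 0 <= f x)%E ->
  (\int[leb]_x f x = s%:E * \int[leb]_x f (s * x + t)%R)%E.
Proof.
move=> s0 mf f0; pose s' := NngNum (ltW s0).
rewrite (@eq_measure_integral _ _ _ _ (mscale s' (pushforward leb (aff s t)))); last first.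
  by move=> A mA _; exact: (@lebesgue_affine s').
rewrite ge0_integral_mscale//=; congr (_ * _)%E.
by rewrite ge0_integral_pushforward// preimage_setT.
Qed.

Lemma ge0_integral_shift (t : R) (f : R -> \bar R) :
  measurable_fun setT f -> (forall x, 0 <= f x)%E ->
  (\int[leb]_x f (x + t)%R = \int[leb]_x f x)%E.
Proof.
move=> mf f0; rewrite [RHS](@ge0_integral_affine 1 t)// mul1e.
by apply: eq_integral => x _; rewrite mul1r.
Qed.

Lemma ge0_integral_reflect (f : R -> \bar R) :
  measurable_fun setT f -> (forall x, 0 <= f x)%E ->
  (\int[leb]_x f (- x)%R = \int[leb]_x f x)%E.
Proof.
move=> mf f0; transitivity (\int[pushforward leb (-%R : _ -> measurableTypeR R)]_x f x)%E.
  by rewrite ge0_integral_pushforward// preimage_setT.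
by apply: eq_measure_integral => A mA _; exact: lebesgue_measureN.
Qed.

Let integral_transfer (phi : R -> R) : measurable_fun setT phi ->
  (forall f : R -> \bar R, measurable_fun setT f -> (forall x, 0 <= f x)%E ->
    (\int[leb]_x f (phi x) = \int[leb]_x f x)%E) ->
  forall f : R -> \bar R, measurable_fun setT f ->
    (\int[leb]_x f (phi x) = \int[leb]_x f x)%E.
Proof.
move=> mphi H f mf; rewrite integralE [RHS]integralE.
rewrite -(H f^\+)%E -?(H f^\-)%E//; try exact: measurable_funepos;
  try exact: measurable_funeneg.
by congr (_ - _)%E; apply: eq_integral => x _;
  rewrite (funepos_comp f phi, funeneg_comp f phi).
Qed.

Lemma integral_shift (t : R) (f : R -> \bar R) : measurable_fun setT f ->
  (\int[leb]_x f (x + t)%R = \int[leb]_x f x)%E.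
Proof.
move=> mf; apply: (@integral_transfer (fun x => x + t)) => //.
  exact: measurable_funD.
by move=> g mg g0; exact: ge0_integral_shift.
Qed.

Lemma integral_reflect (f : R -> \bar R) : measurable_fun setT f ->
  (\int[leb]_x f (- x)%R = \int[leb]_x f x)%E.
Proof.
move=> mf; apply: (@integral_transfer (fun x => - x)) => //.
  exact: oppr_measurable.
by move=> g mg g0; exact: ge0_integral_reflect.
Qed.

Lemma Cint_shift (t : R) (f : R -> R[i]) : cmeasurable setT f ->
  Cint leb setT (fun x => f (x + t)) = Cint leb setT f.
Proof.
move=> [f1 f2]; apply: complex_ext; congr fine.
  by apply: (@integral_shift t (EFin \o (fun x => complex.Re (f x)))); exact/measurable_EFinP.
by apply: (@integral_shift t (EFin \o (fun x => complex.Im (f x)))); exact/measurable_EFinP.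
Qed.

Lemma Cint_reflect (f : R -> R[i]) : cmeasurable setT f ->
  Cint leb setT (fun x => f (- x)) = Cint leb setT f.
Proof.
move=> [f1 f2]; apply: complex_ext; congr fine.
  by apply: (@integral_reflect (EFin \o (fun x => complex.Re (f x)))); exact/measurable_EFinP.
by apply: (@integral_reflect (EFin \o (fun x => complex.Im (f x)))); exact/measurable_EFinP.
Qed.

(* Uniqueness of Haar measure on the multiplicative group: average the scaling
   invariance of dx over k(y)dy with k the indicator of [0,1]. *)
Let ge0_integral_exp_half (f : R -> \bar R) :
  measurable_fun setT f -> (forall x, 0 <= f x)%E -> (forall x, x <= 0 -> f x = 0%E) ->
  (\int[leb]_x f x = \int[leb]_y ((expR y)%:E * f (expR y)))%E.
Proof.
move=> mf f0 fneg.
pose k : R -> \bar R := fun y => (\1_(`[0, 1]%classic : set R) y)%:E.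
have mk : measurable_fun setT k by exact/measurable_EFinP/measurable_indic.
have k0 y : (0 <= k y)%E by rewrite lee_fin.
have If0 : (0 <= \int[leb]_x f x)%E by apply: integral_ge0.
have kint : (\int[leb]_y k y = 1)%E.
  rewrite integral_indic// setIT; have := @lebesgue_measure_itv R `[0, 1].
  by rewrite /= lte_fin ltr01 sube0.
(* The translation of [y] by [- ln x] turns [k y * expR y * f (expR y * x)] into
   [q (x, y) * (expR y * f (expR y))]. For fixed [y], [q] is [1 / x] on [[expR (y - 1), expR y]], of
   integral 1 ([qint]). *)
pose q (z : R * R) : \bar R := ((\1_(`]0%R, +oo[%classic : set R) z.1)%:E *
  (k (z.2 - ln z.1)%R * (z.1 `^ (-1))%:E))%E.
have q0 z : (0 <= q z)%E.
  by apply: mule_ge0; [rewrite lee_fin|apply: mule_ge0 => //; rewrite lee_fin powR_ge0].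
have mq : measurable_fun setT q.
  apply: emeasurable_funM.
    apply/measurable_EFinP; apply: (measurableT_comp (measurable_indic _)) => //.
  apply: emeasurable_funM.
    apply: (measurableT_comp mk); apply: measurable_funB => //.
    exact: (measurableT_comp (@measurable_ln R)).
  apply/measurable_EFinP; exact: (measurableT_comp (measurable_powR _)).
have qint y : (\int[leb]_x q (x, y) = 1)%E.
  have ey : expR (y - 1) < expR y by rewrite ltr_expR ltrBlDr ltrDl.
  transitivity (\int[leb]_(x in `[expR (y - 1), expR y]) (x^-1)%:E)%E.
    rewrite [RHS]integral_mkcond; apply: eq_integral => x _.
    rewrite patchE /q /k/= !indicE.
    have [x0|x0] := ltP 0 x; last first.
      rewrite memNset ?mul0e; last by rewrite /= in_itv/= andbT ltNge x0.
      rewrite memNset//= in_itv/= => /andP[+ _]; rewrite leNgt.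
      by rewrite (le_lt_trans x0)// expR_gt0.
    rewrite mem_set ?mul1e; last by rewrite /= in_itv/= andbT.
    rewrite powR_inv1 ?(ltW x0)//.
    rewrite (_ : (_ \in `[0, 1]%classic) = (x \in `[expR (y - 1), expR y]%classic)).
      by case: ifP; rewrite ?mul1e ?mul0e.
    have e1 : (expR (y - 1) <= x) = (y - 1 <= ln x) by rewrite -{1}(lnK x0) ler_expR.
    have e2 : (x <= expR y) = (ln x <= y) by rewrite -{1}(lnK x0) ler_expR.
    by apply/idP/idP; rewrite !inE/= !in_itv/= e1 e2 => /andP[? ?];
      apply/andP; split; lra.
  rewrite (@continuous_FTC2 _ (fun x => x^-1) (@ln R))//.
  - by rewrite !expRK -EFinB; congr EFin; ring.
  - apply: continuous_in_subspaceT => x; rewrite inE/= in_itv/= => /andP[+ _].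
    move=> /(lt_le_trans (expR_gt0 _)) x0; apply: inv_continuous.
    by rewrite gt_eqF.
  - split.
    + move=> x; rewrite in_itv/= => /andP[+ _] => /(lt_trans (expR_gt0 _)) x0.
      by have [] := is_derive1_ln x0.
    + by apply: cvg_at_right_filter; exact/continuous_ln/expR_gt0.
    + by apply: cvg_at_left_filter; exact/continuous_ln/expR_gt0.
  - move=> x; rewrite in_itv/= => /andP[+ _] => /(lt_trans (expR_gt0 _)) x0.
    by have := is_derive1_ln x0 => h; rewrite derive1E derive_val.
have mfe : measurable_fun setT (fun y => (expR y)%:E * f (expR y))%E.
  by apply: emeasurable_funM; [exact/measurable_EFinP|exact: measurableT_comp].
have mfxy : measurable_fun setT (fun z : R * R => f (expR z.2 * z.1)).
  apply: (measurableT_comp mf); apply: measurable_funM => //.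
  exact: measurableT_comp.
have mky : measurable_fun setT (fun z : R * R => k z.2 * (expR z.2)%:E)%E.
  apply: emeasurable_funM; first exact: measurableT_comp.
  by apply/measurable_EFinP; exact: measurableT_comp.
transitivity (\int[leb]_y (k y * \int[leb]_x f x))%E.
  by rewrite ge0_integralZr// kint mul1e.
transitivity (\int[leb]_y \int[leb]_x (k y * (expR y)%:E * f (expR y * x)%R))%E.
  apply: eq_integral => y _; rewrite (@ge0_integral_affine (expR y) 0)// ?expR_gt0//.
  rewrite ge0_integralZl//.
  - by rewrite muleA; congr (_ * _)%E; apply: eq_integral => x _; rewrite addr0.
  - by apply: (measurableT_comp mf); exact: measurable_funM.
  - by rewrite mule_ge0// lee_fin expR_ge0.
transitivity (\int[leb]_x \int[leb]_y (k y * (expR y)%:E * f (expR y * x)%R))%E.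
  symmetry; apply: (fubini_tonelli (m1 := leb) (m2 := leb)
    (fun z => k z.2 * (expR z.2)%:E * f (expR z.2 * z.1)%R)%E).
    exact: emeasurable_funM.
  by move=> z; rewrite mule_ge0// mule_ge0// lee_fin expR_ge0.
transitivity (\int[leb]_x \int[leb]_y (q (x, y) * ((expR y)%:E * f (expR y))))%E.
  apply: eq_integral => x _; have [x0|x0] := leP x 0.
    rewrite !integral0_eq// => y _.
      rewrite /q/= indicE memNset ?mul0e//.
      by rewrite /= in_itv/= andbT ltNge x0.
    by rewrite fneg ?mule0// mulr_ge0_le0 ?expR_ge0.
  rewrite -[LHS](@ge0_integral_shift (- ln x)).
  - apply: eq_integral => y _; rewrite /q/= indicE mem_set ?mul1e; last first.
      by rewrite /= in_itv/= andbT.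
    rewrite expRD expRN lnK// powR_inv1 ?(ltW x0)// divfK ?gt_eqF//.
    by rewrite -!muleA; congr (_ * _)%E; rewrite muleA -EFinM mulrC.
  - apply: emeasurable_funM.
      by apply: emeasurable_funM => //; exact/measurable_EFinP.
    by apply: (measurableT_comp mf); exact: measurable_funM.
  - by move=> y; rewrite mule_ge0// mule_ge0// lee_fin expR_ge0.
transitivity (\int[leb]_y \int[leb]_x (q (x, y) * ((expR y)%:E * f (expR y))))%E.
  apply: (fubini_tonelli (m1 := leb) (m2 := leb)
    (fun z => q z * ((expR z.2)%:E * f (expR z.2)))%E).
    by apply: emeasurable_funM => //; exact: (measurableT_comp mfe).
  by move=> z; rewrite mule_ge0// mule_ge0// lee_fin expR_ge0.
apply: eq_integral => y _; rewrite ge0_integralZr//.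
- by rewrite qint mul1e.
- by apply: (measurableT_comp mq); exact: pair2_measurable.
- by rewrite mule_ge0// lee_fin expR_ge0.
Qed.

Lemma ge0_integral_Rx_exp (f : R -> \bar R) :
  measurable_fun Rx f -> (forall x, (x != 0)%R -> 0 <= f x)%E ->
  (\int[leb]_(x in Rx) f x =
    \int[leb]_y ((expR y)%:E * f (expR y)) +
    \int[leb]_y ((expR y)%:E * f (- expR y)%R))%E.
Proof.
move=> mf f0.
have Rx0 : Rx = `]0%R, +oo[%classic `|` `]-oo, 0%R[%classic :> set R.
  apply/seteqP; split => x; rewrite /Rx/= !in_itv/= andbT.
    by rewrite neq_lt => /orP[->|->]; [right|left].
  by move=> [x0|x0]; rewrite neq_lt x0 ?orbT.
have mRx : measurable (Rx : set R) by rewrite Rx0; exact: measurableU.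
have half (g : R -> \bar R) : measurable_fun setT g -> (forall x, 0 <= g x)%E ->
    (\int[leb]_(x in `]0%R, +oo[) g x = \int[leb]_y ((expR y)%:E * g (expR y)))%E.
  move=> mg g0; rewrite integral_mkcond [LHS]ge0_integral_exp_half.
  - apply: eq_integral => y _; rewrite patchE mem_set//=.
    by rewrite /= in_itv/= expR_gt0.
  - by apply/(measurable_restrictT _ _).1 => //; exact: measurable_funTS.
  - by move=> x; rewrite patchE; case: ifP.
  - move=> x x0; rewrite patchE memNset//= in_itv/= andbT ltNge.
    by rewrite x0.
pose g := f \_ Rx.
have mg : measurable_fun setT g by apply/(measurable_restrictT _ _).1.
have g0 x : (0 <= g x)%E.
  by rewrite /g patchE; case: ifPn => // /set_mem; exact: f0.
have gE x : x != 0 -> g x = f x by move=> x0; rewrite /g patchE mem_set.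
rewrite Rx0 ge0_integral_setU//=; last 3 first.
- by rewrite -Rx0.
- by move=> x; rewrite !in_itv/= andbT => -[/gt_eqF|/lt_eqF]/negbT; exact: f0.
- apply/disj_setPS => x [/=]; rewrite !in_itv/= andbT => x0 /(lt_trans x0).
  by rewrite ltxx.
congr (_ + _)%E.
  transitivity (\int[leb]_(x in `]0%R, +oo[) g x)%E.
    apply: eq_integral => x; rewrite inE/= in_itv/= andbT => x0.
    by rewrite gE// gt_eqF.
  by rewrite half//; apply: eq_integral => y _; rewrite gE// gt_eqF// expR_gt0.
transitivity (\int[leb]_(x in `]0%R, +oo[) g (- x)%R)%E; last first.
  rewrite half//.
    by apply: eq_integral => y _; rewrite gE// oppr_eq0 gt_eqF// expR_gt0.
  by apply: (measurableT_comp mg); exact: oppr_measurable.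
rewrite integral_mkcond [RHS]integral_mkcond -[LHS]ge0_integral_reflect.
- apply: eq_integral => x _; rewrite !patchE.
  rewrite (_ : (- x \in `]-oo, 0%R[%classic) = (x \in `]0%R, +oo[%classic)).
    case: ifPn => // /set_mem/=; rewrite in_itv/= andbT => x0.
    by rewrite gE// oppr_eq0 gt_eqF.
  by apply/idP/idP; rewrite !inE/= !in_itv/= andbT oppr_lt0.
- apply/(measurable_restrictT _ _).1 => //.
  by apply: measurable_funS mf => // x /= /[!in_itv]/= /lt_eqF/negbT.
- move=> x; rewrite patchE; case: ifPn => // /set_mem/=; rewrite in_itv/=.
  by move=> /lt_eqF/negbT; exact: f0.
Qed.

End change_of_variable.

(** * Gaussian integrals *)

Section gaussian.
Context {R : realType}.
Notation leb := (@lebesgue_measure R).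

(** The fundamental theorem of calculus on [[- n.+1, n.+1]]: dominated convergence gives the limit
    of the integrals, the decay of [F] that of the boundary terms. The successor keeps the interval
    nondegenerate. *)
Lemma Rintegral_derive_eq0 (F f : R -> R) :
  (forall x : R, is_derive x (1 : R) F (f x)) -> continuous f ->
  leb.-integrable setT (EFin \o f) ->
  F n%:R @[n --> \oo] --> 0 -> F (- n%:R) @[n --> \oo] --> 0 ->
  \int[leb]_x f x = 0.
Proof.
move=> dF cf fi F1 F2.
pose f_ n : R -> \bar R := fun x => (f x * \1_(`[- n.+1%:R, n.+1%:R]%classic : set R) x)%:E.
have H1 : (\int[leb]_x f_ n x)%E @[n --> \oo] --> (\int[leb]_x (f x)%:E)%E.
  apply: (dominated_cvg measurableT _ _ _ (integrable_norm fi)) => //.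
  - move=> n; apply/measurable_EFinP; apply: measurable_funM.
      exact: continuous_measurable_fun.
    exact: measurable_indic.
  - move=> x _; apply: cvg_EFin; first exact: nearW.
    apply: cvg_near_cst; near=> n; rewrite /= indicE mem_set ?mulr1//=.
    rewrite in_itv/= -ler_norml.
    near: n; exists (Num.trunc `|x|).+1 => // n /= nx.
    by rewrite (le_trans (ltW (truncnS_gt _)))// ler_nat (leq_trans nx).
  - move=> n x _; rewrite lee_fin normrM ler_piMr// indicE.
    by case: (x \in _); rewrite ?normr1 ?normr0.
have fin n : (\int[leb]_x f_ n x = (F n.+1%:R - F (- n.+1%:R))%:E)%E.
  transitivity (\int[leb]_(x in `[(- n.+1%:R)%R, n.+1%:R%R]) (f x)%:E)%E.
    rewrite [RHS]integral_mkcond; apply: eq_integral => x _.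
    by rewrite patchE /f_ indicE; case: ifP; rewrite ?mulr1 ?mulr0.
  rewrite (@continuous_FTC2 _ f F)// ?EFinB//.
  - by rewrite gtrN// ltr0Sn.
  - exact: continuous_subspaceT.
  - have cF : continuous F.
      by move=> x; exact/differentiable_continuous/derivable1_diffP.
    split; first by [].
      by apply: cvg_at_right_filter; exact: cF.
    by apply: cvg_at_left_filter; exact: cF.
  - by move=> x _; rewrite derive1E derive_val.
have H2 : (F n.+1%:R - F (- n.+1%:R))%:E @[n --> \oo] --> (0%:E : \bar R).
  apply: cvg_EFin; first exact: nearW.
  rewrite -(subr0 0); apply: cvgB.
    by have := F1; rewrite -(cvg_shiftS (fun n => F n%:R)).
  by have := F2; rewrite -(cvg_shiftS (fun n => F (- n%:R))).
rewrite /Rintegral.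
suff -> : (\int[leb]_x (f x)%:E = 0)%E by [].
have H2' : (\int[leb]_x f_ n x)%E @[n --> \oo] --> (0%:E : \bar R).
  rewrite (_ : (fun n => _) = (fun n => (F n.+1%:R - F (- n.+1%:R))%:E))//.
  by apply/funext => n; exact: fin.
exact: (cvg_unique _ H1 H2').
Unshelve. all: end_near. Qed.

Variable s : R.
Hypothesis s0 : 0 < s.
Let p := normal_pdf 0 s.

Lemma normal_pdf0E x : p x = normal_peak s * expR (- (x ^+ 2 / (2 * s ^+ 2))).
Proof.
by rewrite /p normal_pdfE ?gt_eqF// /normal_fun subr0 mulNr mulr_natl.
Qed.

(** From [z <= 1 + z <= expR z]. This decay of order [1 / x^2] disposes of the boundary terms in
    [ibp]. *)
Lemma normal_pdf0_le1Dx x : p x * (x ^+ 2 / (2 * s ^+ 2)) <= normal_peak s.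
Proof.
rewrite normal_pdf0E -mulrA ler_piMr ?normal_peak_ge0// expRN.
rewrite ler_pdivrMl ?expR_gt0// mulr1 (le_trans _ (expR_ge1Dx _))//.
by rewrite lerDr.
Qed.

(** Domination by a Gaussian of twice the deviation, which is integrable. The quotient of the two
    exponentials is [expR (3 x^2 / (8 s^2)) >= 1 + 3 x^2 / (8 s^2)]; the summand [16 s^2] of the
    constant cancels the [s^2] below and leaves [6 x^2], and [1 + 6 x^2 >= |x|]. *)
Let px_le x : `|x * p x| <=
  (1 + 16 * s ^+ 2) * (normal_peak s / normal_peak (2 * s)) * normal_pdf 0 (2 * s) x.
Proof.
have s20 : 0 < 2 * s by rewrite mulr_gt0.
rewrite normal_pdf0E (@normal_pdfE _ 0 (2 * s)) ?gt_eqF// /normal_fun subr0.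
rewrite [leRHS](_ : _ = normal_peak s * ((1 + 16 * s ^+ 2) *
   expR (- x ^+ 2 / ((2 * s) ^+ 2 *+ 2)))); last first.
  by field; rewrite gt_eqF// normal_peak_gt0// gt_eqF.
rewrite !normrM (ger0_norm (normal_peak_ge0 _)) (ger0_norm (expR_ge0 _)) mulrCA.
rewrite ler_wpM2l ?normal_peak_ge0//.
rewrite -ler_pdivlMr ?expR_gt0// -expRN -mulrA -expRD.
rewrite [X in expR X](_ : _ = 3 * x ^+ 2 / (8 * s ^+ 2)); last by field; rewrite gt_eqF.
have h := expR_ge1Dx (3 * x ^+ 2 / (8 * s ^+ 2)).
have s2 : 0 < s ^+ 2 by rewrite exprn_gt0.
apply: (@le_trans _ _ ((1 + 16 * s ^+ 2) * (1 + 3 * x ^+ 2 / (8 * s ^+ 2)))); last first.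
  by rewrite ler_wpM2l// addr_ge0// mulr_ge0// ltW.
rewrite (_ : _ * _ = 1 + 16 * s ^+ 2 + 3 * x ^+ 2 / (8 * s ^+ 2) + 6 * `|x| ^+ 2); last first.
  by rewrite real_normK ?num_real//; field; rewrite gt_eqF.
have h3 : 0 <= 3 * x ^+ 2 / (8 * s ^+ 2).
  by rewrite divr_ge0// mulr_ge0// ?sqr_ge0 ?ltW.
have := sqr_ge0 (`|x| - 1); have := normr_ge0 x; nra.
Qed.

Let mp : measurable_fun setT p. Proof. exact: measurable_normal_pdf. Qed.
Let p_ge0 x : 0 <= p x. Proof. exact: normal_pdf_ge0. Qed.
Let pi_ : leb.-integrable setT (EFin \o p). Proof. exact: integrable_normal_pdf. Qed.

Let xpi : leb.-integrable setT (EFin \o (fun x => `|x * p x|)).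
Proof.
have hi := integrableZl measurableT ((1 + 16 * s ^+ 2) *
  (normal_peak s / normal_peak (2 * s))) (integrable_normal_pdf 0 (2 * s)).
apply: (le_integrable measurableT _ _ hi) => //.
- by apply/measurable_EFinP; apply: measurableT_comp => //; exact: measurable_funM.
- move=> x _; rewrite -EFinM !abse_EFin !lee_fin normr_id.
  by rewrite (le_trans (px_le x))// ler_norm.
Qed.

Let int_bd (h : R -> R) (u : R -> R) : measurable_fun setT h -> measurable_fun setT u ->
  leb.-integrable setT (EFin \o h) -> (forall x, `|u x| <= 1) ->
  leb.-integrable setT (EFin \o (fun x => h x * u x)).
Proof.
move=> mh mu hi u1; apply: (le_integrable measurableT _ _ hi) => //.
- by apply/measurable_EFinP; exact: measurable_funM.
- by move=> x _; rewrite lee_fin normrM ler_piMr.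
Qed.

Let mcos xi : measurable_fun setT (fun x : R => cos (x * xi)).
Proof.
apply: measurableT_comp; last exact: measurable_funM.
by apply: continuous_measurable_fun; exact: continuous_cos.
Qed.
Let msin xi : measurable_fun setT (fun x : R => sin (x * xi)).
Proof.
apply: measurableT_comp; last exact: measurable_funM.
by apply: continuous_measurable_fun; exact: continuous_sin.
Qed.

Let dp (x : R) : is_derive x (1 : R) p (- (x / s ^+ 2) * p x).
Proof.
rewrite (_ : p = fun x => normal_peak s * expR (- (x ^+ 2 / (2 * s ^+ 2)))); last first.
  by apply/funext => y; rewrite normal_pdf0E.
apply: is_derive_eq.
by rewrite /GRing.scale/=; field; rewrite gt_eqF.
Qed.

Let J xi := \int[leb]_x (p x * cos (x * xi)).

Let dJ (xi : R) : is_derive xi (1 : R) J (- \int[leb]_x (x * p x * sin (x * xi))).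
Proof.
have dcos (y x : R) : is_derive x (1 : R) (fun z => p y * cos (y * z)) (- (y * p y * sin (y * x))).
  apply: is_derive_eq; rewrite /GRing.scale/=; ring.
pose f (x y : R) := p y * cos (y * x).
have p1 x y : partial1of2 f x y = - (y * p y * sin (y * x)).
  by rewrite /partial1of2 derive1E /f derive_val.
have Ia : (`]xi - 1, xi + 1[%classic : set R) xi.
  by rewrite /= in_itv/=; apply/andP; split; lra.
have fi x : leb.-integrable setT (EFin \o f x).
  by apply: int_bd => // y; exact: cos_max.
have dd x y : derivable (f^~ y) x 1 by [].
have ub x y : `|partial1of2 f x y| <= `|y * p y|.
  by rewrite p1 normrN normrM ler_piMr// sin_max.
apply: DeriveDef.
  exact: (@derivable_under_integral _ _ _ leb f setT measurableT xi _ _ Ia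
    (fun x _ => fi x) (fun x y _ _ => dd x y) _ (fun=> normr_ge0 _) xpi
    (fun x y _ _ => ub x y)).
rewrite -derive1E (@differentiation_under_integral _ _ _ leb f setT measurableT xi _ _ Ia
    (fun x _ => fi x) (fun x y _ _ => dd x y) _ (fun=> normr_ge0 _) xpi
    (fun x y _ _ => ub x y)).
rewrite -[RHS]mulN1r -RintegralZl//.
  by apply: eq_Rintegral => y _; rewrite p1 mulN1r.
apply: int_bd => //; last by move=> y; exact: sin_max.
  exact: measurable_funM.
apply: (le_integrable measurableT _ _ xpi) => //.
  by apply/measurable_EFinP; exact: measurable_funM.
by move=> x _; rewrite /= normr_id.
Qed.


(** Integration by parts: since [p' = - (x / s^2) p], the derivative of [p x * sin (x * xi)]
    combines the two integrands, and its integral vanishes. *)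
Let ibp xi : \int[leb]_x (x * p x * sin (x * xi)) = s ^+ 2 * xi * J xi.
Proof.
have s2 : s ^+ 2 != 0 by rewrite expf_neq0// gt_eqF.
pose F x := p x * sin (x * xi).
pose f x := - (s ^+ 2)^-1 * (x * p x * sin (x * xi)) + xi * (p x * cos (x * xi)).
have dF (x : R) : is_derive x (1 : R) F (f x).
  have := dp x => dpx; apply: is_derive_eq; rewrite /GRing.scale/= /f.
  by field; rewrite gt_eqF.
have cp : continuous p.
  by move=> x; have := dp x => ?; exact/differentiable_continuous/derivable1_diffP.
have ccos : continuous (fun x : R => cos (x * xi) : R).
  move=> x; have ? : is_derive x (1 : R) (fun x : R => cos (x * xi)) (- sin (x * xi) * xi).
    by apply: is_derive_eq; rewrite /GRing.scale/=; ring.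
  exact/differentiable_continuous/derivable1_diffP.
have csin : continuous (fun x : R => sin (x * xi) : R).
  move=> x; have ? : is_derive x (1 : R) (fun x : R => sin (x * xi)) (cos (x * xi) * xi).
    by apply: is_derive_eq; rewrite /GRing.scale/=; ring.
  exact/differentiable_continuous/derivable1_diffP.
have cf : continuous f.
  move=> x; apply: cvgD.
    apply: cvgM; first exact: cvg_cst.
    by apply: cvgM; [apply: cvgM; [exact: cvg_id|exact: cp]|exact: csin].
  by apply: cvgM; [exact: cvg_cst|apply: cvgM; [exact: cp|exact: ccos]].
have i1 : leb.-integrable setT (EFin \o (fun x => x * p x * sin (x * xi))).
  apply: int_bd => //; last by move=> y; exact: sin_max.
    exact: measurable_funM.
  apply: (le_integrable measurableT _ _ xpi) => //.
    by apply/measurable_EFinP; exact: measurable_funM.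
  by move=> x _; rewrite /= normr_id.
have i2 : leb.-integrable setT (EFin \o (fun x => p x * cos (x * xi))).
  by apply: int_bd => // y; exact: cos_max.
have i1' : leb.-integrable setT (EFin \o (fun x => - (s ^+ 2)^-1 * (x * p x * sin (x * xi)))).
  by rewrite /comp; under eq_fun do rewrite EFinM; exact: integrableZl.
have i2' : leb.-integrable setT (EFin \o (fun x => xi * (p x * cos (x * xi)))).
  by rewrite /comp; under eq_fun do rewrite EFinM; exact: integrableZl.
have fi : leb.-integrable setT (EFin \o f).
  by rewrite /comp; under eq_fun do rewrite EFinD; exact: integrableD.
have Fle x : `|F x| <= p x.
  by rewrite normrM ger0_norm// ler_piMr// sin_max.
have pn n : p n.+1%:R <= 2 * s ^+ 2 * normal_peak s * n.+1%:R^-1.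
  have n0 : 0 < n.+1%:R :> R by rewrite ltr0Sn.
  have := normal_pdf0_le1Dx n.+1%:R.
  rewrite -ler_pdivlMr ?divr_gt0 ?exprn_gt0// ?mulr_gt0 ?exprn_gt0//.
  move=> /le_trans; apply.
  rewrite invf_div mulrA [normal_peak s * _]mulrC ler_wpM2l//.
    by rewrite !mulr_ge0 ?normal_peak_ge0// ltW.
  by rewrite lef_pV2 ?posrE ?exprn_gt0// expr2 ler_peMr ?ler1n ?(ltW n0)//.
have pN x : p (- x) = p x by rewrite !normal_pdf0E sqrrN.
have lim0 : (2 * s ^+ 2 * normal_peak s * n.+1%:R^-1) @[n --> \oo] --> (0 : R).
  by rewrite -[X in _ --> X](mulr0 (2 * s ^+ 2 * normal_peak s)); apply: cvgM;
    [exact: cvg_cst|exact: cvg_harmonic].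
have sq (u : nat -> R) : (forall n, `|F (u n.+1)| <= p n.+1%:R) -> F (u n) @[n --> \oo] --> 0.
  move=> Fu; rewrite -(cvg_shiftS (fun n => F (u n))); apply: norm_cvg0.
  apply: (@squeeze_cvgr _ _ _ _ (cst 0) _ _ _ _ _ lim0).
    by apply: nearW => n; rewrite normr_ge0/= (le_trans (Fu n)).
  exact: cvg_cst.
have := @Rintegral_derive_eq0 F f dF cf fi.
rewrite RintegralD// !RintegralZl// -/(J xi) => H.
have : - (s ^+ 2)^-1 * \int[leb]_x (x * p x * sin (x * xi)) + xi * J xi = 0.
  apply: H; apply: sq => n; first exact: Fle.
  by rewrite (le_trans (Fle _))// pN.
by move=> /eqP; rewrite addr_eq0 mulNr eqr_opp => /eqP h; rewrite -mulrA -h mulrA divff// mul1r.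
Qed.

(** By [dJ] and [ibp], [J] solves [J' = - s^2 xi J]. Hence [J xi * expR (s^2 xi^2 / 2)] has zero
    derivative and keeps its value [J 0 = 1]. *)
Lemma Rintegral_normal_cos xi :
  \int[leb]_x (normal_pdf 0 s x * cos (x * xi)) = expR (- (s ^+ 2 * xi ^+ 2 / 2)).
Proof.
pose K xi := J xi * expR (s ^+ 2 * xi ^+ 2 / 2).
have dK (x : R) : is_derive x (1 : R) K 0.
  have := dJ x; rewrite ibp => dJx; apply: is_derive_eq; rewrite /GRing.scale/=; by field.
have := @is_derive_0_is_cst _ K xi 0 dK.
rewrite /K expr0n/= mulr0 mul0r expR0 mulr1 (_ : J 0 = 1).
  rewrite -/(J xi) expRN => h; apply: (mulIf (lt0r_neq0 (expR_gt0 (s ^+ 2 * xi ^+ 2 / 2)))).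
  by rewrite h mulVf// gt_eqF// expR_gt0.
rewrite /J /Rintegral; under eq_integral do rewrite mulr0 cos0 mulr1.
by rewrite integral_normal_pdf.
Qed.

Lemma Cint_normal_expi xi :
  Cint leb setT (fun x => (normal_pdf 0 s x)%:C * expi (- (xi * x))) =
  (expR (- (s ^+ 2 * xi ^+ 2 / 2)))%:C.
Proof.
have i2 : leb.-integrable setT (EFin \o (fun x => p x * cos (x * xi))).
  by apply: int_bd => // y; exact: cos_max.
have i1 : leb.-integrable setT (EFin \o (fun x => p x * sin (x * xi))).
  by apply: int_bd => // y; exact: sin_max.
apply: complex_ext => /=.
  rewrite -Rintegral_normal_cos; apply: eq_Rintegral => x _.
  by rewrite mul0r subr0 cosN [xi * x]mulrC.
transitivity (\int[leb]_x (- 1 * (p x * sin (x * xi)))).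
  apply: eq_Rintegral => x _; rewrite /= mul0r addr0 sinN [xi * x]mulrC/=.
  by rewrite mulrN mulN1r.
rewrite RintegralZl//.
have pN x : p (- x) = p x by rewrite !normal_pdf0E sqrrN.
(* The integrand is odd, so reflection shows that its integral equals its own opposite. *)
have : \int[leb]_x (p x * sin (x * xi)) = - 1 * \int[leb]_x (p x * sin (x * xi)).
  rewrite -RintegralZl//; rewrite {1}/Rintegral.
  rewrite -(integral_reflect (f := fun x => (p x * sin (x * xi))%:E)).
    by congr fine; apply: eq_integral => x _; rewrite pN mulNr sinN mulrN mulN1r.
  by apply/measurable_EFinP; exact: measurable_funM.
lra.
Qed.

End gaussian.

(** * Fourier transforms of integrable functions *)

Section ae_lebesgue.
Context {R : realType}.
Notation leb := (@lebesgue_measure R).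

Lemma ae_lebS (P Q : R -> Prop) : (forall x, P x -> Q x) ->
  {ae leb, forall x, P x} -> {ae leb, forall x, Q x}.
Proof. by move=> PQ; apply: (@filterS _ _ (ae_filter_ringOfSetsType leb)). Qed.

Lemma ae_lebS2 (P Q S : R -> Prop) : (forall x, P x -> Q x -> S x) ->
  {ae leb, forall x, P x} -> {ae leb, forall x, Q x} -> {ae leb, forall x, S x}.
Proof. by move=> PQS; apply: (@filterS2 _ _ (ae_filter_ringOfSetsType leb)). Qed.

End ae_lebesgue.

Section chf.
Context {R : realType} {d} {T : measurableType d}.
Notation leb := (@lebesgue_measure R).
Variable mu : {measure set T -> \bar R}.
Implicit Types (h : T -> R[i]) (tau : T -> R).

(** Fourier transform of the image under [tau] of the complex measure [h mu]. Lebesgue measure with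
    [tau = id] gives the ordinary transform, and [tau = ln |f|] gives [m_{f,+}] and [m_{f,-}]. *)
Definition chf h tau (xi : R) : R[i] :=
  Cint mu setT (fun s => h s * expi (- (xi * tau s))).

Lemma cmeasurable_expi_mul tau (xi : R) : measurable_fun setT tau ->
  cmeasurable setT (fun s => expi (- (xi * tau s))).
Proof.
by move=> mt; apply: cmeasurable_expi; apply: measurableT_comp => //; exact: measurable_funM.
Qed.

Lemma cintegrable_chf h tau xi : cintegrable mu setT h -> measurable_fun setT tau ->
  cintegrable mu setT (fun s => h s * expi (- (xi * tau s))).
Proof.
move=> hi mt; apply: (@cintegrableM_bounded _ _ _ _ _ _ _ 1) => //.
  exact: cmeasurable_expi_mul.
by move=> s _; rewrite cabs_expi.
Qed.

Lemma cabs_chf_le h tau xi : cintegrable mu setT h -> measurable_fun setT tau ->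
  cabs (chf h tau xi) <= 2 * \int[mu]_s cabs (h s).
Proof.
move=> hi mt; rewrite -lee_fin EFinM.
have mh := cintegrable_measurable hi.
rewrite /Rintegral fineK; last by apply: integrable_fin_num => //; exact: cintegrable_cabs.
apply: (le_trans (@cabs_Cint_le _ _ _ mu setT _ measurableT _)).
  by apply: cmeasurableM => //; exact: cmeasurable_expi_mul.
rewrite (eq_integral (fun s => (cabs (h s))%:E))// => s _.
by rewrite cabsM cabs_expi mulr1.
Qed.

Let continuous_chf_real h tau (a b : R) (r : R -> T -> R) :
  cintegrable mu setT h ->
  (forall s, continuous (fun xi => r xi s)) ->
  (forall xi, mu.-integrable setT (EFin \o r xi)) ->
  (forall xi s, `|r xi s| <= cabs (h s)) ->
  continuous (fun xi => \int[mu]_s r xi s).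
Proof.
move=> hi cr ri rh xi.
have Ia : xi \in (`]xi - 1, xi + 1[%classic : set R).
  by rewrite inE/= in_itv/=; apply/andP; split; lra.
apply: (@continuity_under_integral _ _ _ mu r setT measurableT (xi - 1) (xi + 1)
  _ _ (cabs \o h) _ _ xi Ia).
- by move=> x _; exact: ri.
- by apply: aeW => s _ x _; exact: cr.
- exact: cintegrable_cabs.
- by move=> x _; apply: aeW => s _; exact: rh.
Qed.

Lemma continuous_chf h tau : cintegrable mu setT h -> measurable_fun setT tau ->
  continuous (fun xi => complex.Re (chf h tau xi)) /\
  continuous (fun xi => complex.Im (chf h tau xi)).
Proof.
move=> hi mt.
have ccos s : continuous (fun xi : R => cos (- (xi * tau s))).
  move=> x; have ? : is_derive x (1 : R) (fun x : R => cos (- (x * tau s)))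
      (sin (- (x * tau s)) * tau s).
    by apply: is_derive_eq; rewrite /GRing.scale/=; ring.
  exact/differentiable_continuous/derivable1_diffP.
have csin s : continuous (fun xi : R => sin (- (xi * tau s))).
  move=> x; have ? : is_derive x (1 : R) (fun x : R => sin (- (x * tau s)))
      (- cos (- (x * tau s)) * tau s).
    by apply: is_derive_eq; rewrite /GRing.scale/=; ring.
  exact/differentiable_continuous/derivable1_diffP.
split.
- apply: (@continuous_chf_real h tau 0 0 (fun xi s => complex.Re (h s * expi (- (xi * tau s))))) => //.
  + move=> s x; under eq_fun do rewrite cReM.
    by apply: cvgB; apply: cvgM; [exact: cvg_cst|exact: ccos|exact: cvg_cst|exact: csin].
  + by move=> xi; have [] := cintegrable_chf xi hi mt.
  + move=> xi s; apply: le_trans (Re_le_cabs _) _.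
    by rewrite cabsM cabs_expi mulr1.
- apply: (@continuous_chf_real h tau 0 0 (fun xi s => complex.Im (h s * expi (- (xi * tau s))))) => //.
  + move=> s x; under eq_fun do rewrite cImM.
    by apply: cvgD; apply: cvgM; [exact: cvg_cst|exact: csin|exact: cvg_cst|exact: ccos].
  + by move=> xi; have [] := cintegrable_chf xi hi mt.
  + move=> xi s; apply: le_trans (Im_le_cabs _) _.
    by rewrite cabsM cabs_expi mulr1.
Qed.

Lemma cmeasurable_chf h tau : cintegrable mu setT h -> measurable_fun setT tau ->
  cmeasurable setT (chf h tau).
Proof.
by move=> hi mt; have [c1 c2] := continuous_chf hi mt; split; exact: continuous_measurable_fun.
Qed.

Lemma continuous_cabs_chf h tau : cintegrable mu setT h -> measurable_fun setT tau ->
  continuous (fun xi => cabs (chf h tau xi)).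
Proof.
move=> hi mt x; have [c1 c2] := continuous_chf hi mt.
apply: continuous_comp; last exact: sqrt_continuous.
by apply: cvgD; rewrite expr2; under eq_fun do rewrite expr2; apply: cvgM;
  [exact: c1|exact: c1|exact: c2|exact: c2].
Qed.

End chf.

Section multiplication_formula.
Context {R : realType} {d} {T : measurableType d}.
Notation leb := (@lebesgue_measure R).
Variable mu : {sigma_finite_measure set T -> \bar R}.

Definition fhat (phi : R -> R[i]) : R -> R[i] := chf leb phi id.

(** Both sides are iterated integrals of [h s * expi (- (xi * tau s)) * g xi], which converges
    absolutely because its modulus is the product [|h s| |g xi|]. *)
Lemma Cint_chf_mul (h : T -> R[i]) (tau : T -> R) (g : R -> R[i]) :
  cintegrable mu setT h -> measurable_fun setT tau -> cintegrable leb setT g ->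
  Cint leb setT (fun xi => chf mu h tau xi * g xi) =
  Cint mu setT (fun s => h s * fhat g (tau s)).
Proof.
move=> hi mt gi.
have mh := cintegrable_measurable hi; have mg := cintegrable_measurable gi.
pose F (z : R * T) := h z.2 * expi (- (z.1 * tau z.2)) * g z.1.
have mF : cmeasurable setT F.
  apply: cmeasurableM; last exact: (cmeasurable_comp mg measurable_fst).
  apply: cmeasurableM; first exact: (cmeasurable_comp mh measurable_snd).
  apply: cmeasurable_expi; apply: measurableT_comp => //.
  by apply: measurable_funM => //; exact: (measurableT_comp mt).
have Fi : cintegrable (leb \x mu)%E setT F.
  apply: cintegrable_prodP => //.
  have mch : measurable_fun setT (fun s => (cabs (h s))%:E).
    exact/measurable_EFinP/cmeasurable_cabs.
  have mcg : measurable_fun setT (fun s => (cabs (g s))%:E).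
    exact/measurable_EFinP/cmeasurable_cabs.
  have -> : (\int[leb]_x \int[mu]_y (cabs (F (x, y)))%:E =
      \int[leb]_x (\int[mu]_s (cabs (h s))%:E * (cabs (g x))%:E))%E.
    apply: eq_integral => x _; rewrite -ge0_integralZr ?lee_fin ?cabs_ge0//.
      by apply: eq_integral => s _; rewrite /F/= !cabsM cabs_expi mulr1 EFinM.
    by move=> s _; rewrite lee_fin cabs_ge0.
  rewrite ge0_integralZl//; last by apply: integral_ge0 => x _; rewrite lee_fin cabs_ge0.
    have /cintegrableP[//|_ hoo] := hi; have /cintegrableP[//|_ goo] := gi.
    by rewrite lte_mul_pinfty// ?ge0_fin_numE// integral_ge0// => x _; rewrite lee_fin cabs_ge0.
  by move=> x _; rewrite lee_fin cabs_ge0.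
transitivity (Cint leb setT (fun x => Cint mu setT (fun y => F (x, y)))).
  apply: Cint_eq => x _; rewrite /F/= CintZr//; exact: cintegrable_chf.
rewrite Cint_fubini//; apply: Cint_eq => s _; rewrite /F/= /fhat /chf.
under eq_fun do rewrite -mulrA.
rewrite CintZ//.
  by congr (_ * _); apply: Cint_eq => x _; rewrite mulrC [x * _]mulrC.
under eq_fun do rewrite mulrC [_ * tau s]mulrC.
exact: (@cintegrable_chf _ _ _ leb g id).
Qed.

End multiplication_formula.

Section gaussian_transform.
Context {R : realType}.
Notation leb := (@lebesgue_measure R).
Variable t : R.
Hypothesis t0 : 0 < t.

Definition gweight (x : R) : R := expR (- (x ^+ 2 / (2 * t ^+ 2))).

Lemma gweight_ge0 x : 0 <= gweight x. Proof. exact: expR_ge0. Qed.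
Lemma gweight_gt0 x : 0 < gweight x. Proof. exact: expR_gt0. Qed.
Lemma gweight_le1 x : gweight x <= 1.
Proof. rewrite /gweight -[leRHS]expR0 ler_expR oppr_le0.
by apply: divr_ge0; [exact: sqr_ge0|apply: mulr_ge0 => //; exact: sqr_ge0]. Qed.
Lemma gweightE x : gweight x = (normal_peak t)^-1 * normal_pdf 0 t x.
Proof.
by rewrite normal_pdf0E// mulKf// gt_eqF// normal_peak_gt0// gt_eqF.
Qed.
Lemma measurable_gweight : measurable_fun setT gweight.
Proof.
apply: measurableT_comp => //; apply: measurableT_comp => //.
by apply: measurable_funM => //; exact: measurable_funX.
Qed.
Lemma integrable_gweight : leb.-integrable setT (EFin \o gweight).
Proof.
rewrite /comp; under eq_fun do rewrite gweightE EFinM.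
by apply: integrableZl => //; exact: integrable_normal_pdf.
Qed.
Lemma cintegrable_gweight (a : R) :
  cintegrable leb setT (fun x => (gweight x)%:C * expi (a * x)).
Proof.
apply: (@cintegrableM_bounded _ _ _ _ _ _ _ 1) => //.
- split => /=; first exact: integrable_gweight.
  exact: integrable0.
- by apply: cmeasurable_expi; exact: measurable_funM.
- by move=> x _; rewrite cabs_expi.
Qed.

Lemma normal_peakE : normal_peak t = (t * Num.sqrt (2 * pi))^-1.
Proof.
rewrite /normal_peak; congr (_^-1).
by rewrite -mulr_natl mulrCA sqrtrM ?sqr_ge0// sqrtr_sqr gtr0_norm.
Qed.
End gaussian_transform.

Section gaussian_transform_hat.
Context {R : realType}.
Notation leb := (@lebesgue_measure R).
Variable t : R.
Hypothesis t0 : 0 < t.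
Notation gweight := (gweight t).

(** The source of [2 * pi] in the inversion formula: the peaks for the deviations [t] and [t^-1]
    have product [1 / (2 pi)]. *)
Lemma normal_peakV : (normal_peak t)^-1 = 2 * pi * normal_peak t^-1.
Proof.
have s2 : 0 < Num.sqrt (2 * pi) :> R by rewrite sqrtr_gt0 mulr_gt0// pi_gt0.
have sq : Num.sqrt (2 * pi) ^+ 2 = 2 * pi :> R.
  by rewrite sqr_sqrtr// mulr_ge0// pi_ge0.
rewrite !normal_peakE ?invr_gt0//; move: (Num.sqrt _) s2 sq => r r0 <-; field.
by rewrite !gt_eqF.
Qed.

(** The weight is a multiple of a normal density, so its transform is again Gaussian: a bump of mass
    [2 pi] and width [t^-1] centred at the modulating frequency [a]. It is the kernel through which
    [phi] is recovered from its transform in [bessel] and [fhat_eq0]. *)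
Lemma fhat_gweight (a x : R) :
  fhat (fun xi => (gweight xi)%:C * expi (a * xi)) x =
  (2 * pi * normal_pdf 0 t^-1 (x - a))%:C.
Proof.
have ti : 0 < t^-1 by rewrite invr_gt0.
rewrite /fhat /chf.
transitivity (Cint leb setT (fun s => ((normal_peak t)^-1)%:C *
    ((normal_pdf 0 t s)%:C * expi (- ((x - a) * s))))).
  apply: Cint_eq => s _; rewrite gweightE// rmorphM -!mulrA -expiD.
  by congr (_ * (_ * expi _)); ring.
rewrite CintZ//.
  rewrite Cint_normal_expi// normal_peakV normal_pdf0E// -rmorphM; congr (_%:C).
  rewrite -!mulrA; congr (_ * (_ * (_ * expR _))); field.
  by rewrite gt_eqF.
apply: (@cintegrable_chf _ _ _ leb (fun s => (normal_pdf 0 t s)%:C) id) => //.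
split; [exact: integrable_normal_pdf|exact: integrable0].
Qed.

End gaussian_transform_hat.

(** * Boundedness of the transform in the L2 norm *)

Section bessel.
Context {R : realType}.
Notation leb := (@lebesgue_measure R).
Variable phi : R -> R[i].
Hypothesis phii : cintegrable leb setT phi.
Let mphi : cmeasurable setT phi. Proof. exact: cintegrable_measurable phii. Qed.
Let Psi := fhat phi.
Let mPsi : cmeasurable setT Psi. Proof. exact: cmeasurable_chf. Qed.

Let mpdf s a : measurable_fun setT (fun y : R => normal_pdf 0 s (y - a)).
Proof.
apply: (measurableT_comp (@measurable_normal_pdf R 0 s)).
exact: measurable_funB.
Qed.

Let int_pdf s a : (\int[leb]_y (normal_pdf 0 s (y - a))%:E = 1)%E.
Proof.
rewrite -(integral_normal_pdf 0 s) -[RHS](ge0_integral_shift (- a))//.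
- by apply/measurable_EFinP; exact: measurable_normal_pdf.
- by move=> x; rewrite lee_fin normal_pdf_ge0.
Qed.

Let pdfN s (x : R) : 0 < s -> normal_pdf 0 s (- x) = normal_pdf 0 s x.
Proof. by move=> s0; rewrite !normal_pdf0E// sqrrN. Qed.

(** Transforming the damped conjugate of [Psi] returns [phi], conjugated and smoothed: the kernel
    centred at [x] is the transform of [gweight t] times a character, so the multiplication formula
    exchanges it with [phi]. *)
Let conj_hat t x : 0 < t ->
  fhat (fun xi => conjc (Psi xi) * (gweight t xi)%:C) x =
  conjc (Cint leb setT (fun y => phi y * (2 * pi * normal_pdf 0 t^-1 (y - x))%:C)).
Proof.
move=> t0.
have gi := cintegrable_gweight t0 x.
rewrite -(eq_fun (fun y => congr1 (fun z => phi y * z) (fhat_gweight t0 x y))).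
rewrite -(@Cint_chf_mul _ _ _ leb phi id)//.
rewrite -CintJ//; last first.
  under eq_fun do rewrite mulrC.
  apply: (cintegrableM_bounded (M := 2 * \int[leb]_s cabs (phi s))) => //.
  by move=> xi _; exact: cabs_chf_le.
apply: Cint_eq => xi _; rewrite !conjcM conj_expi conjc_real.
by rewrite -!mulrA.
Qed.

Let mpdf2 t : measurable_fun setT (fun z : R * R => normal_pdf 0 t (z.2 - z.1)).
Proof.
apply: (measurableT_comp (@measurable_normal_pdf R 0 t)).
exact: measurable_funB.
Qed.

(** With [h = conj Psi * gweight], the left side is the integral of [Psi * h], which the
    multiplication formula turns into a double integral of [phi x * conj (phi y)] against the kernel
    [k]. Bounding [|phi x| |phi y|] by [|phi x|^2 + |phi y|^2] and using that [k] has mass [2 pi] in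
    each variable yields [4 pi]; two uses of [cabs_Cint_le] supply the remaining factor 4. *)
Let weighted t : 0 < t ->
  (\int[leb]_xi (cabs (Psi xi) ^+ 2 * gweight t xi)%:E <=
   (16 * pi)%:E * \int[leb]_x (cabs (phi x) ^+ 2)%:E)%E.
Proof.
move=> t0; have ti : 0 < t^-1 by rewrite invr_gt0.
pose h xi := conjc (Psi xi) * (gweight t xi)%:C.
have bPsi xi : cabs (Psi xi) <= 2 * \int[leb]_s cabs (phi s) by exact: cabs_chf_le.
have hi : cintegrable leb setT h.
  rewrite /h; under eq_fun do rewrite mulrC.
  apply: (cintegrableM_bounded (M := 2 * \int[leb]_s cabs (phi s))) => //.
  - by split; [exact: integrable_gweight|exact: integrable0].
  - exact: cmeasurableJ.
  - by move=> xi _; rewrite cabsJ.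
have eq1 : Cint leb setT (fun xi => Psi xi * h xi) =
    (\int[leb]_xi (cabs (Psi xi) ^+ 2 * gweight t xi))%:C.
  rewrite -CintR; apply: Cint_eq => xi _.
  by rewrite /h mulrA mulcJ -rmorphM.
have wi : leb.-integrable setT (fun xi => (cabs (Psi xi) ^+ 2 * gweight t xi)%:E).
  have Hi : cintegrable leb setT (fun xi => h xi * Psi xi).
    by apply: (cintegrableM_bounded (M := 2 * \int[leb]_s cabs (phi s))) => // xi _.
  have := cintegrable_cabs measurableT Hi; apply: eq_integrable => // xi _.
  rewrite /h !cabsM cabsJ cabsR ger0_norm ?gweight_ge0//; congr EFin; ring.
have -> : (\int[leb]_xi (cabs (Psi xi) ^+ 2 * gweight t xi)%:E =
    (cabs (Cint leb setT (fun xi => Psi xi * h xi)))%:E)%E.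
  rewrite eq1 cabsR ger0_norm.
    by rewrite /Rintegral fineK//; exact: integrable_fin_num.
  by apply: Rintegral_ge0 => x _; rewrite mulr_ge0 ?sqr_ge0 ?gweight_ge0.
have mh := cintegrable_measurable hi.
have mfh : cmeasurable setT (fhat h) by exact: cmeasurable_chf.
rewrite (@Cint_chf_mul _ _ _ leb phi id)//.
have mc2 : measurable_fun setT (fun x => (cabs (phi x) ^+ 2)%:E).
  exact: cmeasurable_cabs2.
apply: (le_trans (@cabs_Cint_le _ _ _ leb setT _ measurableT _)).
  exact: cmeasurableM.
pose k x y := (2 * pi * normal_pdf 0 t^-1 (y - x))%:E.
have k0 x y : (0 <= k x y)%E by rewrite lee_fin mulr_ge0 ?normal_pdf_ge0// mulr_ge0// pi_ge0.
have mk x : measurable_fun setT (k x).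
  by apply/measurable_EFinP; exact: measurable_funM.
have mk2 y : measurable_fun setT (k^~ y).
  apply/measurable_EFinP; apply: measurable_funM => //.
  apply: (measurableT_comp (@measurable_normal_pdf R 0 t^-1)).
  exact: measurable_funB.
have mkk : measurable_fun setT (fun z : R * R => k z.1 z.2).
  by apply/measurable_EFinP; exact: measurable_funM.
have k1 x : (\int[leb]_y k x y = (2 * pi)%:E)%E.
  under eq_integral do rewrite /k EFinM.
  rewrite ge0_integralZl ?int_pdf ?mule1// ?lee_fin ?mulr_ge0 ?pi_ge0//.
    by apply/measurable_EFinP; exact: mpdf.
  by move=> y _; rewrite lee_fin normal_pdf_ge0.
have k2 y : (\int[leb]_x k x y = (2 * pi)%:E)%E.
  rewrite -(k1 y); apply: eq_integral => x _.
  by rewrite /k -(pdfN (x - y))// opprB.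
have step x : ((cabs (phi x * fhat h x))%:E <=
    2%:E * \int[leb]_y (((cabs (phi x) ^+ 2)%:E + (cabs (phi y) ^+ 2)%:E) * k x y))%E.
  rewrite cabsM conj_hat// cabsJ EFinM.
  have mck : measurable_fun setT (fun y => (cabs (phi y))%:E * k x y)%E.
    by apply: emeasurable_funM => //; exact/measurable_EFinP/cmeasurable_cabs.
  have ck0 y : (0 <= (cabs (phi y))%:E * k x y)%E.
    by rewrite mule_ge0// lee_fin cabs_ge0.
  have h1 : ((cabs (Cint leb setT (fun y => phi y * (2 * pi * normal_pdf 0 t^-1 (y - x))%:C)))%:E
      <= 2%:E * \int[leb]_y ((cabs (phi y))%:E * k x y))%E.
    apply: (le_trans (@cabs_Cint_le _ _ _ leb setT _ measurableT _)).
      by apply: cmeasurableM => //; apply/cmeasurableR/measurable_EFinP; exact: (mk x).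
    rewrite le_eqVlt; apply/orP; left; apply/eqP; congr (_ * _)%E.
    apply: eq_integral => y _; rewrite cabsM cabsR ger0_norm ?EFinM//.
    by rewrite mulr_ge0 ?normal_pdf_ge0// mulr_ge0// pi_ge0.
  apply: (le_trans (lee_wpmul2l _ h1)); first by rewrite lee_fin cabs_ge0.
  rewrite muleCA; apply: lee_wpmul2l => //.
  rewrite -ge0_integralZl//; last by rewrite lee_fin cabs_ge0.
  apply: ge0_le_integral => //.
  - by move=> y _; rewrite mule_ge0// lee_fin cabs_ge0.
  - exact: measurable_funeM.
  - apply: emeasurable_funM; last exact: mk.
    exact: (emeasurable_funD (measurable_cst _) mc2).
  - move=> y _; rewrite muleA; apply: lee_wpmul2r => //.
    rewrite -EFinM -EFinD lee_fin.
    have := sqr_ge0 (cabs (phi x) - cabs (phi y)).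
    have := sqr_ge0 (cabs (phi x)); have := sqr_ge0 (cabs (phi y)); nra.
have sq0 x : (0 <= (cabs (phi x) ^+ 2)%:E)%E by rewrite lee_fin sqr_ge0.
have mqk x : measurable_fun setT (fun y => (cabs (phi y) ^+ 2)%:E * k x y)%E.
  exact: emeasurable_funM.
have mqkk : measurable_fun setT (fun z : R * R => (cabs (phi z.2) ^+ 2)%:E * k z.1 z.2)%E.
  by apply: emeasurable_funM => //; exact: (measurableT_comp mc2).
have mI : measurable_fun setT (fun x => \int[leb]_y ((cabs (phi y) ^+ 2)%:E * k x y))%E.
  exact: (@measurable_integral2 _ _ _ _ _ leb (fun z => (cabs (phi z.2) ^+ 2)%:E * k z.1 z.2)%E).
have inner x : (\int[leb]_y (((cabs (phi x) ^+ 2)%:E + (cabs (phi y) ^+ 2)%:E) * k x y) =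
   (cabs (phi x) ^+ 2)%:E * (2 * pi)%:E + \int[leb]_y ((cabs (phi y) ^+ 2)%:E * k x y))%E.
  under eq_integral do rewrite ge0_muleDl//.
  rewrite ge0_integralD//.
  - by congr (_ + _)%E; rewrite -(k1 x) ge0_integralZl//; exact: mk.
  - by move=> y _; rewrite mule_ge0.
  - exact: (emeasurable_funM (measurable_cst _) (mk x)).
  - by move=> y _; rewrite mule_ge0.
  - exact: mqk.
have pi20 : (0 <= (2 * pi)%:E :> \bar R)%E by rewrite lee_fin mulr_ge0// pi_ge0.
have in0 x : (0 <= \int[leb]_y ((cabs (phi y) ^+ 2)%:E * k x y))%E.
  by apply: integral_ge0 => y _; rewrite mule_ge0.
have outer : (\int[leb]_x ((cabs (phi x) ^+ 2)%:E * (2 * pi)%:E +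
     \int[leb]_y ((cabs (phi y) ^+ 2)%:E * k x y)) =
   (4 * pi)%:E * \int[leb]_x (cabs (phi x) ^+ 2)%:E)%E.
  have mc : measurable_fun setT (fun x => (cabs (phi x) ^+ 2)%:E * (2 * pi)%:E)%E.
    by apply: emeasurable_funM.
  rewrite ge0_integralD//; last by move=> x _; rewrite mule_ge0.
  have -> : (\int[leb]_x \int[leb]_y ((cabs (phi y) ^+ 2)%:E * k x y) =
      \int[leb]_y \int[leb]_x ((cabs (phi y) ^+ 2)%:E * k x y))%E.
    apply: (fubini_tonelli (m1 := leb) (m2 := leb)
      (fun z => (cabs (phi z.2) ^+ 2)%:E * k z.1 z.2)%E) => //.
    by move=> z; rewrite mule_ge0.
  have -> : (\int[leb]_y \int[leb]_x ((cabs (phi y) ^+ 2)%:E * k x y) =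
      \int[leb]_y ((cabs (phi y) ^+ 2)%:E * (2 * pi)%:E))%E.
    by apply: eq_integral => y _; rewrite -(k2 y) ge0_integralZl//; exact: mk2.
  rewrite ge0_integralZr//.
  rewrite -ge0_muleDr//.
  by rewrite muleC -EFinD; congr (_%:E * _)%E; ring.
apply: (@le_trans _ _ (2%:E * \int[leb]_x (2%:E *
    ((cabs (phi x) ^+ 2)%:E * (2 * pi)%:E + \int[leb]_y ((cabs (phi y) ^+ 2)%:E * k x y))))%E).
  apply: lee_wpmul2l => //; apply: ge0_le_integral => //.
  - by move=> x _; rewrite lee_fin cabs_ge0.
  - by apply/measurable_EFinP/cmeasurable_cabs; exact: cmeasurableM.
  - apply: measurable_funeM; apply: emeasurable_funD => //.
    exact: emeasurable_funM.
  - by move=> x _; rewrite -inner.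
rewrite ge0_integralZl//.
- rewrite outer !muleA -!EFinM le_eqVlt; apply/orP; left; apply/eqP.
  by congr (_%:E * _)%E; ring.
- by apply: emeasurable_funD => //; exact: emeasurable_funM.
- by move=> x _; rewrite adde_ge0// mule_ge0.
Qed.

(* The constant is not sharp: only boundedness of the transform in L2 matters. *)
Lemma bessel : (\int[leb]_xi (cabs (fhat phi xi) ^+ 2)%:E <=
   (16 * pi)%:E * \int[leb]_x (cabs (phi x) ^+ 2)%:E)%E.
Proof.
have n0 n : 0 < n.+1%:R :> R by rewrite ltr0Sn.
(* The weights increase to 1 with their deviation, so monotone convergence removes them from
   [weighted]. *)
pose g n xi := (cabs (Psi xi) ^+ 2 * gweight n.+1%:R xi)%:E.
have mg n : measurable_fun setT (g n).
  apply/measurable_EFinP; apply: measurable_funM; last exact: measurable_gweight.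
  exact/measurable_EFinP/cmeasurable_cabs2.
have g0 n x : (0 <= g n x)%E by rewrite lee_fin mulr_ge0 ?sqr_ge0 ?gweight_ge0.
have ndg x : {homo g^~ x : n m / (n <= m)%N >-> (n <= m)%E}.
  move=> n m nm; rewrite lee_fin ler_wpM2l ?sqr_ge0// ler_expR lerN2.
  rewrite ler_wpM2l ?sqr_ge0// lef_pV2 ?posrE ?mulr_gt0 ?exprn_gt0//.
  by rewrite ler_wpM2l// lerXn2r ?nnegrE// ler_nat.
have := @cvg_monotone_convergence _ _ _ leb setT measurableT g mg
  (fun n x _ => g0 n x) (fun x _ => ndg x).
have -> : (\int[leb]_x limn (g^~ x) = \int[leb]_xi (cabs (Psi xi) ^+ 2)%:E)%E.
  apply: eq_integral => x _; apply/cvg_lim => //.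
  apply: cvg_EFin; first exact: nearW.
  rewrite -[X in _ --> X]mulr1; apply: cvgM; first exact: cvg_cst.
  rewrite -[X in _ --> X]expR0; apply: continuous_cvg; first exact: continuous_expR.
  rewrite -[X in _ --> X]oppr0; apply: cvgN.
  rewrite -[X in _ --> X](mulr0 (x ^+ 2 / 2)).
  rewrite (_ : (fun n => _) = (fun n => x ^+ 2 / 2 * (n.+1%:R^-1 * n.+1%:R^-1))); last first.
    by apply/funext => n; field; rewrite gt_eqF.
  apply: cvgM; first exact: cvg_cst.
  rewrite -[X in _ --> X](mulr0 (0 : R)); apply: cvgM; exact: cvg_harmonic.
move=> cg; rewrite -(cvg_lim _ cg)//; apply: lime_le.
  by apply/cvg_ex; eexists; exact: cg.
by apply: nearW => n; exact: weighted.
Qed.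

End bessel.

(* Testing against narrow Gaussians determines the primitive of [u] at every
   point, hence [u] almost everywhere by Lebesgue differentiation. *)
Section gaussian_separation.
Context {R : realType}.
Notation leb := (@lebesgue_measure R).
Variable u : R -> R.
Hypothesis ui : leb.-integrable setT (EFin \o u).
Hypothesis u0 : forall s a : R, 0 < s ->
  \int[leb]_x (u x * normal_pdf 0 s (x - a)) = 0.

Let mu_ : measurable_fun setT u.
Proof. by have /integrableP[/measurable_EFinP] := ui. Qed.

Let p := @normal_pdf R 0.
Let mp s : measurable_fun setT (p s). Proof. exact: measurable_normal_pdf. Qed.
Let p_ge0 s x : 0 <= p s x. Proof. exact: normal_pdf_ge0. Qed.

Let half b : set R := `]-oo, b]%classic.
Let s_ n : R := n.+1%:R^-1.
Let s_gt0 n : 0 < s_ n. Proof. by rewrite invr_gt0 ltr0Sn. Qed.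

(** The indicator of []-oo, b]] smoothed at scale [s_ n]. In this rescaled form the Gaussian is
    fixed and dominates the integrand as [n] varies; [KE] rewrites it as a superposition of the test
    Gaussians. *)
Let K b n x : \bar R := (\int[leb]_z (p 1 z * \1_(half b) (s_ n * z + x))%:E)%E.

Let mind b : measurable_fun setT (\1_(half b) : R -> R).
Proof. by apply: measurable_indic; exact: measurable_itv. Qed.

Let ind_ge0 b x : 0 <= \1_(half b) x :> R.
Proof. by rewrite indicE. Qed.

Let mKint b n x : measurable_fun setT (fun z => (p 1 z * \1_(half b) (s_ n * z + x))%:E).
Proof.
apply/measurable_EFinP; apply: measurable_funM => //.
by apply: (measurableT_comp (mind b)); apply: measurable_funD.
Qed.

Let K_ge0 b n x : (0 <= K b n x)%E.
Proof. by apply: integral_ge0 => z _; rewrite lee_fin mulr_ge0. Qed.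

Let K_le1 b n x : (K b n x <= 1)%E.
Proof.
rewrite -(integral_normal_pdf 0 1); apply: ge0_le_integral => //.
- by move=> z _; rewrite lee_fin mulr_ge0.
- exact: mKint.
- by apply/measurable_EFinP; exact: measurable_normal_pdf.
- by move=> z _; rewrite lee_fin ler_piMr.
Qed.

Let mK b n : measurable_fun setT (K b n).
Proof.
apply: (@measurable_integral2 _ _ _ _ _ leb
  (fun z : R * R => (p 1 z.2 * \1_(half b) (s_ n * z.2 + z.1))%:E)).
apply/measurable_EFinP; apply: measurable_funM.
  exact: (measurableT_comp (mp 1)).
apply: (measurableT_comp (mind b)); apply: measurable_funD => //.
exact: measurable_funM.
Qed.

Let KE b n x : K b n x = (\int[leb]_a (p (s_ n) (x - a) * \1_(half b) a)%:E)%E.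
Proof.
have mpi : measurable_fun setT (fun a : R => (p (s_ n) (x - a) * \1_(half b) a)%:E).
  apply/measurable_EFinP; apply: measurable_funM; last exact: mind.
  apply: (measurableT_comp (mp _)); exact: measurable_funB.
have pi0 a : (0 <= (p (s_ n) (x - a) * \1_(half b) a)%:E)%E.
  by rewrite lee_fin mulr_ge0.
rewrite (@ge0_integral_affine _ (s_ n) x)//.
rewrite -ge0_integralZl//; last 2 first.
- apply/measurable_EFinP; apply: measurable_funM.
    apply: (measurableT_comp (mp _)); apply: measurable_funB => //.
    by apply: measurable_funD => //; exact: measurable_funM.
  by apply: (measurableT_comp (mind b)); apply: measurable_funD.
- by rewrite lee_fin ltW.
apply: eq_integral => z _; rewrite -EFinM mulrA; congr (_ * _)%:E.
rewrite /p !normal_pdf0E//.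
have -> : normal_peak 1 = s_ n * normal_peak (s_ n) :> R.
  rewrite !normal_peakE// mul1r invfM mulrA divff ?gt_eqF// mul1r//.
rewrite -mulrA; congr (_ * (_ * expR _)).
by field; rewrite gt_eqF.
Qed.

(** At [x = b] the value is [1 / 2] for every [n], whence the exception; one point is negligible in
    [int_half]. *)
Let K_cvg b x : x != b -> K b n x @[n --> \oo] --> (\1_(half b) x : R)%:E.
Proof.
move=> xb.
have -> : (\1_(half b) x : R)%:E = (\int[leb]_z (p 1 z * \1_(half b) x)%:E)%E.
  under eq_integral do rewrite EFinM.
  rewrite ge0_integralZr//.
  - by rewrite integral_normal_pdf mul1e.
  - by apply/measurable_EFinP; exact: measurable_normal_pdf.
  - by move=> z _; rewrite lee_fin p_ge0.
apply: (dominated_cvg measurableT _ _ _ (integrable_normal_pdf 0 1)) => //.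
- by move=> n; exact: mKint.
- move=> z _; apply: cvg_EFin; first exact: nearW.
  apply: cvgM; first exact: cvg_cst.
  have lim : s_ n * z + x @[n --> \oo] --> x.
    rewrite -[X in _ --> X]add0r; apply: cvgD; last exact: cvg_cst.
    rewrite -(mul0r z); apply: cvgM; last exact: cvg_cst.
    exact: cvg_harmonic.
  apply: cvg_near_cst.
  have [xltb|bltx] := ltP x b.
    near=> n; rewrite !indicE !mem_set//= /half/= in_itv/= ?(ltW xltb)//.
    by rewrite ltW//; near: n; exact: (cvgr_lt x).
  have {}bltx : b < x by rewrite lt_neqAle eq_sym xb.
  near=> n; rewrite !indicE !memNset//= /half/= in_itv/= leNgt ?bltx//.
  by apply/negP; rewrite negbK; near: n; exact: (cvgr_gt x).
- by move=> n z _; rewrite abse_EFin lee_fin ger0_norm ?mulr_ge0// ler_piMr.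
Unshelve. all: end_near. Qed.

Let mpind b n x : measurable_fun setT (fun a : R => (p (s_ n) (x - a) * \1_(half b) a)%:E).
Proof.
apply/measurable_EFinP; apply: measurable_funM; last exact: mind.
apply: (measurableT_comp (mp _)); exact: measurable_funB.
Qed.

Let pind_ge0 b n x a : (0 <= (p (s_ n) (x - a) * \1_(half b) a)%:E)%E.
Proof. by rewrite lee_fin mulr_ge0. Qed.

Let pind_int b n x : leb.-integrable setT (fun a : R => (p (s_ n) (x - a) * \1_(half b) a)%:E).
Proof.
apply/integrableP; split; first exact: mpind.
under eq_integral do rewrite gee0_abs//.
by rewrite -KE (le_lt_trans (K_le1 b n x))// ltry.
Qed.

(** By [KE] the smoothed indicator averages Gaussians centred at points [a <= b]. Fubini integrates
    in [x] first, where the hypothesis on [u] gives 0 for each [a]. *)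
Let uK0 b n : (\int[leb]_x ((u x)%:E * K b n x) = 0)%E.
Proof.
pose F (z : R * R) := (u z.1 * (p (s_ n) (z.1 - z.2) * \1_(half b) z.2))%:E.
have mF : measurable_fun setT F.
  apply/measurable_EFinP; apply: measurable_funM; first exact: (measurableT_comp mu_).
  apply: measurable_funM; last exact: (measurableT_comp (mind b)).
  apply: (measurableT_comp (mp _)); exact: measurable_funB.
have Fi : (leb \x leb)%E.-integrable setT F.
  apply/integrable12ltyP => //.
  have /integrableP[_ ioo] := ui; apply: le_lt_trans ioo.
  apply: ge0_le_integral => //.
  - by move=> x _; apply: integral_ge0.
  - by apply: (@measurable_integral2 _ _ _ _ _ leb (abse \o F)); exact: measurableT_comp.
  - by apply: measurableT_comp => //; exact/measurable_EFinP.
  - move=> x _.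
    have -> : (\int[leb]_y `|F (x, y)| = `|(u x)%:E| * K b n x)%E.
      rewrite KE -ge0_integralZl//; last exact: mpind.
      apply: eq_integral => y _; rewrite /F/= -EFinM normrM; congr (_ * _)%:E.
      by rewrite ger0_norm// mulr_ge0.
    by rewrite -[leRHS]mule1; apply: lee_wpmul2l => //; exact: K_le1.
transitivity (\int[leb]_x \int[leb]_y F (x, y))%E.
  apply: eq_integral => x _; rewrite KE -integralZl//.
rewrite (Fubini Fi); apply: integral0_eq => a _.
have upi : leb.-integrable setT (fun x => (u x * p (s_ n) (x - a))%:E).
  apply: (le_integrable measurableT _ _ (integrableZl measurableT (normal_peak (s_ n)) ui)).
  - apply/measurable_EFinP; apply: measurable_funM => //.
    apply: (measurableT_comp (mp _)); exact: measurable_funB.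
  - move=> x _; rewrite -EFinM !abse_EFin lee_fin !normrM mulrC ler_wpM2r//.
    rewrite ger0_norm// (le_trans _ (ler_norm _))// /p normal_pdf_ub//.
    by rewrite gt_eqF.
have : (\int[leb]_x (u x * p (s_ n) (x - a))%:E = 0)%E.
  have /integrable_fin_num := upi => /(_ measurableT) /fineK <-.
  by congr EFin; exact: u0.
rewrite /F/= indicE; case: (_ \in _) => h.
  by rewrite -[RHS]h; apply: eq_integral => x _; rewrite mulr1.
by apply: integral0_eq => x _; rewrite !mulr0.
Qed.

Let int_half b : \int[leb]_(x in half b) u x = 0.
Proof.
have muE : measurable_fun setT (fun x => (u x)%:E) by exact/measurable_EFinP.
have aeb : {ae leb, forall x, setT x -> ((u x)%:E * K b n x)%E @[n --> \oo] -->
    ((u x)%:E * (\1_(half b) x : R)%:E)%E}.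
  exists [set b]; split => //; first exact: lebesgue_measure_set1.
  move=> x /=; apply: contra_notP => /eqP xb _.
  by apply: cvgeZl => //; exact: K_cvg.
have [] := @dominated_convergence _ _ _ leb setT measurableT
  (fun n x => (u x)%:E * K b n x)%E (fun x => (u x)%:E * (\1_(half b) x : R)%:E)%E
  (abse \o (EFin \o u)) _ _ aeb _ _.
- by move=> n; exact: (emeasurable_funM muE (mK b n)).
- by apply: (emeasurable_funM muE); apply/measurable_EFinP; exact: mind.
- exact: integrable_norm.
- apply: aeW => x n _; rewrite abseM -[leRHS]mule1.
  by apply: lee_wpmul2l => //; rewrite gee0_abs ?K_ge0// K_le1.
move=> _ _.
rewrite (_ : [sequence _]_n = cst 0%E); last by apply/funext => n; exact: uK0.
move=> /(cvg_unique _ (cvg_cst (0%E : \bar R))) => /(_ (@ereal_hausdorff R)) h.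
rewrite /Rintegral integral_mkcond; transitivity (fine (0%E : \bar R)); last by [].
congr fine; rewrite h; apply: eq_integral => x _; rewrite patchE indicE.
by case: ifP; rewrite ?mule1 ?mule0.
Qed.

Lemma gaussian_separation : {ae leb, forall x, u x = 0}.
Proof.
have li : locally_integrable setT u by apply: open_integrable_locally => //; exact: openT.
have ii y : leb.-integrable [set` Interval -oo%O (BRight y)] (EFin \o u).
  exact: integrableS ui.
have := FTC1 ii li; apply: ae_lebS => x h.
have [|_ <-] := h; first by first [exact: ltNy | rewrite bnd_simp | rewrite ltNyr].
rewrite (_ : (fun _ => _) = cst 0); last by apply/funext => y; exact: int_half.
by rewrite derive1_cst.
Qed.

End gaussian_separation.

(** The multiplication formula against a modulated weight of deviation [s^-1] shows that [phi]
    annihilates every Gaussian of deviation [s], at any centre. [gaussian_separation] then applies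
    to the real and imaginary parts. *)
Lemma fhat_eq0 {R : realType} (phi : R -> R[i]) :
  cintegrable (@lebesgue_measure R) setT phi -> (forall xi, fhat phi xi = 0) ->
  {ae @lebesgue_measure R, forall x, phi x = 0}.
Proof.
move=> phii phi0.
have key s a : 0 < s -> Cint lebesgue_measure setT
    (fun x => (normal_pdf 0 s (x - a))%:C * phi x) = 0.
  move=> s0; have t0 : 0 < s^-1 by rewrite invr_gt0.
  have := @Cint_chf_mul R _ _ lebesgue_measure phi id _ phii (@measurable_id _ _ _)
    (cintegrable_gweight t0 a).
  rewrite (_ : (fun xi => _) = fun=> 0); last first.
    by apply/funext => xi; rewrite -/(fhat phi xi) phi0 mul0r.
  rewrite Cint0 => /esym.
  rewrite (_ : (fun x => phi x * _) = fun x => (2 * pi)%:C *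
      ((normal_pdf 0 s (x - a))%:C * phi x)); last first.
    by apply/funext => x; rewrite fhat_gweight// invrK rmorphM mulrC mulrA.
  rewrite CintZ//.
    move/eqP; rewrite mulf_eq0 => /orP[|/eqP//].
    by rewrite -cabs_eq0 cabsR normr_eq0 mulf_eq0 gt_eqF// gt_eqF// pi_gt0.
  under eq_fun do rewrite mulrC.
  apply: (cintegrableM_bounded (M := normal_peak s)) => //.
    apply: cmeasurableR; apply: (measurableT_comp (measurable_normal_pdf _ _)).
    exact: measurable_funB.
  by move=> x _; rewrite cabsR ger0_norm ?normal_pdf_ge0// normal_pdf_ub// gt_eqF.
have [ir ii] := phii.
have h1 : {ae @lebesgue_measure R, forall x, complex.Re (phi x) = 0}.
  apply: (gaussian_separation ir) => s a s0.
  have := congr1 (@complex.Re R) (key s a s0) => /= h.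
  rewrite -[RHS]h; apply: eq_Rintegral => x _.
  by rewrite cReM/= mul0r subr0 mulrC.
have h2 : {ae @lebesgue_measure R, forall x, complex.Im (phi x) = 0}.
  apply: (gaussian_separation ii) => s a s0.
  have := congr1 (@complex.Im R) (key s a s0) => /= h.
  rewrite -[RHS]h; apply: eq_Rintegral => x _.
  by rewrite cImM/= mul0r addr0 mulrC.
by apply: ae_lebS2 h1 h2 => x r0 i0; exact: complex_ext.
Qed.

(** * The Fourier transform on L2 *)

Section L2_functions.
Context {R : realType}.
Notation leb := (@lebesgue_measure R).
Implicit Types phi psi : R -> R[i].

Lemma L2R_le phi (psi : R -> \bar R) : cmeasurable setT phi ->
  measurable_fun setT psi -> (\int[leb]_x psi x < +oo)%E ->
  (forall x, (cabs (phi x) ^+ 2)%:E <= psi x)%E -> L2R phi.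
Proof.
move=> mphi mpsi psioo le; split => //; apply: le_lt_trans psioo.
apply: ge0_le_integral => //.
- by move=> x _; rewrite lee_fin sqr_ge0.
- exact: cmeasurable_cabs2.
Qed.

Lemma L2RM_bounded phi psi (M : R) : L2R phi -> cmeasurable setT psi ->
  (forall x, cabs (psi x) <= M) -> L2R (fun x => psi x * phi x).
Proof.
move=> [mphi phioo] mpsi bpsi.
apply: (@L2R_le _ (fun x => (M ^+ 2)%:E * (cabs (phi x) ^+ 2)%:E)%E).
- exact: cmeasurableM.
- by apply: measurable_funeM; exact: cmeasurable_cabs2.
- rewrite ge0_integralZl//.
  + by rewrite lte_mul_pinfty// lee_fin sqr_ge0.
  + exact: cmeasurable_cabs2.
  + by move=> x _; rewrite lee_fin sqr_ge0.
  + by rewrite lee_fin sqr_ge0.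
- move=> x; rewrite cabsM exprMn -EFinM lee_fin ler_wpM2r ?sqr_ge0//.
  by rewrite lerXn2r ?nnegrE ?cabs_ge0// (le_trans (cabs_ge0 _) (bpsi x)).
Qed.

Lemma cabs_sqD_le (z w : R[i]) : cabs (z + w) ^+ 2 <= 2 * cabs z ^+ 2 + 2 * cabs w ^+ 2.
Proof.
rewrite !cabs_sq cReD cImD.
have := sqr_ge0 (complex.Re z - complex.Re w); have := sqr_ge0 (complex.Im z - complex.Im w).
nra.
Qed.

Lemma integral_cabs_sqD_le phi psi : cmeasurable setT phi -> cmeasurable setT psi ->
  (\int[leb]_x (cabs (phi x + psi x) ^+ 2)%:E <=
   2%:E * \int[leb]_x (cabs (phi x) ^+ 2)%:E + 2%:E * \int[leb]_x (cabs (psi x) ^+ 2)%:E)%E.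
Proof.
move=> m1 m2.
have q0 (f : R -> R[i]) x : (0 <= (cabs (f x) ^+ 2)%:E)%E by rewrite lee_fin sqr_ge0.
rewrite -!ge0_integralZl//; [|exact: cmeasurable_cabs2..].
rewrite -ge0_integralD//; last 4 first.
- by move=> x _; rewrite mule_ge0.
- by apply: measurable_funeM; exact: cmeasurable_cabs2.
- by move=> x _; rewrite mule_ge0.
- by apply: measurable_funeM; exact: cmeasurable_cabs2.
apply: ge0_le_integral => //.
- by move=> x _; exact: (q0 (fun x => phi x + psi x)).
- by apply: cmeasurable_cabs2; exact: cmeasurableD.
- by apply: emeasurable_funD; apply: measurable_funeM; exact: cmeasurable_cabs2.
- by move=> x _; rewrite -!EFinM -EFinD lee_fin cabs_sqD_le.
Qed.

Lemma L2RD phi psi : L2R phi -> L2R psi -> L2R (fun x => phi x + psi x).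
Proof.
move=> [m1 i1] [m2 i2]; split; first exact: cmeasurableD.
apply: le_lt_trans (integral_cabs_sqD_le m1 m2) _.
by rewrite lte_add_pinfty// lte_mul_pinfty.
Qed.

Lemma L2RZ (z : R[i]) phi : L2R phi -> L2R (fun x => z * phi x).
Proof.
by move=> h; apply: (L2RM_bounded (M := cabs z)) => //; exact: cmeasurable_cst.
Qed.

Lemma L2RN phi : L2R phi -> L2R (fun x => - phi x).
Proof. by move=> h; under eq_fun do rewrite -mulN1r; exact: L2RZ. Qed.

Lemma L2RB phi psi : L2R phi -> L2R psi -> L2R (fun x => phi x - psi x).
Proof. by move=> h1 h2; apply: L2RD => //; exact: L2RN. Qed.

Lemma L2R_reflect phi : L2R phi -> L2R (fun x => phi (- x)).
Proof.
move=> [m i]; split.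
  by apply: (cmeasurable_comp m); exact: oppr_measurable.
rewrite (ge0_integral_reflect (f := fun x => (cabs (phi x) ^+ 2)%:E))//.
  exact: cmeasurable_cabs2.
by move=> x; rewrite lee_fin sqr_ge0.
Qed.

Lemma L2R0 : L2R (fun _ : R => 0 : R[i]).
Proof.
split; first exact: cmeasurable_cst.
by rewrite integral0_eq// => x _; rewrite cabs0 expr0n.
Qed.

Lemma cintegrable_L2M phi psi : L2R phi -> L2R psi ->
  cintegrable leb setT (fun x => phi x * psi x).
Proof.
move=> [m1 i1] [m2 i2]; apply/cintegrableP => //; split; first exact: cmeasurableM.
apply: (@le_lt_trans _ _ (\int[leb]_x ((cabs (phi x) ^+ 2)%:E + (cabs (psi x) ^+ 2)%:E))%E).
  apply: ge0_le_integral => //.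
  - by move=> x _; rewrite lee_fin cabs_ge0.
  - by apply/measurable_EFinP/cmeasurable_cabs/cmeasurableM.
  - by apply: emeasurable_funD; exact: cmeasurable_cabs2.
  - move=> x _; rewrite -EFinD lee_fin cabsM.
    have := sqr_ge0 (cabs (phi x) - cabs (psi x)).
    have := sqr_ge0 (cabs (phi x)); have := sqr_ge0 (cabs (psi x)); nra.
rewrite ge0_integralD//.
- by rewrite lte_add_pinfty.
- by move=> x _; rewrite lee_fin sqr_ge0.
- exact: cmeasurable_cabs2.
- by move=> x _; rewrite lee_fin sqr_ge0.
- exact: cmeasurable_cabs2.
Qed.

(** Plays the part of Cauchy-Schwarz: [a b <= e^-1 a^2 + e b^2], with the same [e] that controls the
    norm of [phi], so that the bound tends to 0 with [e]. *)
Lemma cabs_Cint_L2M_le phi psi (e G : R) : 0 < e ->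
  cmeasurable setT phi -> cmeasurable setT psi ->
  (\int[leb]_x (cabs (phi x) ^+ 2)%:E <= (e ^+ 2)%:E)%E ->
  (\int[leb]_x (cabs (psi x) ^+ 2)%:E <= G%:E)%E ->
  cabs (Cint leb setT (fun x => phi x * psi x)) <= 2 * e * (1 + G).
Proof.
move=> e0 m1 m2 i1 i2; rewrite -lee_fin.
apply: (le_trans (@cabs_Cint_le _ _ _ leb setT _ measurableT _)).
  exact: cmeasurableM.
rewrite -mulrA EFinM; apply: lee_wpmul2l => //.
have q0 (f : R -> R[i]) x : (0 <= (cabs (f x) ^+ 2)%:E)%E by rewrite lee_fin sqr_ge0.
apply: (@le_trans _ _ (\int[leb]_x (e^-1%:E * (cabs (phi x) ^+ 2)%:E + e%:E * (cabs (psi x) ^+ 2)%:E))%E).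
  apply: ge0_le_integral => //.
  - by move=> x _; rewrite lee_fin cabs_ge0.
  - by apply/measurable_EFinP/cmeasurable_cabs/cmeasurableM.
  - by apply: emeasurable_funD; apply: measurable_funeM; exact: cmeasurable_cabs2.
  - move=> x _; rewrite -!EFinM -EFinD lee_fin cabsM.
    rewrite -(ler_pM2l e0) mulrDr !mulrA divff ?gt_eqF// mul1r.
    have := sqr_ge0 (cabs (phi x) - e * cabs (psi x)).
    have := sqr_ge0 (cabs (phi x)); have := sqr_ge0 (e * cabs (psi x)); nra.
rewrite ge0_integralD//; last 4 first.
- by move=> x _; rewrite mule_ge0// lee_fin invr_ge0 ltW.
- by apply: measurable_funeM; exact: cmeasurable_cabs2.
- by move=> x _; rewrite mule_ge0// lee_fin ltW.
- by apply: measurable_funeM; exact: cmeasurable_cabs2.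
rewrite !ge0_integralZl//; [|exact: cmeasurable_cabs2|by rewrite lee_fin ltW
  |exact: cmeasurable_cabs2|by rewrite lee_fin invr_ge0 ltW].
rewrite mulrDr mulr1 EFinD EFinM; apply: leeD; last first.
  by apply: lee_wpmul2l => //; rewrite lee_fin ltW.
apply: (le_trans (lee_wpmul2l _ i1)); first by rewrite lee_fin invr_ge0 ltW.
by rewrite -EFinM lee_fin expr2 mulrA mulVf ?mul1r// gt_eqF.
Qed.

End L2_functions.

(** * Gaussian wave packets and the transform tested against them *)

Section wave_packets.
Context {R : realType}.
Notation leb := (@lebesgue_measure R).
Implicit Types phi psi : R -> R[i].

Definition packet (p q x : R) : R[i] := (gweight 1 (x - p))%:C * expi (q * x).

Lemma cabs_packet p q x : cabs (packet p q x) = gweight 1 (x - p).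
Proof. by rewrite cabsM cabs_expi mulr1 cabsR ger0_norm// gweight_ge0. Qed.

Lemma packet_neq0 p q x : packet p q x != 0.
Proof. by rewrite -cabs_gt0 cabs_packet gweight_gt0. Qed.

Lemma cmeasurable_packet p q : cmeasurable setT (packet p q).
Proof.
apply: cmeasurableM.
  apply: cmeasurableR; apply: (measurableT_comp (measurable_gweight 1)).
  exact: measurable_funB.
by apply: cmeasurable_expi; exact: measurable_funM.
Qed.

Let mgshift (p : R) : measurable_fun setT (fun x : R => (gweight 1 (x - p))%:E).
Proof.
apply/measurable_EFinP; apply: (measurableT_comp (measurable_gweight 1)).
exact: measurable_funB.
Qed.

Let gshift_oo p : (\int[leb]_x (gweight 1 (x - p))%:E < +oo)%E.
Proof.
rewrite (ge0_integral_shift (- p) (f := fun x => (gweight 1 x)%:E)).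
+ have /integrableP[_] := integrable_gweight (@ltr01 R).
  by under eq_integral do rewrite gee0_abs ?lee_fin ?gweight_ge0//.
+ by apply/measurable_EFinP; exact: measurable_gweight.
+ by move=> x; rewrite lee_fin gweight_ge0.
Qed.

Lemma L2R_packet p q : L2R (packet p q).
Proof.
apply: (@L2R_le _ _ (fun x => (gweight 1 (x - p))%:E)) => //.
- exact: cmeasurable_packet.
- by move=> x; rewrite lee_fin cabs_packet expr2 ler_piMr ?gweight_ge0 ?gweight_le1.
Qed.

Lemma cintegrable_packet p q : cintegrable leb setT (packet p q).
Proof.
apply/cintegrableP => //; split; first exact: cmeasurable_packet.
by under eq_integral do rewrite cabs_packet.
Qed.

Lemma packetM p q t x : packet p q x * expi (- (t * x)) = packet p (q - t) x.
Proof. by rewrite /packet -mulrA -expiD; congr (_ * expi _); ring. Qed.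

(** This is [sqrt (2 pi)], the factor that the transform puts on the standard Gaussian; its square
    [2 pi] is the constant of Fourier inversion. *)
Definition kappa : R := 2 * pi * normal_peak 1.

Lemma kappa_gt0 : 0 < kappa.
Proof. by rewrite mulr_gt0 ?mulr_gt0 ?pi_gt0 ?normal_peak_gt0// oner_neq0. Qed.

(** Up to the phase and [kappa], the transform is the quarter turn [(p, q) -> (q, - p)] of the
    time-frequency plane. Translation by [p] reduces to [fhat_gweight] at [t = 1], where the weight
    and its transform have equal width. *)
Lemma fhat_packet p q xi :
  fhat (packet p q) xi = kappa%:C * expi (p * q) * packet q (- p) xi.
Proof.
rewrite /fhat /chf -(@Cint_shift _ p); last first.
  apply: cmeasurableM; first exact: cmeasurable_packet.
  exact: cmeasurable_expi_mul.
transitivity (Cint leb setT (fun x => expi (p * (q - xi)) *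
    ((gweight 1 x)%:C * expi (q * x) * expi (- (xi * x))))).
  apply: Cint_eq => x _; rewrite /packet addrK -!mulrA -!expiD [RHS]mulrCA -expiD.
  by congr (_ * expi _); ring.
rewrite CintZ//; last first.
  apply: (@cintegrable_chf _ _ _ leb _ id) => //.
  exact: cintegrable_gweight.
have := fhat_gweight (@ltr01 R) q xi; rewrite /fhat /chf => ->.
rewrite invr1 /packet normal_pdf0E// /kappa -/(gweight 1 (xi - q)).
have -> : expi (p * (q - xi)) = expi (p * q) * expi (- p * xi).
  by rewrite -expiD; congr expi; ring.
have realcM (a b : R) : (a * b)%:C = a%:C * b%:C by rewrite rmorphM.
rewrite [2 * pi * (_ * _)]mulrA realcM.
move: (real_complex _ (2 * pi * _)) (real_complex _ (gweight _ _)) => A B.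
by move: (expi _) (expi _) => C D; ring.
Qed.

Definition gint phi := cmeasurable setT phi /\
  forall p q, cintegrable leb setT (fun x => phi x * packet p q x).

Lemma L2R_gint phi : L2R phi -> gint phi.
Proof.
move=> h; split; first by case: h.
by move=> p q; apply: cintegrable_L2M => //; exact: L2R_packet.
Qed.

Lemma gintB phi psi : gint phi -> gint psi -> gint (fun x => phi x - psi x).
Proof.
move=> [m1 i1] [m2 i2]; split; first exact: cmeasurableB.
by move=> p q; under eq_fun do rewrite mulrBl; exact: cintegrableB.
Qed.

(** Packets centred at 0 share one Gaussian factor, so the hypothesis says that the integrable
    function [phi * packet 0 0] has zero transform. The factor vanishes nowhere and can be
    removed. *)
Lemma gint_eq0 phi : gint phi ->
  (forall q, Cint leb setT (fun x => phi x * packet 0 q x) = 0) ->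
  {ae leb, forall x, phi x = 0}.
Proof.
move=> [m i] phi0.
have := @fhat_eq0 _ _ (i 0 0).
have h xi : fhat (fun x => phi x * packet 0 0 x) xi = 0.
  rewrite -(phi0 (- xi)) /fhat /chf; apply: Cint_eq => x _.
  by rewrite -mulrA packetM sub0r.
move=> /(_ h); apply: ae_lebS => x /eqP; rewrite mulf_eq0.
by rewrite (negbTE (packet_neq0 _ _ _)) orbF => /eqP.
Qed.

(* The Fourier transform on L2, characterised by the multiplication formula
   against Gaussian wave packets, a family stable under [fhat]. *)
Definition is_FT phi Phi := [/\ gint phi, gint Phi &
  forall p q, Cint leb setT (fun x => Phi x * packet p q x) =
              Cint leb setT (fun x => phi x * fhat (packet p q) x)].

Lemma gint_fhat phi p q : gint phi ->
  cintegrable leb setT (fun x => phi x * fhat (packet p q) x).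
Proof.
move=> [m i]; rewrite (_ : (fun _ => _) = (fun x => kappa%:C * expi (p * q) *
    (phi x * packet q (- p) x))); last first.
  by apply/funext => x; rewrite fhat_packet mulrCA.
exact: cintegrableZ.
Qed.

Lemma Cint_fhat_packet phi p q : gint phi ->
  Cint leb setT (fun x => phi x * fhat (packet p q) x) =
  kappa%:C * expi (p * q) * Cint leb setT (fun x => phi x * packet q (- p) x).
Proof.
move=> [m i]; rewrite -CintZ//; apply: Cint_eq => x _.
by rewrite fhat_packet mulrCA.
Qed.

Lemma is_FT_uniqr phi1 phi2 Phi1 Phi2 : is_FT phi1 Phi1 -> is_FT phi2 Phi2 ->
  {ae leb, forall x, phi1 x = phi2 x} -> {ae leb, forall x, Phi1 x = Phi2 x}.
Proof.
move=> [g1 G1 F1] [g2 G2 F2] e.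
have : {ae leb, forall x, Phi1 x - Phi2 x = 0}.
  apply: gint_eq0; first exact: gintB.
  move=> q; rewrite (_ : (fun _ => _) =
      (fun x => Phi1 x * packet 0 q x - Phi2 x * packet 0 q x)); last first.
    by apply/funext => x; rewrite mulrBl.
  rewrite CintB//; [|exact: G1.2|exact: G2.2].
  rewrite F1 F2; apply/eqP; rewrite subr_eq0; apply/eqP; apply: ae_eq_Cint => //.
  - by have /cintegrable_measurable := gint_fhat 0 q g1.
  - by have /cintegrable_measurable := gint_fhat 0 q g2.
  - by apply: ae_lebS e => x -> _.
by apply: ae_lebS => x /eqP; rewrite subr_eq0 => /eqP.
Qed.

Lemma is_FT_uniql phi1 phi2 Phi1 Phi2 : is_FT phi1 Phi1 -> is_FT phi2 Phi2 ->
  {ae leb, forall x, Phi1 x = Phi2 x} -> {ae leb, forall x, phi1 x = phi2 x}.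
Proof.
move=> [g1 G1 F1] [g2 G2 F2] e.
have : {ae leb, forall x, phi1 x - phi2 x = 0}.
  apply: gint_eq0; first exact: gintB.
  move=> q.
  have c0 : kappa%:C * expi ((- q) * 0) != 0.
    by rewrite -cabs_gt0 cabsM cabs_expi mulr1 cabsR normr_gt0 gt_eqF// kappa_gt0.
  apply: (mulfI c0); rewrite [RHS]mulr0.
  (* The transform of [packet (- q) 0] is a multiple of [packet 0 q], so testing transforms reaches
     the packets that [gint_eq0] asks for. *)
  have := @Cint_fhat_packet _ (- q) 0 (gintB g1 g2); rewrite opprK => <-.
  rewrite (_ : (fun _ => _) = (fun x => phi1 x * fhat (packet (- q) 0) x -
      phi2 x * fhat (packet (- q) 0) x)); last first.
    by apply/funext => x; rewrite mulrBl.
  rewrite CintB//; [|exact: gint_fhat|exact: gint_fhat].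
  rewrite -F1 -F2; apply/eqP; rewrite subr_eq0; apply/eqP; apply: ae_eq_Cint => //.
  - by have /cintegrable_measurable := G1.2 (- q) 0.
  - by have /cintegrable_measurable := G2.2 (- q) 0.
  - by apply: ae_lebS e => x -> _.
by apply: ae_lebS => x /eqP; rewrite subr_eq0 => /eqP.
Qed.

Lemma is_FTD phi1 phi2 Phi1 Phi2 : is_FT phi1 Phi1 -> is_FT phi2 Phi2 ->
  is_FT (fun x => phi1 x + phi2 x) (fun x => Phi1 x + Phi2 x).
Proof.
have gintD (phi psi : R -> R[i]) : gint phi -> gint psi -> gint (fun x => phi x + psi x).
  move=> [m1 i1] [m2 i2]; split; first exact: cmeasurableD.
  by move=> p q; under eq_fun do rewrite mulrDl; exact: cintegrableD.
move=> [g1 G1 F1] [g2 G2 F2]; split; [exact: gintD|exact: gintD|] => p q.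
transitivity (Cint leb setT (fun x => Phi1 x * packet p q x) +
    Cint leb setT (fun x => Phi2 x * packet p q x)).
  rewrite -CintD//; [|exact: G1.2|exact: G2.2].
  by apply: Cint_eq => x _; rewrite mulrDl.
rewrite F1 F2 -CintD//; [|exact: gint_fhat|exact: gint_fhat].
by apply: Cint_eq => x _; rewrite mulrDl.
Qed.

Lemma is_FTZ (z : R[i]) phi Phi : is_FT phi Phi ->
  is_FT (fun x => z * phi x) (fun x => z * Phi x).
Proof.
have gintZ (psi : R -> R[i]) : gint psi -> gint (fun x => z * psi x).
  move=> [m i]; split; first by apply: cmeasurableM => //; exact: cmeasurable_cst.
  by move=> p q; under eq_fun do rewrite -mulrA; exact: cintegrableZ.
move=> [g G F]; split; [exact: gintZ|exact: gintZ|] => p q.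
transitivity (z * Cint leb setT (fun x => Phi x * packet p q x)).
  rewrite -CintZ//; [|exact: G.2].
  by apply: Cint_eq => x _; rewrite mulrA.
rewrite F -CintZ//; [|exact: gint_fhat].
by apply: Cint_eq => x _; rewrite mulrA.
Qed.

Lemma is_FT0 : is_FT (fun=> 0) (fun=> 0).
Proof.
have g0 : gint (fun=> 0) by apply: L2R_gint; exact: L2R0.
split => // p q; congr Cint; apply/funext => x; by rewrite !mul0r.
Qed.

(** Fourier inversion. Two quarter turns send the packet [(p, q)] to [(- p, - q)], which is its
    reflection; the two phases cancel and the factor [kappa ^+ 2] remains. Every L2 function thereby
    becomes a transform in [is_FT_surj]. *)
Lemma is_FT_reflect phi Phi : is_FT (fun x => phi (- x)) Phi -> gint phi ->
  is_FT (fun x => (kappa ^+ 2)^-1%:C * Phi x) phi.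
Proof.
move=> [g G F] gphi; have [mG iG] := G.
have gc : gint (fun x => (kappa ^+ 2)^-1%:C * Phi x).
  split; first by apply: cmeasurableM => //; exact: cmeasurable_cst.
  move=> p q; under eq_fun do rewrite -mulrA; exact: cintegrableZ.
split => // p q.
rewrite Cint_fhat_packet//.
have -> : Cint leb setT (fun x => (kappa ^+ 2)^-1%:C * Phi x * packet q (- p) x) =
    (kappa ^+ 2)^-1%:C * Cint leb setT (fun x => Phi x * packet q (- p) x).
  by rewrite -CintZ//; apply: Cint_eq => x _; rewrite mulrA.
rewrite F Cint_fhat_packet//.
have -> : Cint leb setT (fun x => phi (- x) * packet (- p) (- q) x) =
    Cint leb setT (fun x => phi x * packet p q x).
  rewrite -[RHS]Cint_reflect; last first.
    by apply: cmeasurableM; [case: gphi|exact: cmeasurable_packet].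
  apply: Cint_eq => x _; congr (_ * _); rewrite /packet /gweight.
  have -> : (x - - p) ^+ 2 = (- x - p) ^+ 2 by ring.
  by have -> : - q * x = q * - x by ring.
rewrite !mulrA mulrN; set z := Cint _ _ _.
rewrite -[LHS]mul1r; congr (_ * z).
rewrite (_ : expi (- (q * p)) = (expi (p * q))^-1); last first.
  apply: (@mulIf _ (expi (p * q))); first by rewrite -cabs_gt0 cabs_expi.
  rewrite mulVf -?cabs_gt0 ?cabs_expi// -expiD [q * p]mulrC addrC subrr.
  by rewrite expi0.
have k0 : (kappa%:C : R[i]) != 0 by rewrite -cabs_gt0 cabsR normr_gt0 gt_eqF// kappa_gt0.
have e0 : expi (p * q) != 0 by rewrite -cabs_gt0 cabs_expi.
rewrite fmorphV rmorphXn /=; field.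
by rewrite k0 e0.
Qed.

End wave_packets.

Section truncated_transform.
Context {R : realType}.
Notation leb := (@lebesgue_measure R).

Definition trunc (phi : R -> R[i]) (n : nat) (x : R) : R[i] :=
  (\1_(`[- n%:R, n%:R]%classic : set R) x)%:C * phi x.

Lemma indic_abs_le1 (A : set R) x : `|\1_A x : R| <= 1.
Proof. by rewrite indicE; case: (_ \in _); rewrite ?normr1 ?normr0. Qed.

Lemma L2R_trunc phi n : L2R phi -> L2R (trunc phi n).
Proof.
move=> h; apply: (L2RM_bounded (M := 1)) => //.
  by apply: cmeasurableR; apply: measurable_indic; exact: measurable_itv.
by move=> x; rewrite cabsR indic_abs_le1.
Qed.

Lemma cintegrable_trunc phi n : L2R phi -> cintegrable leb setT (trunc phi n).
Proof.
move=> h; apply: cintegrable_L2M => //.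
apply: (@L2R_le _ _ (fun x => (\1_(`[- n%:R, n%:R]%classic : set R) x)%:E)).
- by apply: cmeasurableR; apply: measurable_indic; exact: measurable_itv.
- by apply/measurable_EFinP; apply: measurable_indic; exact: measurable_itv.
- rewrite integral_indic ?setIT//; have := @lebesgue_measure_itv R `[- n%:R, n%:R].
  by move=> /= ->; case: ifP; rewrite ?ltry.
- move=> x; rewrite lee_fin cabsR indicE; case: (_ \in _).
    by rewrite normr1 expr1n.
  by rewrite normr0 expr0n.
Qed.

Lemma Ftrunc_fhat phi n xi : Ftrunc phi n xi = fhat (trunc phi n) xi.
Proof.
rewrite /Ftrunc Cint_mkcond /fhat /chf; apply: Cint_eq => x _.
by rewrite /trunc mulrA [x * xi]mulrC.
Qed.

Lemma trunc_cvg phi : L2R phi ->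
  (\int[leb]_x (cabs (phi x - trunc phi n x) ^+ 2)%:E)%E @[n --> \oo] --> (0 : \bar R)%E.
Proof.
move=> h; have [m i] := h.
have -> : (0 = \int[leb]_x (cst 0 x : \bar R))%E by rewrite integral0.
have mc n : cmeasurable setT (fun x => phi x - trunc phi n x).
  by apply: cmeasurableB => //; case: (L2R_trunc n h).
have pin : leb.-integrable setT (fun x => (cabs (phi x) ^+ 2)%:E).
  apply/integrableP; split; first exact: cmeasurable_cabs2.
  by under eq_integral do rewrite gee0_abs ?lee_fin ?sqr_ge0//.
apply: (dominated_cvg measurableT _ _ _ pin) => //.
- by move=> n; exact: (cmeasurable_cabs2 (mc n)).
- move=> x _; apply: cvg_near_cst; near=> n.
  rewrite /trunc indicE mem_set.
    by rewrite mul1r subrr cabs0 expr0n.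
  rewrite /= in_itv/= -ler_norml; near: n; exists (Num.trunc `|x|).+1 => // n /= nx.
  by rewrite (le_trans (ltW (truncnS_gt _)))// ler_nat.
- move=> n x _; rewrite abse_EFin lee_fin ger0_norm ?sqr_ge0// /trunc indicE.
  case: (_ \in _); first by rewrite mul1r subrr cabs0 expr0n sqr_ge0.
  by rewrite mul0r subr0.
Unshelve. all: end_near. Qed.

Lemma is_FT_fhat_packet phi n p q : L2R phi ->
  Cint leb setT (fun xi => Ftrunc phi n xi * packet p q xi) =
  Cint leb setT (fun x => trunc phi n x * fhat (packet p q) x).
Proof.
move=> h; under eq_fun do rewrite Ftrunc_fhat.
apply: (@Cint_chf_mul _ _ _ leb _ id) => //; first exact: cintegrable_trunc.
exact: cintegrable_packet.
Qed.

Lemma L2R_fhat_packet p q : L2R (fhat (packet p q) : R -> R[i]).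
Proof.
rewrite (_ : fhat _ = fun x => kappa%:C * expi (p * q) * packet q (- p) x).
  by apply: L2RZ; exact: L2R_packet.
by apply/funext => x; rewrite fhat_packet.
Qed.

Lemma ereal_le_bound (x : \bar R) : (0 <= x)%E -> (x < +oo)%E ->
  exists2 M : R, 0 <= M & (x <= M%:E)%E.
Proof.
by case: x => // r r0 _; exists r.
Qed.

(** The multiplication formula holds for truncations, which are integrable, and passes to the limit
    because packets and their transforms lie in L2. Asking for one good [n] per [e] covers both the
    full limit in [Hsob] and the subsequence chosen in [is_FT_exists]. *)
Lemma is_FT_lim phi Phi : L2R phi -> L2R Phi ->
  (forall e : R, 0 < e -> exists n,
    (\int[leb]_xi (cabs (Phi xi - Ftrunc phi n xi) ^+ 2)%:E <= e%:E)%E /\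
    (\int[leb]_x (cabs (phi x - trunc phi n x) ^+ 2)%:E <= e%:E)%E) ->
  is_FT phi Phi.
Proof.
move=> h H lim; split; [exact: L2R_gint|exact: L2R_gint|] => p q.
have [mg ig] := L2R_packet p q; have [mgh igh] := L2R_fhat_packet p q.
have q0 (f : R -> R[i]) : (0 <= \int[leb]_x (cabs (f x) ^+ 2)%:E)%E.
  by apply: integral_ge0 => x _; rewrite lee_fin sqr_ge0.
have [G1 G10 GG1] := ereal_le_bound (q0 _) ig.
have [G2 G20 GG2] := ereal_le_bound (q0 _) igh.
have mt n : cmeasurable setT (trunc phi n) by case: (L2R_trunc n h).
have mF n : cmeasurable setT (Ftrunc phi n).
  rewrite (_ : Ftrunc phi n = fhat (trunc phi n)); last first.
    by apply/funext => x; rewrite Ftrunc_fhat.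
  by apply: cmeasurable_chf => //; exact: cintegrable_trunc.
have Fi n : cintegrable leb setT (fun x => Ftrunc phi n x * packet p q x).
  under eq_fun do rewrite mulrC Ftrunc_fhat.
  apply: (cintegrableM_bounded (M := 2 * \int[leb]_s cabs (trunc phi n s))) => //.
  - exact: cintegrable_packet.
  - by apply: cmeasurable_chf => //; exact: cintegrable_trunc.
  - by move=> x _; apply: cabs_chf_le => //; exact: cintegrable_trunc.
set I1 := Cint _ _ _; set I2 := Cint _ _ _.
have key (e : R) : 0 < e -> cabs (I1 - I2) <= 2 * e * (1 + G1) + 2 * e * (1 + G2).
  move=> e0; have [n [A B]] := lim _ (exprn_gt0 2 e0).
  have -> : I1 - I2 =
     Cint leb setT (fun x => (Phi x - Ftrunc phi n x) * packet p q x) -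
     Cint leb setT (fun x => (phi x - trunc phi n x) * fhat (packet p q) x).
    rewrite (_ : Cint leb setT (fun x => (Phi x - _) * _) =
        I1 - Cint leb setT (fun x => Ftrunc phi n x * packet p q x)); last first.
      rewrite -CintB//; first by apply: Cint_eq => x _; rewrite mulrBl.
      by apply: cintegrable_L2M => //.
    rewrite (_ : Cint leb setT (fun x => (phi x - _) * _) =
        I2 - Cint leb setT (fun x => trunc phi n x * fhat (packet p q) x)); last first.
      rewrite -CintB//; first by apply: Cint_eq => x _; rewrite mulrBl.
        by apply: cintegrable_L2M.
      by apply: cintegrable_L2M => //; exact: L2R_trunc.
    by rewrite is_FT_fhat_packet//; ring.
  apply: (le_trans (cabs_leB _ _)); apply: lerD; apply: cabs_Cint_L2M_le => //.
  - by apply: cmeasurableB => //; case: H.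
  - by apply: cmeasurableB => //; case: h.
apply/eqP; rewrite -subr_eq0 -cabs_eq0 eq_le cabs_ge0 andbT.
apply/ler_addgt0Pl => e e0; rewrite addr0.
have C0 : 0 < 2 * (2 + G1 + G2) by lra.
have := key (e / (2 * (2 + G1 + G2))) (divr_gt0 e0 C0).
rewrite -mulrDr [X in _ <= X](_ : _ = e)//.
by field; rewrite gt_eqF//; lra.
Qed.

Lemma Hsob_is_FT alpha phi : Hsob alpha phi -> exists2 Phi, is_FT phi Phi &
  L2R Phi /\ (\int[leb]_xi (cabs (Phi xi) ^+ 2 * (1 + xi ^+ 2) `^ alpha)%:E < +oo)%E.
Proof.
move=> [h [Phi [H [cv fin]]]]; exists Phi => //.
apply: is_FT_lim => // e e0.
have e0' : (0 < e%:E)%E by rewrite lte_fin.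
have small (u : nat -> \bar R) : u n @[n --> \oo] --> (0 : \bar R)%E ->
    (forall n, 0 <= u n)%E -> \forall n \near \oo, (u n <= e%:E)%E.
  move=> /fine_cvgP[fu /cvgr0_norm_le/(_ _ e0) uc] u0.
  near=> n; have ufn : u n \is a fin_num by near: n.
  rewrite -(fineK ufn) lee_fin (le_trans (ler_norm _))//.
  by near: n.
have q0 (f : R -> R[i]) : (0 <= \int[leb]_x (cabs (f x) ^+ 2)%:E)%E.
  by apply: integral_ge0 => x _; rewrite lee_fin sqr_ge0.
near \oo => n; exists n; split; near: n.
- by apply: small.
- by apply: small => //; exact: trunc_cvg.
Unshelve. all: end_near. Qed.

End truncated_transform.

(** * Completeness of L2 for rapidly Cauchy sequences *)

Section L2_completeness.
Context {R : realType}.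
Notation leb := (@lebesgue_measure R).

Lemma limn_einf_le (u : nat -> \bar R) (M : \bar R) (k : nat) :
  (forall j, (k <= j)%N -> (u j <= M)%E) -> (limn_einf u <= M)%E.
Proof.
move=> uM; rewrite limn_einf_lim; apply: lime_le; first exact: is_cvg_einfs.
apply: nearW => n; apply: (@le_trans _ _ (u (maxn n k))).
  by apply: ereal_inf_lbound => /=; exists (maxn n k) => //=; exact: leq_maxl.
by apply: uM; exact: leq_maxr.
Qed.

Lemma measurable_limn_einf (f : nat -> R -> \bar R) :
  (forall n, measurable_fun setT (f n)) ->
  measurable_fun setT (fun x => limn_einf (f^~ x)).
Proof.
move=> mf; rewrite (_ : (fun _ => _) = (fun x => - limn_esup (fun n => - f n x)))%E.
  apply: measurableT_comp => //.
  by apply: measurable_fun_limn_esup => n; exact: measurableT_comp.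
by apply/funext => x; rewrite (limn_esupN (f^~ x)) oppeK.
Qed.

(** Since [z^2 <= M] forces [z <= 1 + M], the increments are at most [(1 + M) / 2^k], and the
    telescoping series converges absolutely. *)
Lemma cvg_of_weighted_increments (u : nat -> R) (M : R) :
  (forall k, 4 ^+ k * (u k.+1 - u k) ^+ 2 <= M) -> cvgn u.
Proof.
move=> uM.
have M0 : 0 <= M by apply: le_trans (uM 0%N); rewrite expr0 mul1r sqr_ge0.
have le1 k : `|telescope u k| <= geometric (1 + M) (2^-1) k.
  rewrite /telescope /geometric /= exprVn.
  have p2 : 0 < 2 ^+ k :> R by rewrite exprn_gt0.
  rewrite ler_pdivlMr//; have := uM k; set a := u k.+1 - u k.
  have -> : 4 ^+ k * a ^+ 2 = (`|a| * 2 ^+ k) ^+ 2.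
    rewrite exprMn real_normK ?num_real// mulrC; congr (_ * _).
    by rewrite -exprM mulnC exprM; congr (_ ^+ _); ring.
  have : 0 <= `|a| * 2 ^+ k by rewrite mulr_ge0// ltW.
  by move: (_ * _) => z z0 zM; have := sqr_ge0 (z - 1); nra.
have : cvgn (series (telescope u)).
  apply: normed_cvg; apply: (@series_le_cvg _ _ (geometric (1 + M) 2^-1)) => //.
  - by move=> n /=.
  - by move=> n; rewrite /geometric/= mulr_ge0 ?addr_ge0// exprn_ge0// invr_ge0.
  - by apply: is_cvg_geometric_series; rewrite ger0_norm ?invr_ge0// invf_lt1// ltr1n.
rewrite telescopeK => /cvg_ex[/= l cl]; apply/cvg_ex; exists (l + u 0%N).
have : (u n - u 0%N) + u 0%N @[n --> \oo] --> l + u 0%N by apply: cvgD => //; exact: cvg_cst.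
by under eq_fun do rewrite subrK.
Qed.

(** The Riesz-Fischer argument. At rate [8^-k] the squared increments can still be weighted by [4^k]
    and have integrable sum [G], since the [2^-k] sum to 2; where [G] is finite the sequence
    converges. Fatou's lemma then carries the estimate to the limit. *)
Lemma L2_complete (u : nat -> R -> R) (C : R) : 0 <= C ->
  (forall n, measurable_fun setT (u n)) ->
  (forall k j, (k <= j)%N ->
     (\int[leb]_x ((u j x - u k x) ^+ 2)%:E <= (C * (8 ^+ k)^-1)%:E)%E) ->
  exists2 v : R -> R, measurable_fun setT v &
    forall k, (\int[leb]_x ((v x - u k x) ^+ 2)%:E <= (C * (8 ^+ k)^-1)%:E)%E.
Proof.
move=> C0 mu_ uC.
pose d k x := (4 ^+ k * (u k.+1 x - u k x) ^+ 2)%:E.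
have d0 k x : (0 <= d k x)%E.
  by rewrite lee_fin; apply: mulr_ge0; [exact: exprn_ge0|exact: sqr_ge0].
have msq k j : measurable_fun setT (fun x => ((u j x - u k x) ^+ 2)%:E).
  by apply/measurable_EFinP; apply: measurable_funX; exact: measurable_funB.
have md k : measurable_fun setT (d k).
  rewrite /d; under eq_fun do rewrite EFinM.
  exact: measurable_funeM.
pose G x := (\sum_(0 <= k <oo) d k x)%E.
have Goo : (\int[leb]_x G x <= (2 * C)%:E)%E.
  rewrite /G integral_nneseries//.
  apply: le_trans (@epsilon_trick0 _ (2 * C) xpredT _); last by rewrite mulr_ge0.
  apply: lee_nneseries => k _; first by move=> _; apply: integral_ge0.
  rewrite /d; under eq_integral do rewrite EFinM.
  rewrite ge0_integralZl//; [|exact: msq|by move=> x _; rewrite lee_fin sqr_ge0].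
  apply: (le_trans (lee_wpmul2l _ (uC k k.+1 (leqnSn k)))); first by rewrite lee_fin exprn_ge0.
  rewrite -EFinM lee_fin le_eqVlt; apply/orP; left; apply/eqP.
  rewrite natrX exprS.
  have -> : 8 ^+ k = 4 ^+ k * 2 ^+ k :> R by rewrite -exprMn; congr (_ ^+ _); ring.
  by field; rewrite !expf_neq0.
have mG : measurable_fun setT G by exact: ge0_emeasurable_sum.
have G0 x : (0 <= G x)%E by apply: nneseries_ge0.
have Gi : leb.-integrable setT G.
  apply/integrableP; split => //; under eq_integral do rewrite gee0_abs//.
  by rewrite (le_lt_trans Goo)// ltry.
(* An upper limit is measurable with no regard to convergence, and agrees with the limit almost
   everywhere. *)
pose v x := fine (limn_esup (fun n => (u n x)%:E)).
have mv : measurable_fun setT v.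
  apply: (measurableT_comp measurable_fineT).
  by apply: measurable_fun_limn_esup => n; exact/measurable_EFinP.
have vlim : {ae leb, forall x, u n x @[n --> \oo] --> v x}.
  have := integrable_ae measurableT Gi; apply: ae_lebS => x /(_ I) Gx.
  have cu : cvgn (u^~ x).
    apply: (@cvg_of_weighted_increments _ (fine (G x))) => k.
    rewrite -lee_fin fineK//.
    apply: le_trans (nneseries_lim_ge k.+1 _) => //.
    by rewrite big_nat_recr//= leeDr// sume_ge0.
  move/cvg_ex : cu => [l ul]; suff -> : v x = l by [].
  have ule : (u n x)%:E @[n --> \oo] --> l%:E by apply: cvg_EFin => //; exact: nearW.
  by rewrite /v (cvg_limn_einf_sup ule).
exists v => // k.
pose f j x := ((u j x - u k x) ^+ 2)%:E.
have -> : (\int[leb]_x ((v x - u k x) ^+ 2)%:E = \int[leb]_x limn_einf (f^~ x))%E.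
  apply: ge0_ae_eq_integral => //.
  - by apply/measurable_EFinP; apply: measurable_funX; apply: measurable_funB; [exact: mv|exact: mu_].
  - by apply: measurable_limn_einf => n; exact: msq.
  - by move=> x _; rewrite lee_fin sqr_ge0.
  - move=> x _; rewrite limn_einf_lim; apply: lime_ge; first exact: is_cvg_einfs.
    by apply: nearW => n; apply: le_ereal_inf_tmp => _ [j _ <-]; rewrite lee_fin sqr_ge0.
  - apply: ae_lebS vlim => x vx _.
    have fe : f n x @[n --> \oo] --> ((v x - u k x) ^+ 2)%:E.
      apply: cvg_EFin; first exact: nearW.
      by rewrite /f /comp /= expr2; under eq_fun do rewrite expr2; apply: cvgM;
        apply: cvgB => //; exact: cvg_cst.
    by rewrite (cvg_limn_einf_sup fe).
apply: (le_trans (@fatou _ _ _ leb setT measurableT f _ _)) => //.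
- by move=> n; exact: msq.
- by move=> n x _; rewrite lee_fin sqr_ge0.
- by apply: (@limn_einf_le _ _ k) => j kj; exact: uC.
Qed.

End L2_completeness.

Section L2_transform.
Context {R : realType}.
Notation leb := (@lebesgue_measure R).

Let lt_eps (C : R) (e : R) : 0 < e -> exists k : nat, C * (8 ^+ k)^-1 <= e.
Proof.
move=> e0; pose k := (Num.trunc (C / e)).+1; exists k.
have h : C / e < k%:R by exact: truncnS_gt.
have k8 : k%:R <= 8 ^+ k :> R.
  by rewrite -natrX ler_nat ltnW// ltn_expl.
rewrite ler_pdivrMr ?exprn_gt0// mulrC -ler_pdivrMr//.
by rewrite (le_trans (ltW h)).
Qed.

(** Truncations are picked within [8^-k] of [phi] in squared norm. [bessel] transports this rate to
    their transforms, and [L2_complete] produces the limit, one real component at a time. *)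
Lemma is_FT_exists (phi : R -> R[i]) : L2R phi -> exists2 Phi, L2R Phi & is_FT phi Phi.
Proof.
move=> h.
have q0 (f : R -> R[i]) : (0 <= \int[leb]_x (cabs (f x) ^+ 2)%:E)%E.
  by apply: integral_ge0 => x _; rewrite lee_fin sqr_ge0.
have trsmall k : exists n, (\int[leb]_x (cabs (phi x - trunc phi n x) ^+ 2)%:E <=
    ((8 ^+ k)^-1)%:E)%E.
  have e0 : 0 < (8 ^+ k)^-1 :> R by rewrite invr_gt0 exprn_gt0.
  have /fine_cvgP[fu /cvgr0_norm_le/(_ _ e0) uc] := trunc_cvg h.
  near \oo => n; exists n.
  have ufn : (\int[leb]_x (cabs (phi x - trunc phi n x) ^+ 2)%:E)%E \is a fin_num.
    by near: n.
  rewrite -(fineK ufn) lee_fin (le_trans (ler_norm _))//.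
  by near: n.
have [nk nkP] := choice trsmall.
pose F k := fhat (trunc phi (nk k)).
have mt n : cmeasurable setT (trunc phi n) by case: (L2R_trunc n h).
have it n : cintegrable leb setT (trunc phi n) by exact: cintegrable_trunc.
have mF k : cmeasurable setT (F k) by exact: cmeasurable_chf.
(* [16 * pi] comes from [bessel]; 4 comes from comparing two truncations through [phi], at cost
   [2 * 8^-k + 2 * 8^-k]. *)
pose C : R := 16 * pi * 4.
have C0 : 0 <= C by rewrite !mulr_ge0// pi_ge0.
have pow k j : (k <= j)%N -> (8 ^+ j)^-1 <= (8 ^+ k)^-1 :> R.
  move=> kj; rewrite lef_pV2 ?posrE ?exprn_gt0//.
  by rewrite ler_weXn2l// ler1n.
have FC k j : (k <= j)%N ->
    (\int[leb]_x (cabs (F j x - F k x) ^+ 2)%:E <= (C * (8 ^+ k)^-1)%:E)%E.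
  move=> kj.
  have -> : (fun x => (cabs (F j x - F k x) ^+ 2)%:E) =
      (fun x => (cabs (fhat (fun y => trunc phi (nk j) y - trunc phi (nk k) y) x) ^+ 2)%:E).
    apply/funext => x; congr (cabs _ ^+ 2)%:E.
    rewrite /F /fhat /chf -CintB//; [|exact: cintegrable_chf|exact: cintegrable_chf].
    by apply: Cint_eq => y _; rewrite mulrBl.
  apply: le_trans (bessel _) _; first exact: cintegrableB.
  have -> : C * (8 ^+ k)^-1 = 16 * pi * (4 * (8 ^+ k)^-1) by rewrite /C; ring.
  rewrite [leRHS]EFinM; apply: lee_wpmul2l.
    by rewrite lee_fin mulr_ge0// pi_ge0.
  have -> : (fun x => (cabs (trunc phi (nk j) x - trunc phi (nk k) x) ^+ 2)%:E) =
      (fun x => (cabs ((phi x - trunc phi (nk k) x) + - (phi x - trunc phi (nk j) x)) ^+ 2)%:E).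
    by apply/funext => x; congr (cabs _ ^+ 2)%:E; ring.
  have mp n : cmeasurable setT (fun x => phi x - trunc phi n x).
    by apply: cmeasurableB => //; case: h.
  apply: le_trans (integral_cabs_sqD_le (mp _) (cmeasurableN (mp _))) _.
  under [X in (_ + 2%:E * X)%E]eq_integral do rewrite cabsN.
  rewrite (_ : 4 * _ = 2 * (8 ^+ k)^-1 + 2 * (8 ^+ k)^-1); last by ring.
  apply: (@le_trans _ _ (2%:E * ((8 ^+ k)^-1)%:E + 2%:E * ((8 ^+ k)^-1)%:E)%E); last first.
    by rewrite -!EFinM -EFinD.
  apply: leeD; apply: lee_wpmul2l => //.
  by apply: le_trans (nkP j) _; rewrite lee_fin pow.
have [vr mvr vrP] : exists2 v : R -> R, measurable_fun setT v &
    forall k, (\int[leb]_x ((v x - complex.Re (F k x)) ^+ 2)%:E <= (C * (8 ^+ k)^-1)%:E)%E.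
  apply: (@L2_complete _ (fun k x => complex.Re (F k x))) => //.
    by move=> n; case: (mF n).
  move=> k j kj; apply: le_trans (FC k j kj); apply: ge0_le_integral => //.
  - by move=> x _; rewrite lee_fin sqr_ge0.
  - apply/measurable_EFinP; apply: measurable_funX; apply: measurable_funB.
      by case: (mF j).
    by case: (mF k).
  - by apply: cmeasurable_cabs2; apply: cmeasurableB; exact: mF.
  - by move=> x _; rewrite lee_fin cabs_sq cReD cReN lerDl sqr_ge0.
have [vi mvi viP] : exists2 v : R -> R, measurable_fun setT v &
    forall k, (\int[leb]_x ((v x - complex.Im (F k x)) ^+ 2)%:E <= (C * (8 ^+ k)^-1)%:E)%E.
  apply: (@L2_complete _ (fun k x => complex.Im (F k x))) => //.
    by move=> n; case: (mF n).
  move=> k j kj; apply: le_trans (FC k j kj); apply: ge0_le_integral => //.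
  - by move=> x _; rewrite lee_fin sqr_ge0.
  - apply/measurable_EFinP; apply: measurable_funX; apply: measurable_funB.
      by case: (mF j).
    by case: (mF k).
  - by apply: cmeasurable_cabs2; apply: cmeasurableB; exact: mF.
  - by move=> x _; rewrite lee_fin cabs_sq cImD cImN lerDr sqr_ge0.
pose Phi x : R[i] := vr x +i* vi x.
have mPhi : cmeasurable setT Phi by split.
have PhiF k : (\int[leb]_x (cabs (Phi x - F k x) ^+ 2)%:E <= (2 * C * (8 ^+ k)^-1)%:E)%E.
  under eq_integral do rewrite cabs_sq cReD cImD cReN cImN /= EFinD.
  rewrite ge0_integralD//.
  - have -> : 2 * C * (8 ^+ k)^-1 = C * (8 ^+ k)^-1 + C * (8 ^+ k)^-1 by ring.
    by rewrite EFinD; apply: leeD; [exact: vrP|exact: viP].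
  - by move=> x _; rewrite lee_fin sqr_ge0.
  - apply/measurable_EFinP; apply: measurable_funX; apply: measurable_funB => //.
    by case: (mF k).
  - by move=> x _; rewrite lee_fin sqr_ge0.
  - apply/measurable_EFinP; apply: measurable_funX; apply: measurable_funB => //.
    by case: (mF k).
have LF : L2R (F 0%N).
  split => //; apply: le_lt_trans (bessel (it _)) _.
  by apply: lte_mul_pinfty => //; [rewrite lee_fin mulr_ge0// pi_ge0|case: (L2R_trunc (nk 0%N) h)].
have LPhi : L2R Phi.
  have -> : Phi = fun x => (Phi x - F 0%N x) + F 0%N x by apply/funext => x; rewrite subrK.
  apply: L2RD => //; split; first exact: cmeasurableB.
  by apply: le_lt_trans (PhiF 0%N) _; rewrite ltry.
exists Phi => //; apply: is_FT_lim => // e e0.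
have [k1 k1e] := lt_eps (2 * C) e0; have [k2 k2e] := lt_eps 1 e0.
exists (nk (maxn k1 k2)); split.
- rewrite (_ : (fun xi => _) = (fun x => (cabs (Phi x - F (maxn k1 k2) x) ^+ 2)%:E)); last first.
    by apply/funext => x; rewrite Ftrunc_fhat.
  apply: le_trans (PhiF _) _; rewrite lee_fin (le_trans _ k1e)//.
  by rewrite ler_wpM2l ?pow ?leq_maxl// mulr_ge0.
- apply: le_trans (nkP _) _; rewrite lee_fin (le_trans _ k2e)// mul1r.
  by rewrite pow// leq_maxr.
Unshelve. all: end_near. Qed.

Lemma is_FT_surj (Phi : R -> R[i]) : L2R Phi -> exists2 phi, L2R phi & is_FT phi Phi.
Proof.
move=> H; have [Psi HPsi F] := is_FT_exists (L2R_reflect H).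
exists (fun x => (kappa ^+ 2)^-1%:C * Psi x); first exact: L2RZ.
by apply: is_FT_reflect => //; exact: L2R_gint.
Qed.

End L2_transform.

(** * Convolution equations on L2 *)

Lemma L2R_shift {R : realType} (t : R) (phi : R -> R[i]) : L2R phi -> L2R (fun x => phi (x + t)).
Proof.
move=> [m i]; split; first by apply: (cmeasurable_comp m); exact: measurable_funD.
rewrite (ge0_integral_shift t (f := fun x => (cabs (phi x) ^+ 2)%:E))//.
  exact: cmeasurable_cabs2.
by move=> x; rewrite lee_fin sqr_ge0.
Qed.

Section convolution_operator.
Context {R : realType} {d} {T : measurableType d}.
Notation leb := (@lebesgue_measure R).
Variables (mu : {sigma_finite_measure set T -> \bar R}) (h : T -> R[i]) (tau : T -> R).
Hypothesis (hi : cintegrable mu setT h) (mtau : measurable_fun setT tau).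
Implicit Types phi Phi : R -> R[i].

Let mh : cmeasurable setT h. Proof. exact: cintegrable_measurable hi. Qed.

Definition convop phi (y : R) : R[i] := Cint mu setT (fun s => h s * phi (y - tau s)).

Let mshift : measurable_fun setT (fun z : R * T => z.1 - tau z.2).
Proof. by apply: measurable_funB => //; exact: (measurableT_comp mtau). Qed.

Lemma cmeasurable_convop_integrand phi : cmeasurable setT phi ->
  cmeasurable setT (fun z : R * T => h z.2 * phi (z.1 - tau z.2)).
Proof.
move=> mphi; apply: cmeasurableM; first exact: (cmeasurable_comp mh measurable_snd).
exact: (cmeasurable_comp mphi mshift).
Qed.

Lemma cmeasurable_convop phi : cmeasurable setT phi -> cmeasurable setT (convop phi).
Proof.
by move=> mphi; exact: (cmeasurable_Cint2 mu (cmeasurable_convop_integrand mphi)).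
Qed.

(** The real variable is integrated first: [|phi| |g| <= |phi|^2 + |g|^2] and translation invariance
    bound the inner integral by [(M + G) |h s|], uniformly in the shift [tau s]. *)
Lemma cintegrable_convop_prod phi g : L2R phi -> L2R g ->
  cintegrable (leb \x mu)%E setT (fun z : R * T => h z.2 * phi (z.1 - tau z.2) * g z.1).
Proof.
move=> [mphi iphi] [mg ig].
have mF : cmeasurable setT (fun z : R * T => h z.2 * phi (z.1 - tau z.2) * g z.1).
  apply: cmeasurableM; first exact: cmeasurable_convop_integrand.
  exact: (cmeasurable_comp mg measurable_fst).
apply: cintegrable_prodP2 => //.
have q0 (f : R -> R[i]) : (0 <= \int[leb]_x (cabs (f x) ^+ 2)%:E)%E.
  by apply: integral_ge0 => x _; rewrite lee_fin sqr_ge0.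
have [M M0 MP] := ereal_le_bound (q0 phi) iphi.
have [G G0 GP] := ereal_le_bound (q0 g) ig.
have mphis s : cmeasurable setT (fun x : R => phi (x - tau s)).
  by apply: (cmeasurable_comp mphi); exact: measurable_funB.
apply: (@le_lt_trans _ _ (\int[mu]_s ((M + G)%:E * (cabs (h s))%:E))%E).
  apply: ge0_le_integral => //.
  - by move=> s _; apply: integral_ge0 => x _; rewrite lee_fin cabs_ge0.
  - apply: (@measurable_fun_fubini_tonelli_G _ _ _ _ _ leb
      (fun z : R * T => (cabs (h z.2 * phi (z.1 - tau z.2) * g z.1))%:E)).
      exact/measurable_EFinP/cmeasurable_cabs.
    by move=> z; rewrite lee_fin cabs_ge0.
  - by apply: measurable_funeM; exact/measurable_EFinP/cmeasurable_cabs.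
  - move=> s _.
    apply: (@le_trans _ _ (\int[leb]_x ((cabs (h s))%:E * ((cabs (phi (x - tau s)) ^+ 2)%:E + (cabs (g x) ^+ 2)%:E)))%E).
      apply: ge0_le_integral => //.
      + by move=> x _; rewrite lee_fin cabs_ge0.
      + apply/measurable_EFinP/cmeasurable_cabs.
        apply: cmeasurableM; last exact: mg.
        apply: cmeasurableM; last exact: mphis.
        by rewrite /=; split; exact: measurable_cst.
      + by apply: measurable_funeM; apply: emeasurable_funD; [exact: (cmeasurable_cabs2 (mphis s))|exact: (cmeasurable_cabs2 mg)].
      + move=> x _; rewrite -EFinD -EFinM lee_fin !cabsM -mulrA ler_wpM2l ?cabs_ge0//.
        have := sqr_ge0 (cabs (phi (x - tau s)) - cabs (g x)).
        have := sqr_ge0 (cabs (phi (x - tau s))); have := sqr_ge0 (cabs (g x)); nra.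
    rewrite ge0_integralZl//; last 3 first.
    + by apply: emeasurable_funD; [exact: (cmeasurable_cabs2 (mphis s))|exact: (cmeasurable_cabs2 mg)].
    + by move=> x _; rewrite -EFinD lee_fin addr_ge0 ?sqr_ge0.
    + by rewrite lee_fin cabs_ge0.
    rewrite muleC; apply: lee_wpmul2r; first by rewrite lee_fin cabs_ge0.
    rewrite ge0_integralD//; last 4 first.
    + by move=> x _; rewrite lee_fin sqr_ge0.
    + exact: (cmeasurable_cabs2 (mphis s)).
    + by move=> x _; rewrite lee_fin sqr_ge0.
    + exact: (cmeasurable_cabs2 mg).
    rewrite EFinD; apply: leeD => //.
    rewrite (ge0_integral_shift (- tau s) (f := fun x => (cabs (phi x) ^+ 2)%:E))//.
      exact: cmeasurable_cabs2.
    by move=> x; rewrite lee_fin sqr_ge0.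
have /cintegrableP[//|_ hoo] := hi.
rewrite ge0_integralZl//.
- by rewrite lte_mul_pinfty// lee_fin addr_ge0.
- exact/measurable_EFinP/cmeasurable_cabs.
- by move=> s _; rewrite lee_fin cabs_ge0.
- by rewrite lee_fin addr_ge0.
Qed.

(** Fubini with a packet as [g]; a packet vanishes nowhere, so it can be divided out at each [y]. *)
Lemma ae_cintegrable_convop phi : L2R phi ->
  {ae leb, forall y, cintegrable mu setT (fun s => h s * phi (y - tau s))}.
Proof.
move=> hphi; have := ae_cintegrable2 (cintegrable_convop_prod hphi (L2R_packet 0 0)).
apply: ae_lebS => y /= hy.
rewrite (_ : (fun s => _) = (fun s => (packet 0 0 y)^-1 * (h s * phi (y - tau s) * packet 0 0 y))).
  exact: cintegrableZ.
by apply/funext => s; rewrite [RHS]mulrC mulfK// packet_neq0.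
Qed.

Let convop_packet phi p q : L2R phi -> {ae leb, forall y,
  Cint mu setT (fun s => h s * phi (y - tau s) * packet p q y) = convop phi y * packet p q y}.
Proof.
by move=> hphi; apply: ae_lebS (ae_cintegrable_convop hphi) => y hy; rewrite CintZr.
Qed.

Lemma gint_convop phi : L2R phi -> gint (convop phi).
Proof.
move=> hphi; have [mphi _] := hphi.
split; first exact: cmeasurable_convop.
move=> p q.
have /cintegrable_Cint2 /cintegrableP[//|m i] := cintegrable_convop_prod hphi (L2R_packet p q).
have mK : cmeasurable setT (fun y => convop phi y * packet p q y).
  by apply: cmeasurableM; [exact: cmeasurable_convop|exact: cmeasurable_packet].
apply/cintegrableP => //; split => //; apply: le_lt_trans i.
rewrite le_eqVlt; apply/orP; left; apply/eqP; apply: ge0_ae_eq_integral => //.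
- exact/measurable_EFinP/cmeasurable_cabs.
- exact/measurable_EFinP/cmeasurable_cabs.
- by move=> x _; rewrite lee_fin cabs_ge0.
- by move=> x _; rewrite lee_fin cabs_ge0.
- by apply: ae_lebS (convop_packet p q hphi) => y /= ->.
Qed.

(** The convolution theorem. The multiplication formula in [s] leaves the transform of
    [Phi * packet] at [tau s]; there the character lowers the frequency of the packet by [tau s],
    which on the other side translates [fhat (packet p q)] ([step]). Fubini reassembles the
    convolution. *)
Lemma is_FT_convop phi Phi : L2R phi -> L2R Phi -> is_FT phi Phi ->
  is_FT (convop phi) (fun xi => chf mu h tau xi * Phi xi).
Proof.
move=> hphi hPhi [g G F].
have hm : L2R (fun xi => chf mu h tau xi * Phi xi).
  apply: (L2RM_bounded (M := 2 * \int[mu]_s cabs (h s))) => //.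
    exact: cmeasurable_chf.
  by move=> xi; exact: cabs_chf_le.
split; [exact: gint_convop|exact: L2R_gint|] => p q.
have [mPhi iPhi] := G.
rewrite (_ : (fun x => _) = (fun xi => chf mu h tau xi * (Phi xi * packet p q xi))); last first.
  by apply/funext => xi; rewrite mulrA.
rewrite Cint_chf_mul//.
have step s : fhat (fun xi => Phi xi * packet p q xi) (tau s) =
    Cint leb setT (fun y => phi (y - tau s) * fhat (packet p q) y).
  transitivity (Cint leb setT (fun xi => Phi xi * packet p (q - tau s) xi)).
    by rewrite /fhat /chf; apply: Cint_eq => x _; rewrite -mulrA packetM.
  rewrite F -[RHS](@Cint_shift _ (tau s)); last first.
    apply: cmeasurableM; first by case: (L2R_shift (- tau s) hphi).
    by case: (L2R_fhat_packet p q).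
  apply: Cint_eq => y _; rewrite addrK; congr (_ * _); rewrite !fhat_packet /packet.
  have -> : y - (q - tau s) = y + tau s - q by ring.
  have -> : expi (p * (q - tau s)) = expi (p * q) * expi (- (p * tau s)).
    by rewrite -expiD; congr expi; ring.
  have -> : expi (- p * (y + tau s)) = expi (- p * y) * expi (- (p * tau s)).
    by rewrite -expiD; congr expi; ring.
  move: (real_complex _ kappa) (real_complex _ (gweight _ _)) => A B.
  by move: (expi (p * q)) (expi (- (p * tau s))) (expi _) => D E F'; ring.
transitivity (Cint mu setT (fun s => Cint leb setT
    (fun y => h s * phi (y - tau s) * fhat (packet p q) y))).
  apply: Cint_eq => s _; rewrite step -CintZ//; first by apply: Cint_eq => y _; rewrite mulrA.
  exact: cintegrable_L2M (L2R_shift _ hphi) (L2R_fhat_packet p q).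
have hF := cintegrable_convop_prod hphi (L2R_fhat_packet p q).
rewrite -(Cint_fubini hF).
apply: ae_eq_Cint => //.
- have /cintegrable_Cint2 := cintegrable_convop_prod hphi (L2R_fhat_packet p q).
  by move/cintegrable_measurable.
- by apply: cmeasurableM; [exact: (cmeasurable_convop hphi.1)|case: (L2R_fhat_packet p q)].
- by apply: ae_lebS (ae_cintegrable_convop hphi) => y hy _; rewrite /= CintZr.
Qed.

End convolution_operator.

(** * Uniqueness and solvability for a single convolution equation *)

Section convolution_equation.
Context {R : realType} {d} {T : measurableType d}.
Notation leb := (@lebesgue_measure R).
Variables (mu : {sigma_finite_measure set T -> \bar R}) (h : T -> R[i]) (tau : T -> R).
Hypothesis (hi : cintegrable mu setT h) (mtau : measurable_fun setT tau).
Local Notation K := (convop mu h tau).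
Local Notation m := (chf mu h tau).
Implicit Types phi Phi v V : R -> R[i].

Let mm : cmeasurable setT m. Proof. exact: cmeasurable_chf. Qed.

Lemma convopB phi psi : L2R phi -> L2R psi ->
  {ae leb, forall y, K (fun x => phi x - psi x) y = K phi y - K psi y}.
Proof.
move=> hphi hpsi.
apply: ae_lebS2 (ae_cintegrable_convop hi mtau hphi) (ae_cintegrable_convop hi mtau hpsi).
by move=> y i1 i2; rewrite -CintB//; apply: Cint_eq => s _; rewrite mulrBr.
Qed.

Lemma convop0 y : K (fun=> 0) y = 0.
Proof. by rewrite -[RHS](Cint0 mu setT); apply: Cint_eq => s _; rewrite mulr0. Qed.

(** For necessity, a packet cut down to the zero set of [m] is the transform of some [phi] in the
    kernel of the convolution. If this [phi] is zero almost everywhere, the zero set is null, since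
    packets vanish nowhere. *)
Lemma convop_injective :
  (forall phi, L2R phi -> {ae leb, forall y, K phi y = 0} -> {ae leb, forall y, phi y = 0}) <->
  {ae leb, forall xi, m xi != 0}.
Proof.
split=> [inj|m0 phi hphi K0].
  (* [1 - z / z] is the indicator of [z = 0] since [0^-1 = 0]. *)
  pose Psi xi := (1 - m xi * (m xi)^-1) * packet 0 0 xi.
  have hPsi : L2R Psi.
    apply: (L2RM_bounded (M := 1)); first exact: L2R_packet.
      apply: cmeasurableB; first exact: cmeasurable_cst.
      by apply: cmeasurableM => //; exact: cmeasurableV.
    move=> xi; have [->|h0] := eqVneq (m xi) 0; first by rewrite mul0r subr0 cabsR normr1.
    by rewrite divff// subrr cabs0.
  have [phi hphi F] := is_FT_surj hPsi.
  have := is_FT_uniql F is_FT0.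
  have K0 : {ae leb, forall y, K phi y = 0}.
    apply: is_FT_uniql (is_FT_convop hi mtau hphi hPsi F) is_FT0 _.
    apply: nearW => xi; rewrite /Psi mulrA.
    have [->|h0] := eqVneq (m xi) 0; first by rewrite !mul0r.
    by rewrite divff// subrr mulr0 mul0r.
  have := is_FT_uniqr F is_FT0 (inj _ hphi K0).
  move=> Psi0 _; apply: ae_lebS Psi0 => xi Psi0; apply/eqP => m0.
  move: Psi0; rewrite /Psi m0 mul0r subr0 mul1r => /eqP.
  by rewrite (negbTE (packet_neq0 _ _ _)).
have [Phi hPhi F] := is_FT_exists hphi.
have mPhi0 := is_FT_uniqr (is_FT_convop hi mtau hphi hPhi F) is_FT0 K0.
apply: is_FT_uniql F is_FT0 _; apply: ae_lebS2 m0 mPhi0 => xi mxi /eqP.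
by rewrite mulf_eq0 (negbTE mxi) => /eqP.
Qed.

Lemma convop_solvable v V : is_FT v V -> (forall xi, m xi != 0) ->
  L2R (fun xi => (m xi)^-1 * V xi) ->
  exists2 phi, L2R phi & {ae leb, forall y, v y = K phi y}.
Proof.
move=> F m0 hW; have [phi hphi G] := is_FT_surj hW.
exists phi => //; apply: is_FT_uniql F (is_FT_convop hi mtau hphi hW G) _.
by apply: nearW => xi; rewrite mulVKf.
Qed.

(** A single point carries no L2 mass, so continuity spreads the bound [|m| < 4^-n] from a point to
    an interval; half the radius keeps the closed interval inside the open ball. *)
Let inf_le0_interval : inf (range (fun x => cabs (m x))) <= 0 ->
  forall n : nat, exists xr : R * R, 0 < xr.2 /\
    forall y, xr.1 - xr.2 <= y <= xr.1 + xr.2 -> 16 ^+ n * cabs (m y) ^+ 2 <= 1.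
Proof.
move=> i0 n.
have hlb : has_inf (range (fun x => cabs (m x))).
  by split; [exists (cabs (m 0)), 0|exists 0 => _ [x _ <-]; exact: cabs_ge0].
have e0 : 0 < (4 ^+ n)^-1 :> R by rewrite invr_gt0 exprn_gt0.
have [_ [x _ <-]] := inf_adherent e0 hlb.
move=> mx; have {}mx : cabs (m x) < (4 ^+ n)^-1.
  by rewrite (lt_le_trans mx)// gerDr.
have : \forall y \near x, cabs (m y) < (4 ^+ n)^-1.
  have := @continuous_cabs_chf _ _ _ mu h tau hi mtau x.
  by move/(@cvgr_lt _ _ _ _ _ _) => /(_ _ mx).
move=> /nbhs_ballP[r /= r0 xr]; exists (x, r / 2) => /=; split; first by rewrite divr_gt0.
move=> y /andP[y1 y2].
have /xr : ball x r y.
  by rewrite /ball/= ltr_norml; apply/andP; split; lra.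
move=> my.
have -> : 16 ^+ n = 4 ^+ n * 4 ^+ n :> R by rewrite -exprMn; congr (_ ^+ _); ring.
have -> : 4 ^+ n * 4 ^+ n * cabs (m y) ^+ 2 = (4 ^+ n * cabs (m y)) ^+ 2 by ring.
have : 4 ^+ n * cabs (m y) <= 1.
  by rewrite -ler_pdivlMl ?exprn_gt0// mulr1 ltW.
have : 0 <= 4 ^+ n * cabs (m y) by rewrite mulr_ge0// cabs_ge0.
by move: (_ * _) => z; nra.
Qed.

Lemma convop_surjective :
  (forall v, L2R v -> exists2 phi, L2R phi & {ae leb, forall y, v y = K phi y}) <->
  0 < inf (range (fun x => cabs (m x))).
Proof.
split=> [surj|i0 v hv]; last first.
  have [V hV F] := is_FT_exists hv.
  have mge xi : inf (range (fun x => cabs (m x))) <= cabs (m xi).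
    apply: ge_inf; last by exists xi.
    by exists 0 => _ [x _ <-]; exact: cabs_ge0.
  have m0 xi : m xi != 0 by rewrite -cabs_gt0 (lt_le_trans i0).
  apply: (convop_solvable F m0).
  apply: (L2RM_bounded (M := (inf (range (fun x => cabs (m x))))^-1)) => //.
    exact: cmeasurableV.
  by move=> xi; rewrite cabsV lef_pV2 ?posrE ?cabs_gt0.
rewrite ltNge; apply/negP => i0.
have [xr xrP] := choice (inf_le0_interval i0).
pose J n : set R := `[(xr n).1 - (xr n).2, (xr n).1 + (xr n).2]%classic.
have mI n : measurable (J n) by exact: measurable_itv.
have m1 n : measurable_fun setT (fun x : R => (\1_(J n) x : R)%:E).
  by apply/measurable_EFinP; exact: measurable_indic.
have i1 n : (\int[leb]_x (\1_(J n) x : R)%:E = leb (J n))%E.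
  by rewrite (integral_indic leb measurableT (mI n)) setIT.
have leI n : leb (J n) = (2 * (xr n).2)%:E.
  have [r0 _] := xrP n.
  rewrite /J lebesgue_measure_itv/= lte_fin ltrBlDr -addrA ltrDl addr_gt0// -EFinD.
  by congr _%:E; ring.
(* The height that gives mass [2^-n] to [J n]. The intervals may overlap, so the bumps are summed
   into [G] and the L2 function is its square root [q]. *)
pose w n : R := (2 ^+ n)^-1 / (2 * (xr n).2).
have w0 n : 0 <= w n.
  by have [r0 _] := xrP n; rewrite /w divr_ge0 ?invr_ge0 ?exprn_ge0// mulr_ge0// ltW.
pose g n (x : R) := ((w n)%:E * (\1_(J n) x : R)%:E)%E.
have g0 n x : (0 <= g n x)%E by rewrite mule_ge0// lee_fin.
have mg n : measurable_fun setT (g n).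
  by apply: measurable_funeM; exact: m1.
have ig n : (\int[leb]_x g n x = ((2 ^+ n)^-1)%:E)%E.
  rewrite /g ge0_integralZl//; last 2 first.
  - exact: m1.
  - by rewrite lee_fin.
  rewrite i1 leI -EFinM /w divfK// gt_eqF// mulr_gt0//.
  by have [] := xrP n.
pose G x := (\sum_(0 <= n <oo) g n x)%E.
have mG : measurable_fun setT G by exact: ge0_emeasurable_sum.
have G0 x : (0 <= G x)%E by apply: nneseries_ge0.
have Goo : (\int[leb]_x G x < +oo)%E.
  rewrite /G integral_nneseries//.
  apply: (@le_lt_trans _ _ 2%:E); last by rewrite ltry.
  apply: le_trans (@epsilon_trick0 _ 2 xpredT _) => //.
  apply: lee_nneseries => n _; first by rewrite ig lee_fin invr_ge0 exprn_ge0.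
  by rewrite ig lee_fin natrX exprS invfM mulrA divff// mul1r.
have Gi : leb.-integrable setT G.
  by apply/integrableP; split => //; under eq_integral do rewrite gee0_abs//.
pose q x := Num.sqrt (fine (G x)).
have q2 x : q x ^+ 2 = fine (G x) by rewrite sqr_sqrtr// fine_ge0.
have hq : L2R (fun x => (q x)%:C).
  apply: (@L2R_le _ _ G) => //.
    apply: cmeasurableR; apply: (measurableT_comp (continuous_measurable_fun (@sqrt_continuous R))).
    exact: (measurableT_comp measurable_fineT).
  move=> x; rewrite cabsR ger0_norm ?sqrtr_ge0// q2.
  by case: (G x) (G0 x) => //= _; rewrite leey.
have [phi hphi F] := is_FT_surj hq.
have [psi hpsi E] := surj _ hphi.
have [Psi [mPsi iPsi] F'] := is_FT_exists hpsi.
have := is_FT_uniqr F (is_FT_convop hi mtau hpsi (conj mPsi iPsi) F') E.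
move=> /(ae_lebS2 _ (integrable_ae measurableT Gi)) qE.
(* Almost everywhere on [J n], [w n <= q^2 = |m|^2 |Psi|^2] while [16^n |m|^2 <= 1]. Multiplied by
   the length [2 * (xr n).2] of [J n], the resulting lower bound gives [|Psi|^2] the mass
   [16^n / 2^n = 8^n]. *)
have {}qE : {ae leb, forall x, forall n, J n x -> (8 ^+ n / (2 * (xr n).2) <= cabs (Psi x) ^+ 2)}.
  apply: qE => x /(_ I) Gx qx n Ix; have [r0 /(_ x) mn] := xrP n.
  have {}mn : 16 ^+ n * cabs (m x) ^+ 2 <= 1 by apply: mn; move: Ix; rewrite /J /= in_itv.
  have : w n <= cabs (m x) ^+ 2 * cabs (Psi x) ^+ 2.
    rewrite -exprMn -cabsM -qx cabsR ger0_norm ?sqrtr_ge0// q2 -lee_fin fineK//.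
    apply: le_trans (nneseries_lim_ge n.+1 _) => //.
    rewrite big_nat_recr//= (_ : (w n)%:E = g n x); last by rewrite /g indicE mem_set// mule1.
    by rewrite leeDr// sume_ge0.
  move=> wle.
  have : 16 ^+ n * w n <= cabs (Psi x) ^+ 2.
    apply: (@le_trans _ _ (16 ^+ n * (cabs (m x) ^+ 2 * cabs (Psi x) ^+ 2))).
      by rewrite ler_wpM2l// exprn_ge0.
    by rewrite mulrA ler_piMl// sqr_ge0.
  rewrite /w mulrA (_ : 16 ^+ n / 2 ^+ n = 8 ^+ n)//.
  by rewrite -expr_div_n; congr (_ ^+ _); field.
have Psige n : ((8 ^+ n)%:E <= \int[leb]_x (cabs (Psi x) ^+ 2)%:E)%E.
  have [r0 _] := xrP n.
  apply: (@le_trans _ _ (\int[leb]_x ((8 ^+ n / (2 * (xr n).2))%:E * (\1_(J n) x : R)%:E))%E).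
    rewrite ge0_integralZl//; last 2 first.
    - exact: m1.
    - by rewrite lee_fin divr_ge0 ?exprn_ge0// mulr_ge0// ltW.
    by rewrite i1 leI -EFinM divfK// gt_eqF// mulr_gt0.
  apply: ae_ge0_le_integral => //.
  - by move=> x _; apply: mule_ge0; rewrite lee_fin// divr_ge0 ?exprn_ge0// mulr_ge0// ltW.
  - by apply: measurable_funeM; exact: m1.
  - by move=> x _; rewrite lee_fin sqr_ge0.
  - exact: cmeasurable_cabs2.
  - apply: ae_lebS qE => x /(_ n) h8 _; rewrite indicE.
    have [xI|xI] := boolP (x \in J n).
      by rewrite -EFinM mulr1 lee_fin h8//; rewrite inE in xI.
    by rewrite -EFinM mulr0 lee_fin sqr_ge0.
have P0 : (0 <= \int[leb]_x (cabs (Psi x) ^+ 2)%:E)%E.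
  by apply: integral_ge0 => x _; rewrite lee_fin sqr_ge0.
have [M M0 MP] := ereal_le_bound P0 iPsi.
pose n := (Num.trunc M).+1.
have : 8 ^+ n <= M by rewrite -lee_fin (le_trans (Psige n)).
apply/negP; rewrite -ltNge (lt_trans (truncnS_gt M))//.
by rewrite -/n -natrX ltr_nat ltn_expl.
Qed.

(** The constant [4 / gamma ^+ 2] comes from [(1 + |x|^alpha)^2 <= 2 + 2 |x|^(2 alpha) <= 4 (1 +
    x^2)^alpha], where [alpha >= 0] puts both 1 and [|x|^(2 alpha)] below the Sobolev weight. *)
Lemma convop_solvable_weighted (alpha gamma : R) v V : 0 <= alpha -> 0 < gamma ->
  (forall x, gamma / (1 + `|x| `^ alpha) <= cabs (m x)) -> is_FT v V -> L2R V ->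
  (\int[leb]_xi (cabs (V xi) ^+ 2 * (1 + xi ^+ 2) `^ alpha)%:E < +oo)%E ->
  exists2 phi, L2R phi & {ae leb, forall y, v y = K phi y}.
Proof.
move=> a0 c0 mge F [mV _] iV.
have d0 (x : R) : 0 < 1 + `|x| `^ alpha by rewrite ltr_wpDr ?powR_ge0.
have m0 xi : m xi != 0 by rewrite -cabs_gt0 (lt_le_trans _ (mge xi))// divr_gt0.
apply: (convop_solvable F m0).
apply: (@L2R_le _ _ (fun x => (4 / gamma ^+ 2)%:E * (cabs (V x) ^+ 2 * (1 + x ^+ 2) `^ alpha)%:E)%E).
- by apply: cmeasurableM => //; exact: cmeasurableV.
- apply: measurable_funeM; apply/measurable_EFinP; apply: measurable_funM.
    by apply/measurable_EFinP; exact: cmeasurable_cabs2.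
  by apply: (measurableT_comp (measurable_powR alpha)); apply: measurable_funD => //; exact: measurable_funX.
- rewrite ge0_integralZl//.
  + by rewrite lte_mul_pinfty// lee_fin divr_ge0// sqr_ge0.
  + apply/measurable_EFinP; apply: measurable_funM.
      by apply/measurable_EFinP; exact: cmeasurable_cabs2.
    by apply: (measurableT_comp (measurable_powR alpha)); apply: measurable_funD => //; exact: measurable_funX.
  + by move=> x _; rewrite lee_fin mulr_ge0 ?sqr_ge0 ?powR_ge0.
  + by rewrite lee_fin divr_ge0// sqr_ge0.
- move=> x; rewrite -EFinM lee_fin cabsM exprMn.
  rewrite [leRHS](_ : _ = (4 / gamma ^+ 2 * (1 + x ^+ 2) `^ alpha) * cabs (V x) ^+ 2); last by ring.
  apply: ler_wpM2r; first exact: sqr_ge0.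
  rewrite cabsV.
  have le1 : (cabs (m x))^-1 <= (1 + `|x| `^ alpha) / gamma.
    rewrite -[leRHS]invf_div lef_pV2 ?posrE ?cabs_gt0//; last by rewrite divr_gt0.
  have le2 : (cabs (m x))^-1 ^+ 2 <= ((1 + `|x| `^ alpha) / gamma) ^+ 2.
    by rewrite lerXn2r ?nnegrE ?invr_ge0 ?cabs_ge0// divr_ge0// ltW.
  apply: (le_trans le2); rewrite [leRHS]mulrAC exprMn exprVn; apply: ler_wpM2r.
    by rewrite invr_ge0 sqr_ge0.
  have p1 : 1 <= (1 + x ^+ 2) `^ alpha.
    have h1 : (1 : R) `^ alpha = 1 by rewrite powR1.
    rewrite -[leLHS]h1; apply: ge0_ler_powR => //; rewrite ?nnegrE//.
      by rewrite addr_ge0// sqr_ge0.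
    by rewrite lerDl sqr_ge0.
  have p2 : (`|x| `^ alpha) ^+ 2 <= (1 + x ^+ 2) `^ alpha.
    rewrite expr2 -powRM// -expr2 real_normK ?num_real//.
    apply: ge0_ler_powR => //; rewrite ?nnegrE ?sqr_ge0//.
      by rewrite addr_ge0// sqr_ge0.
    by rewrite lerDr.
  by have := sqr_ge0 (`|x| `^ alpha - 1); nra.
Qed.

End convolution_equation.

(** * Logarithmic coordinates *)

Section log_coordinates.
Context {R : realType}.
Notation leb := (@lebesgue_measure R).
Implicit Types (w v : R -> R[i]) (b : bool) (c : R).

Lemma measurable_Rx : measurable (Rx : set R).
Proof.
rewrite (_ : Rx = ~` [set 0 : R]); first by apply: measurableC; exact: measurable_set1.
by apply/seteqP; split => x /= /eqP.
Qed.

(** The change of variables is applied to the indicator of an exceptional set, in one direction of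
    [A] itself and in the other of the pullback of [B] by [ln |x|]. The density [expR y] is
    positive, so null sets correspond. *)
Lemma ae_Rx_exp (P : R -> Prop) : {ae leb, forall x, x != 0 -> P x} <->
  {ae leb, forall y, P (expR y) /\ P (- expR y)}.
Proof.
have m1 (A : set R) : measurable A -> measurable_fun setT (fun x : R => (\1_A x : R)%:E).
  by move=> mA; apply/measurable_EFinP; exact: measurable_indic.
split=> [[A [mA A0 PA]]|[B [mB B0 PB]]].
- have int0 : (\int[leb]_(x in Rx) (\1_A x : R)%:E = 0)%E.
    rewrite (integral_indic leb measurable_Rx mA); apply/eqP; rewrite -measure_le0 -A0.
    by rewrite le_measure ?inE//; apply: measurableI => //; exact: measurable_Rx.
  have mE : measurable_fun setT (fun y : R => (expR y)%:E).
    by apply/measurable_EFinP; exact: measurable_expR.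
  have mp : measurable_fun setT (fun y : R => ((expR y)%:E * (\1_A (expR y) : R)%:E)%E).
    by apply: emeasurable_funM => //; apply: (measurableT_comp (m1 _ mA)); exact: measurable_expR.
  have mn : measurable_fun setT (fun y : R => ((expR y)%:E * (\1_A (- expR y) : R)%:E)%E).
    apply: emeasurable_funM => //; apply: (measurableT_comp (m1 _ mA)).
    by apply: measurable_funN; exact: measurable_expR.
  have p0 (g : R -> R) y : (0 <= (expR y)%:E * (\1_A (g y) : R)%:E)%E.
    by rewrite mule_ge0// lee_fin expR_ge0.
  move: int0; rewrite ge0_integral_Rx_exp//; last exact: measurable_funTS (m1 _ mA).
  move/eqP; rewrite padde_eq0; [|by apply: integral_ge0 => y _; exact: p0|
    by apply: integral_ge0 => y _; exact: (p0 (fun y => - expR y))].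
  move=> /andP[/eqP i1 /eqP i2].
  have aux (g : R -> R) :
      measurable_fun setT (fun y : R => ((expR y)%:E * (\1_A (g y) : R)%:E)%E) ->
      (\int[leb]_y ((expR y)%:E * (\1_A (g y) : R)%:E) = 0)%E ->
      {ae leb, forall y, ~ A (g y)}.
    move=> mg ig.
    have : (\int[leb]_y `| (expR y)%:E * (\1_A (g y) : R)%:E | = 0)%E.
      by rewrite -[RHS]ig; apply: eq_integral => y _; rewrite gee0_abs.
    move=> /(ae_eq_integral_abs leb measurableT mg).1; apply: ae_lebS => y /(_ Logic.I) /eqP.
    rewrite -EFinM eqe mulf_eq0 gt_eqF ?expR_gt0//= indicE => /eqP + Ag.
    by rewrite mem_set//= => /eqP; rewrite oner_eq0.
  apply: ae_lebS2 (aux _ mp i1) (aux (fun y => - expR y) mn i2) => y A1 A2.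
  split; apply: contrapT => nP.
    by apply: A1; apply: PA => /=; apply/not_implyP; split => //; rewrite gt_eqF ?expR_gt0.
  by apply: A2; apply: PA => /=; apply/not_implyP; split => //; rewrite oppr_eq0 gt_eqF ?expR_gt0.
- have mln : measurable_fun setT (fun x : R => ln `|x|).
    by apply: (measurableT_comp (@measurable_ln R)); exact: normr_measurable.
  have mf : measurable_fun setT (fun x : R => (\1_B (ln `|x|) : R)%:E).
    exact: (measurableT_comp (m1 _ mB) mln).
  have i0 : (\int[leb]_y ((expR y)%:E * (\1_B y : R)%:E) = 0)%E.
    have -> : (\int[leb]_y ((expR y)%:E * (\1_B y : R)%:E) = \int[leb]_(y in B) (expR y)%:E)%E.
      rewrite [RHS]integral_mkcond; apply: eq_integral => y _.
      by rewrite patchE indicE; case: ifP; rewrite ?mule1 ?mule0.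
    apply: null_set_integral => //; apply: measurable_funTS.
    by apply/measurable_EFinP; exact: measurable_expR.
  have : (\int[leb]_(x in Rx) (\1_B (ln `|x|) : R)%:E = 0)%E.
    rewrite ge0_integral_Rx_exp//; last exact: measurable_funTS.
    under eq_integral do rewrite ger0_norm ?expR_ge0// expRK.
    under [X in (_ + X)%E]eq_integral do rewrite normrN ger0_norm ?expR_ge0// expRK.
    by rewrite i0 adde0.
  move=> j0.
  have : (\int[leb]_(x in Rx) `| (\1_B (ln `|x|) : R)%:E | = 0)%E.
    by rewrite -[RHS]j0; apply: eq_integral => x _; rewrite gee0_abs.
  move=> /(ae_eq_integral_abs leb measurable_Rx (measurable_funTS mf)).1.
  apply: ae_lebS => x /= + x0; move/(_ x0) => [] /eqP h.
  have nB : ~ B (ln `|x|).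
    by move=> Bx; move: h; rewrite indicE mem_set//= oner_eq0.
  have [P1 P2] : P (expR (ln `|x|)) /\ P (- expR (ln `|x|)).
    by apply: contrapT => nP; apply: nB; apply: PB.
  move: P1 P2; rewrite lnK ?posrE ?normr_gt0//.
  by case: (lerP 0 x) => [x00|x00]; [rewrite ger0_norm|rewrite ltr0_norm// opprK].
Qed.

Lemma measurable_fun_Rx_exp (u : R -> R) : measurable_fun Rx u <->
  forall b, measurable_fun setT (fun y : R => u ((-1) ^+ b * expR y)).
Proof.
have mb b : measurable_fun setT (fun y : R => (-1) ^+ b * expR y).
  by apply: measurable_funM => //; exact: measurable_expR.
split=> [mu_ b|mu_].
  apply: (measurable_comp measurable_Rx _ mu_ (mb b)) => _ [y _ <-].
  by rewrite /Rx/= mulf_neq0 ?signr_eq0// gt_eqF// expR_gt0.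
have mln : measurable_fun setT (fun x : R => ln `|x|).
  by apply: (measurableT_comp (@measurable_ln R)); exact: normr_measurable.
apply: (eq_measurable_fun (fun x : R => if 0 < x
    then u ((-1) ^+ false * expR (ln `|x|)) else u ((-1) ^+ true * expR (ln `|x|)))).
  move=> x; rewrite inE /Rx/= => x0; rewrite lnK ?posrE ?normr_gt0//.
  rewrite expr0 expr1 mul1r mulN1r; case: ltrP => h; first by rewrite ger0_norm// ltW.
  by rewrite ler0_norm// opprK.
apply: measurable_funTS; apply: measurable_fun_ifT.
- exact: measurable_fun_ltr.
- exact: (measurableT_comp (mu_ false) mln).
- exact: (measurableT_comp (mu_ true) mln).
Qed.

(** The function [M w] on the half-line of sign [(-1)^b]: at [|x| = expR y] the prefactor is
    [|x|^((c+1)/2)], which makes the weighted norm of [w] an unweighted one in [y]. *)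
Definition logside c b w (y : R) : R[i] :=
  (expR ((c + 1) * y / 2))%:C * w ((-1) ^+ b * expR y).

(** Twice the even part for [b = false], twice the odd part for [b = true]; the factor 1/2 reappears
    in [logside_parity]. *)
Definition parity c b w (y : R) : R[i] :=
  logside c false w y + (-1) ^+ b * logside c true w y.

Lemma expC_neq0 (y : R) : (expR y)%:C != 0 :> R[i].
Proof. by rewrite -cabs_gt0 cabsR normr_gt0 gt_eqF// expR_gt0. Qed.

Lemma cmeasurable_logside c w : cmeasurable Rx w <->
  forall b, cmeasurable setT (logside c b w).
Proof.
have mE : measurable_fun setT (fun y : R => expR ((c + 1) * y / 2)).
  apply: (@measurableT_comp _ _ _ _ _ _ expR); first exact: measurable_expR.
  by apply: measurable_funM => //; exact: measurable_funM.
have aux b : cmeasurable setT (logside c b w) <->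
    cmeasurable setT (fun y : R => w ((-1) ^+ b * expR y)).
  split=> hm; last by apply: cmeasurableM => //; exact: cmeasurableR.
  rewrite (_ : (fun y => _) = (fun y => ((expR ((c + 1) * y / 2))%:C)^-1 * logside c b w y)).
    by apply: cmeasurableM => //; apply: cmeasurableV; exact: cmeasurableR.
  by apply/funext => y; rewrite mulKf// expC_neq0.
rewrite {1}/cmeasurable !measurable_fun_Rx_exp; split=> [[h1 h2] b|h].
  by apply/aux; split; [exact: h1|exact: h2].
by split=> b; have /aux [] := h b.
Qed.

Lemma integral_Rx_logside c w : cmeasurable Rx w ->
  (\int[leb]_(x in Rx) (cabs (w x) ^+ 2 * `|x| `^ c)%:E =
   \int[leb]_y (cabs (logside c false w y) ^+ 2)%:E +
   \int[leb]_y (cabs (logside c true w y) ^+ 2)%:E)%E.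
Proof.
move=> mw; rewrite ge0_integral_Rx_exp; last 2 first.
- apply/measurable_EFinP; apply: measurable_funM.
    by apply/measurable_EFinP; exact: cmeasurable_cabs2.
  apply: measurable_funTS; apply: (measurableT_comp (measurable_powR c)).
  exact: normr_measurable.
- by move=> x _; rewrite lee_fin mulr_ge0 ?sqr_ge0 ?powR_ge0.
have E (A y : R) : expR y * (A ^+ 2 * expR y `^ c) = (expR ((c + 1) * y / 2) * A) ^+ 2.
  rewrite exprMn -expRM_natl -expRM mulrCA mulrC -expRD; congr (expR _ * _).
  by field.
congr (_ + _)%E; apply: eq_integral => y _; rewrite /logside cabsM cabsR.
  by rewrite expr0 mul1r !ger0_norm ?expR_ge0// -E.
by rewrite expr1 mulN1r normrN !ger0_norm ?expR_ge0// -E.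
Qed.

Lemma L2w_logside c w : L2w c w <-> forall b, L2R (logside c b w).
Proof.
have i0 b : (0 <= \int[leb]_y (cabs (logside c b w y) ^+ 2)%:E)%E.
  by apply: integral_ge0 => y _; rewrite lee_fin sqr_ge0.
split=> [[mw iw] b|h].
  have mb := (cmeasurable_logside c w).1 mw.
  split; first exact: mb.
  apply: le_lt_trans iw; rewrite integral_Rx_logside//.
  by case: b; [rewrite leeDr|rewrite leeDl].
have mw : cmeasurable Rx w by apply/(cmeasurable_logside c w) => b; case: (h b).
split => //; rewrite integral_Rx_logside// lte_add_pinfty//.
  by case: (h false).
by case: (h true).
Qed.

Lemma L2R_parity c b w : L2w c w -> L2R (parity c b w).
Proof.
by move/L2w_logside => h; apply: L2RD; [exact: h|apply: L2RZ; exact: h].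
Qed.

Lemma logside_surj c (psi : bool -> R -> R[i]) :
  exists w, forall b y, logside c b w y = psi b y.
Proof.
exists (fun x => ((expR ((c + 1) * ln `|x| / 2))%:C)^-1 * psi (x < 0) (ln `|x|)) => b y.
rewrite /logside normrM normr_sign mul1r ger0_norm ?expR_ge0// expRK.
rewrite mulVKf ?expC_neq0//; congr psi.
by case: b; rewrite ?expr0 ?expr1 ?mulN1r ?mul1r ?oppr_lt0 ?expR_gt0// lt_gtF ?expR_gt0.
Qed.

Lemma logside_parity c w y :
  logside c false w y = 2^-1 * (parity c false w y + parity c true w y) /\
  logside c true w y = 2^-1 * (parity c false w y - parity c true w y).
Proof.
have two : (2 : R[i]) != 0 by rewrite pnatr_eq0.
by rewrite /parity expr0 expr1; split; field.
Qed.

Lemma parity_surj c (phi : bool -> R -> R[i]) : (forall b, L2R (phi b)) ->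
  exists2 w, L2w c w & forall b y, parity c b w y = phi b y.
Proof.
move=> hphi.
pose psi b y := 2^-1 * (phi false y + (-1) ^+ b * phi true y).
have [w wE] := logside_surj c psi; exists w.
  apply/L2w_logside => b; rewrite (_ : logside c b w = psi b); last exact/funext.
  by apply: L2RZ; apply: L2RD => //; exact: L2RZ.
have two : (2 : R[i]) != 0 by rewrite pnatr_eq0.
by move=> b y; rewrite /parity !wE /psi expr0 expr1; case: b; rewrite ?expr0 ?expr1; field.
Qed.

Lemma ae_parity c w1 w2 : {ae leb, forall x, x != 0 -> w1 x = w2 x} <->
  forall b, {ae leb, forall y, parity c b w1 y = parity c b w2 y}.
Proof.
rewrite (ae_Rx_exp (fun x => w1 x = w2 x)); split=> [h b|h].
  apply: ae_lebS h => y [h1 h2]; rewrite /parity /logside expr0 expr1 mul1r mulN1r.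
  by rewrite h1 h2.
apply: ae_lebS2 (h false) (h true) => y h0 h1.
have [w1f w1t] := logside_parity c w1 y; have [w2f w2t] := logside_parity c w2 y.
have ef : logside c false w1 y = logside c false w2 y by rewrite w1f w2f h0 h1.
have et : logside c true w1 y = logside c true w2 y by rewrite w1t w2t h0 h1.
split; apply: (mulfI (expC_neq0 ((c + 1) * y / 2))).
  by move: ef; rewrite /logside expr0 mul1r.
by move: et; rewrite /logside expr1 mulN1r.
Qed.

Lemma L2w0 c : L2w c (fun=> 0 : R[i]).
Proof.
apply/L2w_logside => b; rewrite (_ : logside c b _ = fun=> 0); first exact: L2R0.
by apply/funext => y; rewrite /logside mulr0.
Qed.

Lemma parity0 c b y : parity c b (fun=> 0) y = 0.
Proof. by rewrite /parity /logside !mulr0 addr0. Qed.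

End log_coordinates.

(** * Equation (E) as a pair of convolution equations *)

Section moving_average.
Context {R : realType} {d} {T : measurableType d}.
Notation leb := (@lebesgue_measure R).
Variables (mu : {sigma_finite_measure set T -> \bar R}) (f : T -> R) (c beta : R) (sgn_u : bool).
Hypothesis mf : measurable_fun setT f.
Hypothesis hint :
  (\int[mu]_(s in supp f) (`|f s| `^ (beta + (c - 1) / 2))%:E < +oo)%E.
Implicit Types (v w : R -> R[i]) (b : bool).

Let tau (t : T) : R := ln `|f t|.
Let coef (t : T) : R := uf sgn_u beta (f t) * `|f t| `^ ((c - 1) / 2).

(** The indicator extends the integration from [supp f] to the whole space. On [supp f] the modulus
    is [|f|^(beta + (c-1)/2)], so the integrability condition is integrability of this kernel. *)
Definition par_kernel b (t : T) : R[i] :=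
  (\1_(supp f) t)%:C * (coef t * (if b then Num.sg (f t) else 1))%:C.

Local Notation h := par_kernel.
Local Notation m b := (chf mu (h b) tau).
Local Notation K b := (convop mu (h b) tau).

Let msupp : measurable (supp f).
Proof.
rewrite (_ : supp f = setT `&` f @^-1` (~` [set 0])).
  by apply: mf => //; apply: measurableC; exact: measurable_set1.
by apply/seteqP; split => t /=; rewrite /supp/=; [move=> /eqP|move=> [_ /eqP]].
Qed.

Let mtau : measurable_fun setT tau.
Proof.
apply: (measurableT_comp (@measurable_ln R)).
exact: (measurableT_comp (@normr_measurable R setT) mf).
Qed.

Let msg : measurable_fun setT (fun t => Num.sg (f t)).
Proof.
rewrite (_ : (fun t => _) = (fun t => (if 0 < f t then 1 else 0) + (if f t < 0 then -1 else 0))).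
  by apply: measurable_funD; apply: measurable_fun_ifT => //; exact: measurable_fun_ltr.
apply/funext => t; case: (ltrgt0P (f t)) => [p|n|->]; last by rewrite sgr0 addr0.
  by rewrite gtr0_sg// addr0.
by rewrite ltr0_sg// add0r.
Qed.

Let mcoef : measurable_fun setT coef.
Proof.
have mabs : measurable_fun setT (fun t => `|f t|).
  exact: (measurableT_comp (@normr_measurable R setT) mf).
apply: measurable_funM; last exact: (measurableT_comp (measurable_powR _) mabs).
apply: measurable_funM; last exact: (measurableT_comp (measurable_powR _) mabs).
by case: sgn_u => //; exact: msg.
Qed.

Lemma cintegrable_par_kernel b : cintegrable mu setT (h b).
Proof.
apply: (cintegrable_mkcond mu
  (fun t => (coef t * (if b then Num.sg (f t) else 1))%:C) msupp).1.
have mpow : measurable_fun setT (fun t => `|f t| `^ (beta + (c - 1) / 2)).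
  apply: (measurableT_comp (measurable_powR _)).
  exact: (measurableT_comp (@normr_measurable R setT) mf).
apply: (@le_cintegrable _ _ _ mu _ _ (fun t => `|f t| `^ (beta + (c - 1) / 2))) => //.
- have := @cmeasurableR _ _ _ setT (fun t => coef t * (if b then Num.sg (f t) else 1)).
  case=> [|m1 m2]; last by split; exact: measurable_funTS.
  by apply: measurable_funM => //; case: b.
- apply/integrableP; split; first by apply/measurable_EFinP; exact: measurable_funTS.
  by under eq_integral do rewrite gee0_abs ?lee_fin ?powR_ge0//.
- move=> t ft; rewrite cabsR normrM.
  have -> : `|if b then Num.sg (f t) else 1| = 1.
    by case: b; rewrite ?normr1// normr_sg ft.
  rewrite mulr1 /coef /uf !normrM.
  have -> : `|if sgn_u then Num.sg (f t) else 1| = 1.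
    by case: sgn_u; rewrite ?normr1// normr_sg ft.
  rewrite mul1r !(ger0_norm (powR_ge0 _ _)) -powRD//.
  by rewrite normr_eq0 ft implybT.
Qed.

Lemma mfpE x : mfp mu f sgn_u beta c x = m false x.
Proof.
rewrite /mfp Cint_mkcond; apply: Cint_eq => t _.
by rewrite /par_kernel mulr1 mulrA.
Qed.

Lemma mfmE x : mfm mu f sgn_u beta c x = m true x.
Proof.
rewrite /mfm Cint_mkcond; apply: Cint_eq => t _.
have realcM (r s : R) : (r * s)%:C = r%:C * s%:C by rewrite rmorphM.
rewrite /par_kernel [in RHS]realcM -/(coef t).
move: (real_complex _ (\1_(supp f) t)) (real_complex _ (coef t)) => A B.
by move: (real_complex _ _) (expi _) => C D; ring.
Qed.

(** Dividing [x] by [f t] shifts the logarithm by [tau t] and exchanges the half-lines when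
    [f t < 0]. The weight contributes [|f t|^((c+1)/2)] and the kernel takes one power back, which
    leaves the exponent [(c-1)/2] of [coef]. *)
Lemma logside_Ekernel b w y t : f t != 0 ->
  logside c b (fun x => Ekernel f sgn_u beta w x t) y =
  (coef t)%:C * logside c (b (+) (f t < 0)) w (y - tau t).
Proof.
move=> ft; have a0 : 0 < `|f t| by rewrite normr_gt0.
have realcM (r s : R) : (r * s)%:C = r%:C * s%:C by rewrite rmorphM.
rewrite /logside /Ekernel !mulrA -!realcM; congr (_%:C * w _).
  rewrite /coef /tau; set u := uf _ _ _.
  have -> : expR ((c + 1) * y / 2) =
      expR ((c + 1) * (y - ln `|f t|) / 2) * `|f t| `^ ((c + 1) / 2).
    by rewrite /powR gt_eqF// -expRD; congr expR; field.
  have -> : `|f t| `^ ((c + 1) / 2) = `|f t| `^ ((c - 1) / 2) * `|f t|.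
    rewrite -{3}[`|f t|]powRr1 ?normr_ge0// -powRD; last by rewrite normr_eq0 ft implybT.
    by congr (_ `^ _); field.
  by field; rewrite normr_eq0.
rewrite /tau expRD expRN lnK ?posrE// signr_addb -!mulrA; congr (_ * _).
rewrite mulrCA; congr (_ * _).
by case: (ltrgt0P (f t)) ft => // h0 _; rewrite /= ?expr0 ?expr1 ?mul1r// invrN mulrN mulN1r opprK.
Qed.

(** Exchanging the half-lines fixes the even part and negates the odd part. The sign factor in
    [par_kernel] records this, so the two parities decouple. *)
Lemma parity_Ekernel b w y t :
  (\1_(supp f) t)%:C * parity c b (fun x => Ekernel f sgn_u beta w x t) y =
  h b t * parity c b w (y - tau t).
Proof.
have realcM (r s : R) : (r * s)%:C = r%:C * s%:C by rewrite rmorphM.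
rewrite /par_kernel indicE; have [ft|] := boolP (t \in supp f); last by rewrite !mul0r.
rewrite inE /supp/= in ft; rewrite -[RHS]mulrA; congr (_ * _).
rewrite /parity !logside_Ekernel//= (realcM (coef t)).
have sE : ((if b then Num.sg (f t) else 1)%:C : R[i]) = (-1) ^+ (b && (f t < 0)).
  case: b => //=; case: (ltrgt0P (f t)) ft => // h0 _.
    by rewrite gtr0_sg.
  by rewrite ltr0_sg//= expr1 (rmorphN1 (real_complex R)).
rewrite {}sE; move: (real_complex _ (coef t)) => A.
case: (f t < 0); case: b => /=; rewrite ?expr0 ?expr1; ring.
Qed.

(** For almost every [y] both parity integrands are integrable because [w] is in L2. At such [y] the
    integrands at [expR y] and [- expR y] are invertible combinations of them, which transfers both
    the integrability clause of [solvesE] and the two equations. *)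
Lemma solvesE_parity v w : L2w c w -> solvesE mu f sgn_u beta v w <->
  forall b, {ae leb, forall y, parity c b v y = K b (parity c b w) y}.
Proof.
move=> hw.
pose Q x := cintegrable mu (supp f) (Ekernel f sgn_u beta w x) /\
     v x = Cint mu (supp f) (Ekernel f sgn_u beta w x).
have I b : {ae leb, forall y, cintegrable mu setT (fun t => h b t * parity c b w (y - tau t))}.
  exact: (ae_cintegrable_convop (cintegrable_par_kernel b) mtau (L2R_parity b hw)).
have key y : cintegrable mu setT (fun t => h false t * parity c false w (y - tau t)) ->
    cintegrable mu setT (fun t => h true t * parity c true w (y - tau t)) ->
    (Q (expR y) /\ Q (- expR y)) <-> forall b, parity c b v y = K b (parity c b w) y.
  move=> i0 i1; pose E : R[i] := (expR ((c + 1) * y / 2))%:C.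
  have E0 : E != 0 by exact: expC_neq0.
  have two : (2 : R[i]) != 0 by rewrite pnatr_eq0.
  pose k0 t := (\1_(supp f) t)%:C * Ekernel f sgn_u beta w (expR y) t.
  pose k1 t := (\1_(supp f) t)%:C * Ekernel f sgn_u beta w (- expR y) t.
  have hE b t : h b t * parity c b w (y - tau t) = E * k0 t + (-1) ^+ b * (E * k1 t).
    rewrite -parity_Ekernel /parity /logside expr0 expr1 mul1r mulN1r /k0 /k1 -/E.
    by move: (real_complex _ (\1_(supp f) t)) => A; ring.
  have ki0 : cintegrable mu setT k0.
    rewrite (_ : k0 = fun t => (2 * E)^-1 * (h false t * parity c false w (y - tau t) +
        h true t * parity c true w (y - tau t))).
      by apply: cintegrableZ => //; exact: cintegrableD.
    by apply/funext => t; rewrite !hE expr0 expr1; field; rewrite E0.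
  have ki1 : cintegrable mu setT k1.
    rewrite (_ : k1 = fun t => (2 * E)^-1 * (h false t * parity c false w (y - tau t) -
        h true t * parity c true w (y - tau t))).
      by apply: cintegrableZ => //; exact: cintegrableB.
    by apply/funext => t; rewrite !hE expr0 expr1; field; rewrite E0.
  have KE b : K b (parity c b w) y = E * Cint mu setT k0 + (-1) ^+ b * (E * Cint mu setT k1).
    rewrite /convop -!CintZ//; last exact: cintegrableZ.
    rewrite -CintD//; last 2 first.
    - exact: cintegrableZ.
    - by apply: cintegrableZ => //; exact: cintegrableZ.
    by apply: Cint_eq => t _; exact: hE.
  have C0 : Cint mu (supp f) (Ekernel f sgn_u beta w (expR y)) = Cint mu setT k0.
    exact: Cint_mkcond.
  have C1 : Cint mu (supp f) (Ekernel f sgn_u beta w (- expR y)) = Cint mu setT k1.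
    exact: Cint_mkcond.
  have vE b : parity c b v y = E * v (expR y) + (-1) ^+ b * (E * v (- expR y)).
    by rewrite /parity /logside expr0 expr1 mul1r mulN1r.
  rewrite /Q C0 C1; split=> [[[_ q0] [_ q1]] b|q]; first by rewrite vE KE q0 q1.
  have := q false; have := q true; rewrite !vE !KE expr0 expr1 => q1 q0.
  have e0 : v (expR y) = Cint mu setT k0.
    apply: (mulfI (mulf_neq0 two E0)).
    have := congr2 +%R q0 q1; move: (Cint _ _ _) (Cint _ _ _) => A B.
    by move=> /eqP; rewrite -subr_eq0 => /eqP hh; apply/eqP; rewrite -subr_eq0 -hh; apply/eqP; ring.
  have e1 : v (- expR y) = Cint mu setT k1.
    apply: (mulfI E0); move: q0; rewrite e0 !mul1r.
    by move/addrI.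
  by split; split => //; apply/cintegrable_mkcond.
rewrite /solvesE -/Q (ae_Rx_exp Q); split=> [hQ b|hK].
- have := ae_lebS2 (fun y i0 i1 => conj i0 i1) (I false) (I true).
  by move=> hI; apply: ae_lebS2 hQ hI => y q [i0 i1]; exact: ((key y i0 i1).1 q).
- have hI := ae_lebS2 (fun y i0 i1 => conj i0 i1) (I false) (I true).
  have hKK := ae_lebS2 (fun y i0 i1 => conj i0 i1) (hK false) (hK true).
  apply: ae_lebS2 hI hKK => y [i0 i1] [q0 q1]; apply/(key y i0 i1).
  by case.
Qed.

Lemma solvesE_unique :
  (forall v w1 w2, L2w c v -> L2w c w1 -> L2w c w2 ->
    solvesE mu f sgn_u beta v w1 -> solvesE mu f sgn_u beta v w2 ->
    {ae leb, forall x, x != 0 -> w1 x = w2 x}) <->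
  forall b, {ae leb, forall xi, m b xi != 0}.
Proof.
have hk := cintegrable_par_kernel.
split=> [uniq b|m0 v w1 w2 hv hw1 hw2].
- apply/(convop_injective (hk b) mtau) => phi hphi K0.
  (* An element of the kernel placed in parity [b] alone gives a second solution for the right-hand
     side 0. *)
  have [|w hw wE] := @parity_surj _ c (fun b' => if b' == b then phi else fun=> 0).
    by move=> b'; case: ifP => // _; exact: L2R0.
  have parE b' : parity c b' w = if b' == b then phi else fun=> 0.
    by apply/funext => y; rewrite wE.
  have s0 : solvesE mu f sgn_u beta (fun=> 0) (fun=> 0).
    apply/(solvesE_parity _ (L2w0 c)) => b'; apply: nearW => y.
    rewrite parity0 (_ : parity c b' _ = fun=> 0) ?convop0//.
    by apply/funext => x; rewrite parity0.
  have s1 : solvesE mu f sgn_u beta (fun=> 0) w.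
    apply/(solvesE_parity _ hw) => b'; rewrite parE; case: eqP => [->|_].
      by apply: ae_lebS K0 => y ->; rewrite parity0.
    by apply: nearW => y; rewrite parity0 convop0.
  have /(ae_parity c)/(_ b) := uniq _ _ _ (L2w0 c) hw (L2w0 c) s1 s0.
  by apply: ae_lebS => y; rewrite parity0 parE eqxx.
- move=> /(solvesE_parity _ hw1) s1 /(solvesE_parity _ hw2) s2.
  apply/(ae_parity c) => b.
  have h1 := L2R_parity b hw1; have h2 := L2R_parity b hw2.
  have K0 : {ae leb, forall y, K b (fun x => parity c b w1 x - parity c b w2 x) y = 0}.
    have Ks := ae_lebS2 (fun y i0 i1 => conj i0 i1) (s1 b) (s2 b).
    apply: ae_lebS2 (convopB (hk b) mtau h1 h2) Ks => y -> [<- <-].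
    by rewrite subrr.
  have := (convop_injective (hk b) mtau).2 (m0 b) _ (L2RB h1 h2) K0.
  by apply: ae_lebS => y /eqP; rewrite subr_eq0 => /eqP.
Qed.

Lemma solvesE_exists :
  (forall v, L2w c v -> exists w, L2w c w /\ solvesE mu f sgn_u beta v w) <->
  forall b, 0 < inf (range (fun x => cabs (m b x))).
Proof.
have hk := cintegrable_par_kernel.
split=> [ex b|i0 v hv].
- apply/(convop_surjective (hk b) mtau) => phi hphi.
  have [v hv vE] := @parity_surj _ c (fun=> phi) (fun=> hphi).
  have [w [hw /(solvesE_parity _ hw)/(_ b) s]] := ex v hv.
  exists (parity c b w); first exact: L2R_parity.
  by apply: ae_lebS s => y <-; rewrite vE.
- have sol b := (convop_surjective (hk b) mtau).2 (i0 b) _ (L2R_parity b hv).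
  have [phi0 hphi0 E0] := sol false; have [phi1 hphi1 E1] := sol true.
  have [|w hw wE] := @parity_surj _ c (fun b => if b then phi1 else phi0); first by case.
  exists w; split => //; apply/(solvesE_parity _ hw) => b.
  rewrite (_ : parity c b w = if b then phi1 else phi0); last by apply/funext => y; rewrite wE.
  by case: b.
Qed.

(** The Sobolev hypothesis concerns the two half-lines, the convolution equations the two parities.
    The transforms combine linearly, and [|V0 + V1|^2] and [|V0 - V1|^2] are at most
    [2 |V0|^2 + 2 |V1|^2], so the weighted integral stays finite. *)
Lemma solvesE_Hsob (alpha gamma : R) v : 0 <= alpha -> 0 < gamma ->
  (forall b x, gamma / (1 + `|x| `^ alpha) <= cabs (m b x)) ->
  L2w c v -> (forall b, Hsob alpha (logside c b v)) ->
  exists2 w, L2w c w & solvesE mu f sgn_u beta v w.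
Proof.
move=> a0 g0 mge hv hs; have hk := cintegrable_par_kernel.
have [V0 F0 [hV0 iV0]] := Hsob_is_FT (hs false).
have [V1 F1 [hV1 iV1]] := Hsob_is_FT (hs true).
have mw : measurable_fun setT (fun x : R => (1 + x ^+ 2) `^ alpha).
  by apply: (measurableT_comp (measurable_powR alpha)); apply: measurable_funD => //; exact: measurable_funX.
have mV (V : R -> R[i]) : L2R V ->
    measurable_fun setT (fun x : R => (cabs (V x) ^+ 2 * (1 + x ^+ 2) `^ alpha)%:E).
  move=> [mV _]; apply/measurable_EFinP; apply: measurable_funM => //.
  by apply/measurable_EFinP; exact: cmeasurable_cabs2.
have wpos (V : R -> R[i]) x : (0 <= (cabs (V x) ^+ 2 * (1 + x ^+ 2) `^ alpha)%:E)%E.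
  by rewrite lee_fin mulr_ge0 ?sqr_ge0 ?powR_ge0.
have sol b : exists2 phi, L2R phi & {ae leb, forall y, parity c b v y = K b phi y}.
  have hV : L2R (fun x => V0 x + (-1) ^+ b * V1 x) by apply: L2RD => //; exact: L2RZ.
  apply: (convop_solvable_weighted (hk b) mtau a0 g0 (mge b) (is_FTD F0 (is_FTZ _ F1)) hV).
  apply: (@le_lt_trans _ _ (\int[leb]_x (2%:E * (cabs (V0 x) ^+ 2 * (1 + x ^+ 2) `^ alpha)%:E +
      2%:E * (cabs (V1 x) ^+ 2 * (1 + x ^+ 2) `^ alpha)%:E))%E).
    apply: ge0_le_integral => //.
    - by move=> x _; exact: (wpos (fun x => V0 x + (-1) ^+ b * V1 x)).
    - exact: mV.
    - by apply: emeasurable_funD; apply: measurable_funeM; exact: mV.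
    - move=> x _; rewrite -!EFinM -EFinD lee_fin.
      rewrite [leRHS](_ : _ = (2 * cabs (V0 x) ^+ 2 + 2 * cabs (V1 x) ^+ 2) * (1 + x ^+ 2) `^ alpha); last by ring.
      apply: ler_wpM2r; first exact: powR_ge0.
      have c1 : cabs (1 : R[i]) = 1 by rewrite (cabsR 1) normr1.
      apply: le_trans (cabs_sqD_le _ _) _; rewrite cabsM (_ : cabs ((-1) ^+ b) = 1) ?mul1r//.
      by case: b {hV}; rewrite ?expr1 ?expr0 ?cabsN.
  rewrite ge0_integralD//.
  - by rewrite !ge0_integralZl// ?lte_add_pinfty// ?lte_mul_pinfty//; exact: mV.
  - by move=> x _; rewrite mule_ge0.
  - by apply: measurable_funeM; exact: mV.
  - by move=> x _; rewrite mule_ge0.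
  - by apply: measurable_funeM; exact: mV.
have [phi0 hphi0 E0] := sol false; have [phi1 hphi1 E1] := sol true.
have [|w hw wE] := @parity_surj _ c (fun b => if b then phi1 else phi0); first by case.
exists w => //; apply/(solvesE_parity _ hw) => b.
rewrite (_ : parity c b w = if b then phi1 else phi0); last by apply/funext => y; rewrite wE.
by case: b.
Qed.

Theorem moving_average_inversion :
  let mp := mfp mu f sgn_u beta c in
  let mm := mfm mu f sgn_u beta c in
  ((forall v w1 w2 : R -> R[i], L2w c v -> L2w c w1 -> L2w c w2 ->
      solvesE mu f sgn_u beta v w1 -> solvesE mu f sgn_u beta v w2 ->
      {ae (@lebesgue_measure R), forall x, x != 0 -> w1 x = w2 x})
   <->
   ({ae (@lebesgue_measure R), forall x, mp x != 0} /\
    {ae (@lebesgue_measure R), forall x, mm x != 0}))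
  /\
  ((forall v : R -> R[i], L2w c v ->
      exists w : R -> R[i], L2w c w /\ solvesE mu f sgn_u beta v w)
   <->
   (0 < inf (range (fun x => cabs (mp x))) /\
    0 < inf (range (fun x => cabs (mm x)))))
  /\
  (forall alpha gamma : R, 0 <= alpha -> 0 < gamma ->
     (forall x : R, gamma / (1 + `|x| `^ alpha) <= cabs (mp x) /\
                    gamma / (1 + `|x| `^ alpha) <= cabs (mm x)) ->
     forall v : R -> R[i], L2w c v ->
     Hsob alpha (fun x => (expR ((c + 1) * x / 2))%:C * v (expR x)) ->
     Hsob alpha (fun x => (expR ((c + 1) * x / 2))%:C * v (- expR x)) ->
     exists w : R -> R[i], L2w c w /\ solvesE mu f sgn_u beta v w /\
       forall w' : R -> R[i], L2w c w' -> solvesE mu f sgn_u beta v w' ->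
         {ae (@lebesgue_measure R), forall x, x != 0 -> w' x = w x}).
Proof.
move=> mp mm.
have mpE : mp = m false by apply/funext => x; exact: mfpE.
have mmE : mm = m true by apply/funext => x; exact: mfmE.
rewrite mpE mmE; split; [|split].
- rewrite solvesE_unique; split=> [h|[h0 h1]]; first by split; exact: h.
  by case.
- rewrite solvesE_exists; split=> [h|[h0 h1]]; first by split; exact: h.
  by case.
- move=> alpha gamma a0 g0 mge v hv s0 s1.
  have mge' b x : gamma / (1 + `|x| `^ alpha) <= cabs (m b x).
    by have [] := mge x; case: b.
  have [b|w hw E] := solvesE_Hsob a0 g0 mge' hv.
    rewrite /logside; case: b; first by under eq_fun do rewrite expr1 mulN1r.
    by under eq_fun do rewrite expr0 mul1r.
  exists w; split => //; split => // w' hw' E'.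
  (* The lower bound makes both multipliers non-zero everywhere, so uniqueness is the sufficiency
     half of (a). *)
  apply: (solvesE_unique.2 _ v) => // b; apply: nearW => x.
  rewrite -cabs_gt0 (lt_le_trans _ (mge' b x))// divr_gt0//.
Qed.

End moving_average.

Theorem mainTheorem1 (R : realType) (d : nat) (hd : (0 < d)%N)
  (f : Rd R d -> R) (mf : measurable_fun setT f)
  (c beta : R) (hc : 0 <= c) (sgn_u : bool)
  (hint : (\int[lebd R d]_(s in supp f) (`|f s| `^ (beta + (c - 1) / 2))%:E < +oo)%E) :
  let mu := lebd R d in
  let mp := mfp mu f sgn_u beta c in
  let mm := mfm mu f sgn_u beta c in
  (* (a) *)
  ((forall v w1 w2 : R -> R[i], L2w c v -> L2w c w1 -> L2w c w2 ->
      solvesE mu f sgn_u beta v w1 -> solvesE mu f sgn_u beta v w2 ->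
      {ae (@lebesgue_measure R), forall x, x != 0 -> w1 x = w2 x})
   <->
   ({ae (@lebesgue_measure R), forall x, mp x != 0} /\
    {ae (@lebesgue_measure R), forall x, mm x != 0}))
  /\
  (* (b) *)
  ((forall v : R -> R[i], L2w c v ->
      exists w : R -> R[i], L2w c w /\ solvesE mu f sgn_u beta v w)
   <->
   (0 < inf (range (fun x => cabs (mp x))) /\
    0 < inf (range (fun x => cabs (mm x)))))
  /\
  (* (c) *)
  (forall alpha gamma : R, 0 <= alpha -> 0 < gamma ->
     (forall x : R, gamma / (1 + `|x| `^ alpha) <= cabs (mp x) /\
                    gamma / (1 + `|x| `^ alpha) <= cabs (mm x)) ->
     forall v : R -> R[i], L2w c v ->
     Hsob alpha (fun x => (expR ((c + 1) * x / 2))%:C * v (expR x)) ->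
     Hsob alpha (fun x => (expR ((c + 1) * x / 2))%:C * v (- expR x)) ->
     exists w : R -> R[i], L2w c w /\ solvesE mu f sgn_u beta v w /\
       forall w' : R -> R[i], L2w c w' -> solvesE mu f sgn_u beta v w' ->
         {ae (@lebesgue_measure R), forall x, x != 0 -> w' x = w x}).
Proof. exact: moving_average_inversion. Qed.
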